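(* Let $\lambda\in\mathbb C$ and $r\in\mathbb Z$. Then: (1) $H^i_{\rm DS}(\Pi(0))=\delta_{i,0}\,\mathbb C\mathbf 1$; (2) $H^i_{\rm DS}(\Pi(\lambda))=\delta_{i,0}\,\mathbb Ce^{\lambda(\alpha+\beta)}$; (3) $H_{\rm DS}(\Pi_r(\lambda))=0$ if $r\neq0$.
   Context: Let $p\in\mathbb Z_{\ge2}$, $k=-2+\frac1p$. Let $\mathbb Cc\oplus\mathbb Cd$ carry the form $\langle c,c\rangle=\langle d,d\rangle=0$, $\langle c,d\rangle=2$, and let $\mu=\frac12d+\frac k4c$, so $\langle\mu,c\rangle=1$. (In the paper's free field realization $c=\alpha+\beta$.) $\Pi(0)=M_{c,d}(1)\otimes\mathbb C[\mathbb Zc]$, where $M_{c,d}(1)$ is the rank two Heisenberg vertex algebra; it is a vertex algebra. Its modules are $\Pi_r(\lambda)=\Pi(0).e^{r\mu+\lambda c}$ and $\Pi(\lambda)=\Pi_0(\lambda)$. Drinfeld–Sokolov reduction: $V(\mathfrak n)$ is the vertex subalgebra of the affine vertex algebra of $\mathfrak{sl}_2$ at level $k$ generated by $e(z)$, and it maps to $\Pi(0)$ by $e\mapsto e^c$. Let $F=V_{\mathbb Z\phi}$, $\langle\phi,\phi\rangle=1$, be the fermionic lattice vertex superalgebra with charge grading $F=\bigoplus_{i}F^i$ in which $e^{\pm\phi}$ has charge $\pm1$. For a $V(\mathfrak n)$-module $N$, $C^i(N)=N\otimes F^i$, with differential the zero mode $d_{{\rm DS}(0)}=\mathrm{Res}_zY(d_{\rm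 DS},z)$ of $d_{\rm DS}=(e+\mathbf 1)\otimes e^\phi$; $H^\bullet_{\rm DS}(N)$ is the cohomology of $(C^\bullet(N),d_{{\rm DS}(0)})$, and $H_{\rm DS}(N)=\bigoplus_iH^i_{\rm DS}(N)$. *)

(* Defs.v *)
From HB Require Import structures.
From mathcomp Require Import all_boot all_order all_algebra.
From mathcomp Require Import finmap multiset monalg complex.
From mathcomp Require Import boolp classical_sets cardinality fsbigop reals.

Set Implicit Arguments.
Unset Strict Implicit.
Unset Printing Implicit Defensive.

Import GRing.Theory.

Local Open Scope ring_scope.
Local Open Scope quotient_scope.

Section LinearExtension.
Context (C : fieldType) (K : choiceType) (V : lmodType C).
Variable f : K -> V.

Definition lin_ext (x : {malg C[K]}) : V := \sum_(k <- msupp x) x@_k *: f k.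

Lemma lin_extEw (D : {fset K}) (x : {malg C[K]}) :
  (msupp x `<=` D)%fset -> lin_ext x = \sum_(k <- D) x@_k *: f k.
Proof.
move=> sxD; rewrite /lin_ext; apply: big_fset_incl => // k _ kNx.
by rewrite mcoeff_outdom // scale0r.
Qed.

Lemma lin_ext_is_linear : linear lin_ext.
Proof.
move=> a x y; pose D := (msupp (a *: x + y) `|` (msupp x `|` msupp y))%fset.
rewrite !(@lin_extEw D) /D.
- rewrite scaler_sumr -big_split /=; apply: eq_bigr => k _.
  by rewrite mcoeffD mcoeffZ scalerDl scalerA.
- by apply: fsubset_trans (fsubsetUr _ _); exact: fsubsetUr.
- by apply: fsubset_trans (fsubsetUr _ _); exact: fsubsetUl.
- exact: fsubsetUl.
Qed.

HB.instance Definition _ :=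
  GRing.isLinear.Build C {malg C[K]} V *:%R lin_ext lin_ext_is_linear.

End LinearExtension.

(* {malg C[A * B]} models the tensor product of the free modules {malg C[A]}
   and {malg C[B]}. *)
Definition tens (C : fieldType) (A B : choiceType)
    (x : {malg C[A]}) (y : {malg C[B]}) : {malg C[(A * B)%type]} :=
  lin_ext (fun a => lin_ext (fun b => << (a, b) >>) y) x.

Section SubQuotient.
Context (C : fieldType) (V : lmodType C) (Z B : submodClosed V).

Definition subspace_of : Type := {x : V | x \in Z}.
HB.instance Definition _ := SubChoice.on subspace_of.
HB.instance Definition _ := [SubChoice_isSubLmodule of subspace_of by <:].

Definition rel_pred : {pred subspace_of} := [pred x | val x \in B].

Fact rel_pred_closed : zmod_closed rel_pred.
Proof.
split=> [|x y]; rewrite !inE; first by rewrite raddf0; exact: rpred0.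
by move=> xB yB; rewrite raddfB -scaleN1r rpredD ?rpredZ.
Qed.
HB.instance Definition _ :=
  GRing.isZmodClosed.Build subspace_of rel_pred rel_pred_closed.

(* The quotient of Z by Z :&: B, as a vector space. *)
Definition subquot : Type := Quotient.quot rel_pred.
HB.instance Definition _ := GRing.Zmodule.on subquot.

Definition subquot_pi : subspace_of -> subquot := \pi_(Quotient.quot rel_pred).

Let subquot_scale (a : C) (q : subquot) : subquot := subquot_pi (a *: repr q).

Fact subquot_eqP (x y : subspace_of) :
  (subquot_pi x == subquot_pi y) = (val x - val y \in B).
Proof.
rewrite /subquot_pi -Quotient.idealrBE -[LHS]/(val (x - y) \in B).
by rewrite raddfB.
Qed.

Fact subquot_pi_is_zmod_morphism : zmod_morphism subquot_pi.
Proof. exact: raddfB. Qed.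
HB.instance Definition _ := GRing.isZmodMorphism.Build subspace_of subquot
  subquot_pi subquot_pi_is_zmod_morphism.

Fact subquot_scaleE a x : subquot_scale a (subquot_pi x) = subquot_pi (a *: x).
Proof.
apply/eqP; rewrite subquot_eqP !GRing.valZ -scalerBr rpredZ //.
by rewrite -subquot_eqP /subquot_pi reprK.
Qed.

Fact subquot_scaleA a b v :
  subquot_scale a (subquot_scale b v) = subquot_scale (a * b) v.
Proof. by rewrite {2}/subquot_scale subquot_scaleE scalerA. Qed.

Fact subquot_reprK v : subquot_pi (repr v) = v. Proof. exact: reprK. Qed.

Fact subquot_scale1 : left_id 1 subquot_scale.
Proof. by move=> v; rewrite /subquot_scale scale1r subquot_reprK. Qed.

Fact subquot_scaleDr : right_distributive subquot_scale +%R.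
Proof.
move=> a v w; rewrite -[v]subquot_reprK -[w]subquot_reprK -raddfD.
by rewrite !subquot_scaleE scalerDr raddfD.
Qed.

Fact subquot_scaleDl v : {morph subquot_scale^~ v : a b / a + b}.
Proof. by move=> a b; rewrite /subquot_scale scalerDl raddfD. Qed.

HB.instance Definition _ := GRing.Zmodule_isLmodule.Build C subquot
  subquot_scaleA subquot_scale1 subquot_scaleDr subquot_scaleDl.

End SubQuotient.

Section LatticeFock.
Context (C : fieldType) (l : nat) (G : 'M[C]_l).

(* For the l-dimensional space h with Gram matrix G, M(1) (x) C[h] has basis
   h_{j1}(-m1-1) ... h_{js}(-ms-1) e^beta, encoded as the multiset of the
   letters (j, m) together with beta.  Every Heisenberg or lattice vertex
   algebra and module below is the subspace with weights beta in a coset. *)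
Definition fock_basis : choiceType := ({mset 'I_l * nat}%mset * 'rV[C]_l)%type.
Definition fock : lmodType C := {malg C[fock_basis]}.

Definition pairing (x y : 'rV[C]_l) : C := (x *m G *m y^T) 0 0.

Definition expv (beta : 'rV[C]_l) : fock := << (mset0, beta) : fock_basis >>.

(* Right multiplication by e^nu in the algebra M(1) (x) C[h]. *)
Definition mul_expv (nu : 'rV[C]_l) : fock -> fock :=
  lin_ext (fun b : fock_basis => << (b.1, b.2 + nu) : fock_basis >>).

Definition heis_basis (h : 'rV[C]_l) (n : int) (b : fock_basis) : fock :=
  match n with
  | Negz m =>
      \sum_(j < l) h 0 j *: << ((j, m) +` b.1, b.2)%mset : fock_basis >>
  | Posz 0 => pairing h b.2 *: << b >>
  | Posz m.+1 =>
      \sum_(j < l) (m.+1%:R * pairing h (delta_mx 0 j) * (b.1 (j, m))%:R) *: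
        << (b.1 `\ (j, m), b.2)%mset : fock_basis >>
  end.

(* The Heisenberg mode h(n), with [h(m), h'(n)] = m <h, h'> delta_{m+n,0}. *)
Definition heis (h : 'rV[C]_l) (n : int) : fock -> fock :=
  lin_ext (heis_basis h n).

(* Coefficient of z^n in exp (\sum_(m >= 1) a m z^m), for commuting a m. *)
Definition exp_coef (a : nat -> fock -> fock) (n : nat) (v : fock) : fock :=
  \sum_(s < n.+1) (s`!%:R)^-1 *:
    \sum_(t : s.-tuple 'I_n | (\sum_(i <- t) i.+1)%N == n)
      foldr (fun i : 'I_n => a i.+1) v t.

(* Modes Y(e^gamma, z) = \sum_n e^gamma_(n) z^(-n-1) of
     e^gamma z^gamma(0) exp (\sum_(m >= 1) gamma(-m) z^m / m)
                        exp (- \sum_(m >= 1) gamma(m) z^-m / m);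
   the term of index (s, t) contributes z^(s - t + <gamma, beta>) on weight
   beta.  The lattices used below, Zc and Z phi, admit the trivial cocycle.
   Infinite sums over \in are finitely supported on each vector. *)
Definition Yexp_basis (gamma : 'rV[C]_l) (n : int) (b : fock_basis) : fock :=
  \sum_(st \in [set st : nat * nat |
      st.1%:R - st.2%:R + pairing gamma b.2 = (- n - 1)%:~R]%classic)
    mul_expv gamma
      (exp_coef (fun m => m%:R^-1 \*: heis gamma (- m%:Z)) st.1
        (exp_coef (fun m => - m%:R^-1 \*: heis gamma m%:Z) st.2 << b >>)).

(* Modes of the normally ordered product of the fields
   (1 / m!) (d/dz)^m h_j(z), for (j, m) in s, and of Y(e^gamma, z): expanding
   :A B: with A(z) = (1 / m!) (d/dz)^m h_j(z) puts the h_j(-m-1-i) on the left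
   and the h_j(i), i >= 0, on the right. *)
Fixpoint Yword (gamma : 'rV[C]_l) (s : seq ('I_l * nat)) (n : int)
    (v : fock) : fock :=
  match s with
  | [::] => lin_ext (Yexp_basis gamma n) v
  | (j, m) :: s' =>
      \sum_(i \in [set: nat]%classic) ('C(m + i, m))%:R *:
        (heis (delta_mx 0 j) (- (m + i).+1%:Z) (Yword gamma s' (n + i%:Z) v)
         + (-1) ^+ m *:
           Yword gamma s' (n - (m + i).+1%:Z) (heis (delta_mx 0 j) i%:Z v))
  end.

(* a_(n) v, where Y(a, z) = \sum_n a_(n) z^(-n-1). *)
Definition Ymode (a : fock) (n : int) (v : fock) : fock :=
  lin_ext (fun b : fock_basis => Yword b.2 (enum_mset b.1) n v) a.

End LatticeFock.

Section DrinfeldSokolov.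
Context (C : fieldType).

Definition cv : 'rV[C]_2 := delta_mx 0 0.
Definition dv : 'rV[C]_2 := delta_mx 0 1.
Definition cd_gram : 'M[C]_2 := \matrix_(i, j) (if i == j then 0 else 2).
Definition muv (k : C) : 'rV[C]_2 := 2^-1 *: dv + (k / 4) *: cv.

(* Pi(0) = M_{c,d}(1) (x) C[Zc]. *)
Definition Pi0 : set (fock C 2) :=
  [set x | forall b, b \in msupp x -> exists n : int, b.2 = n%:~R *: cv]%classic.

(* Pi_r(lambda) = Pi(0) . e^(r mu + lambda c). *)
Definition Pi (k : C) (r : int) (lambda : C) : set (fock C 2) :=
  (mul_expv (r%:~R *: muv k + lambda *: cv) @` Pi0)%classic.

Definition phi : 'rV[C]_1 := const_mx 1.
Definition phi_gram : 'M[C]_1 := 1%:M.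

(* The charge i part of F = V_(Z phi). *)
Definition Fcharge (i : int) : set (fock C 1) :=
  [set y | forall b, b \in msupp y -> b.2 = i%:~R *: phi]%classic.

Definition fock2 : lmodType C := {malg C[(fock_basis C 2 * fock_basis C 1)%type]}.

(* (a (x) b)_(n) (u (x) v) = \sum_i a_(i) u (x) b_(n-1-i) v; there is no Koszul
   sign since u is always even. *)
Definition Ymode2 (a : fock2) (n : int) : fock2 -> fock2 :=
  lin_ext (fun uv : fock_basis C 2 * fock_basis C 1 =>
    lin_ext (fun ab : fock_basis C 2 * fock_basis C 1 =>
      \sum_(i \in [set: int]%classic)
        tens (Ymode cd_gram << ab.1 >> i << uv.1 >>)
             (Ymode phi_gram << ab.2 >> (n - 1 - i) << uv.2 >>)) a).

(* The image of (e + 1) (x) e^phi under e |-> e^c. *)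
Definition d_DS : fock2 := tens (expv cv + expv 0) (expv phi).

Definition d_DS0 : fock2 -> fock2 := Ymode2 d_DS 0.

Fact d_DS0P a x y : d_DS0 (a *: x + y) = a *: d_DS0 x + d_DS0 y.
Proof. exact: lin_ext_is_linear. Qed.

Fact d_DS0_0 : d_DS0 0 = 0.
Proof. exact: raddf0. Qed.

Section Cohomology.
(* A subspace N stable under the modes of Y(e^c, z), hence a module for the
   vertex subalgebra generated by e(z) via e |-> e^c. *)
Variable N : set (fock C 2).

(* C^i(N) = N (x) F^i. *)
Definition cochains (i : int) : set fock2 :=
  [set x | exists2 s : seq (fock C 2 * fock C 1),
     forall q, q \in s -> N q.1 /\ Fcharge i q.2 &
     x = \sum_(q <- s) tens q.1 q.2]%classic.

Lemma cochains_closed i a x y :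
  cochains i x -> cochains i y -> cochains i (a *: x + y).
Proof.
move=> [s sP ->] [t tP ->].
exists ([seq (q.1, a *: q.2) | q <- s] ++ t) => [q|].
  rewrite mem_cat => /orP[/mapP[q' /sP[Nq Fq] ->]|/tP //]; split=> //= b bq.
  apply: Fq; move: bq; rewrite -!mcoeff_neq0 mcoeffZ.
  by apply: contra_neq => ->; rewrite mulr0.
rewrite big_cat big_map /= scaler_sumr; congr (_ + _).
apply: eq_bigr => q _; rewrite /tens /lin_ext scaler_sumr.
apply: eq_bigr => u _; rewrite scalerA mulrC -scalerA; congr (_ *: _).
by rewrite -/(lin_ext _ _) -/(lin_ext _ (a *: q.2)) linearZ.
Qed.

Lemma cochains0 i : cochains i 0.
Proof. by exists [::]; rewrite // big_nil. Qed.

Definition cocycles (i : int) : {pred fock2} :=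
  [pred x | `[< cochains i x /\ d_DS0 x = 0 >]].

Definition coboundaries (i : int) : {pred fock2} :=
  [pred x | `[< exists2 y, cochains (i - 1) y & x = d_DS0 y >]].

Fact cocycles_closed i : submod_closed (cocycles i).
Proof.
split=> [|a x y].
  by apply/asboolP; split; [exact: cochains0 | exact: d_DS0_0].
move=> /asboolP[xC x0] /asboolP[yC y0]; apply/asboolP.
split; first exact: cochains_closed.
by rewrite d_DS0P x0 y0 scaler0 addr0.
Qed.
HB.instance Definition _ i :=
  GRing.isSubmodClosed.Build C fock2 (cocycles i) (cocycles_closed i).

Fact coboundaries_closed i : submod_closed (coboundaries i).
Proof.
split=> [|a x y].
  by apply/asboolP; exists 0; [exact: cochains0 | rewrite d_DS0_0].
move=> /asboolP[x' x'C ->] /asboolP[y' y'C ->]; apply/asboolP.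
exists (a *: x' + y'); first exact: cochains_closed.
by rewrite d_DS0P.
Qed.
HB.instance Definition _ i :=
  GRing.isSubmodClosed.Build C fock2 (coboundaries i) (coboundaries_closed i).

(* H^i_DS(N). *)
Definition H_DS (i : int) : lmodType C := subquot (cocycles i) (coboundaries i).

(* H_DS(N), the direct sum of the H^i_DS(N). *)
Definition H_DS_total : set (forall i, H_DS i) :=
  [set f | finite_set [set i | f i != 0]]%classic.

(* Junk value 0 when x is not a cocycle. *)
Definition DS_class (i : int) (x : fock2) : H_DS i :=
  subquot_pi (coboundaries i) (insubd (0 : subspace_of (cocycles i)) x).

(* H^i_DS(N) = delta_{i,0} C v for all i, with v (x) 1 a cocycle representing a
   nonzero class. *)
Definition H_DS_delta0_line (v : fock C 2) : Prop :=
  [/\ tens v (expv 0) \in cocycles 0,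
      DS_class 0 (tens v (expv 0)) != 0,
      [set: H_DS 0] = range (fun a : C => a *: DS_class 0 (tens v (expv 0))) &
      forall i, i != 0 -> [set: H_DS i] = [set 0]]%classic.

End Cohomology.
End DrinfeldSokolov.

Arguments Pi0 C _ : clear implicits.
Arguments H_DS_total {C} N _.

(* Main.v *)
From HB Require Import structures.
From mathcomp Require Import all_boot all_order all_algebra.
From mathcomp Require Import finmap multiset monalg complex.
From mathcomp Require Import boolp classical_sets cardinality fsbigop reals.
From mathcomp Require Import zify ring.
Require Import Defs.

(* Let A_j, psi_j and h_m denote the coefficients of z^j in Y(e^c, z) and the modes
   e^phi_(j) and e^(-phi)_(- m - 1), so that the differential is
   d = \sum_j (A_j + delta_{j,0}) (x) psi_j and psi_j h_m + h_m psi_j = delta_{j,m}.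
   The number of letters c minus the number of letters d in a basis monomial is
   bounded on vectors of bounded weight, so an operator that preserves the weight and
   equals a nonzero scalar up to terms raising this number is invertible.
   On the sector <c, -> = r != 0, the anticommutator of d with e^(-c) (x) h_r is 1 up
   to such terms, hence every cocycle is exact.  For r = 0, the anticommutator of d
   with the sum over m != 0 of (m / 2) e^(-c) d(m) (x) h_m is the total weight (where
   e^(i phi) has weight i (i + 1) / 2) up to such terms, hence the cohomology is
   carried by weight zero.  There only the charges -1 and 0 occur, both parts are
   copies of C[Zc], and d is the multiplication by 1 + e^c; its cokernel
   is a line, detected by evaluation at e^c = -1. *)

Set Implicit Arguments.
Unset Strict Implicit.
Unset Printing Implicit Defensive.

Import Order.TTheory GRing.Theory Num.Theory.

Local Open Scope ring_scope.

(** No inverse operator is built: a cocycle [x] is replaced by [d h - w x], again a cocycle within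
    the same weight bound but with larger excess, until the excess passes the weight and the vector
    is zero. The first homotopy breaks down for [r = 0] because [h_0] selects [A_0 + 1], with
    leading part [e^c + 1], which is not invertible. The modes [m != 0] avoid the summand 1, but the
    leading part of [A_m] is then linear in a mode of [c]; multiplying by [d(m)] turns it into a
    number operator. The scalar from normally ordering the bosons cancels the one from the fermions.
    The Clifford relations are derived from commutators with Heisenberg modes alone, and the
    fermionic energy is identified with the weight because their difference is killed by every
    lowering mode. Two devices recur. Zero modes act by integers on each sector, so they are
    absorbed into the indices of vertex operators and the remaining operators do not see the
    lattice. The differential is an infinite sum, finite on each vector; the identities are proved
    for finite windows of modes, where they are exact. *)

Lemma sum_op_commutator (C : fieldType) (V : lmodType C) (I : finType)
    (c c' : I -> C) (f g : I -> {linear V -> V}) (kap : I -> I -> C) v :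
  (forall i j v, f i (g j v) = g j (f i v) + kap i j *: v) ->
  \sum_i c i *: f i (\sum_j c' j *: g j v) =
  \sum_j c' j *: g j (\sum_i c i *: f i v) +
  (\sum_i \sum_j c i * c' j * kap i j) *: v.
Proof.
move=> fg.
transitivity (\sum_i \sum_j c i *: (c' j *: f i (g j v))).
  apply: eq_bigr => i _; rewrite linear_sum scaler_sumr.
  by apply: eq_bigr => j _; rewrite linearZ.
transitivity (\sum_i \sum_j (c' j *: (c i *: g j (f i v)) +
    (c i * c' j * kap i j) *: v)).
  apply: eq_bigr => i _; apply: eq_bigr => j _.
  by rewrite fg !scalerDr !scalerA [c' j * c i]mulrC.
under eq_bigr do rewrite big_split.
rewrite big_split; congr (_ + _).
  rewrite exchange_big; apply: eq_bigr => j _; rewrite linear_sum scaler_sumr.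
  by apply: eq_bigr => i _; rewrite [g j (_ *: _)]linearZ.
by rewrite scaler_suml; apply: eq_bigr => i _; rewrite scaler_suml.
Qed.

Arguments sum_op_commutator {C V I} c c' f g kap v _.

Lemma big_ord_extend (V : nmodType) (n k : nat) (F : nat -> V) :
  (k <= n)%N -> (forall s, (k <= s)%N -> F s = 0) ->
  \sum_(s < k) F s = \sum_(s < n) F s.
Proof.
move=> kn F0; rewrite (big_ord_widen n F kn) big_mkcond; apply: eq_bigr => s _.
by case: ifP => // /negbT; rewrite -leqNgt => /F0.
Qed.

(** * Exponentials of commuting operators *)

Section ExpCoef.
Context {C : numFieldType} {V : lmodType C}.
Variable a : nat -> {linear V -> V}.

(* The sum over compositions of n into s parts, i.e. the coefficient of z^n in
   (\sum_(m >= 1) a m z^m)^s. *)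
Fixpoint exp_part (s n : nat) (v : V) : V :=
  if s is s'.+1 then \sum_(i < n) a i.+1 (exp_part s' (n - i.+1) v)
  else if n == 0 then v else 0.

Lemma exp_part_gt s n v : (n < s)%N -> exp_part s n v = 0.
Proof.
elim: s n => // s IHs n ltns /=; apply: big1 => i _.
by rewrite IHs ?linear0 //; have := ltn_ord i; lia.
Qed.

(* The coefficient of z^n in exp (\sum_(m >= 1) a m z^m). *)
Definition exp_op (n : nat) (v : V) : V :=
  \sum_(s < n.+1) s`!%:R^-1 *: exp_part s n v.

Fact exp_part_linear s n : linear (exp_part s n).
Proof.
elim: s n => [|s IHs] n c u v /=.
  by case: eqP => _; rewrite ?scaler0 ?addr0.
rewrite scaler_sumr -big_split; apply: eq_bigr => i _ /=.
by rewrite IHs linearP.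
Qed.

Fact exp_op_linear n : linear (exp_op n).
Proof.
move=> c u v; rewrite /exp_op scaler_sumr -big_split; apply: eq_bigr => s _ /=.
by rewrite exp_part_linear scalerDr !scalerA mulrC.
Qed.

Lemma exp_op0 v : exp_op 0 v = v.
Proof. by rewrite /exp_op big_ord1 /= invr1 scale1r. Qed.

HB.instance Definition _ s n :=
  GRing.isLinear.Build C V V *:%R (exp_part s n) (exp_part_linear s n).
HB.instance Definition _ n :=
  GRing.isLinear.Build C V V *:%R (exp_op n) (exp_op_linear n).

(** Extension by zero to negative indices: shifts of the index become plain integer arithmetic. *)
Definition exp_int (n : int) (v : V) : V :=
  if n is Posz k then exp_op k v else 0.

Fact exp_int_linear n : linear (exp_int n).
Proof.
by case: n => n c u v /=; rewrite ?scaler0 ?addr0 //; exact: exp_op_linear.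
Qed.
HB.instance Definition _ n :=
  GRing.isLinear.Build C V V *:%R (exp_int n) (exp_int_linear n).

Lemma exp_int0 v : exp_int 0 v = v.
Proof. exact: exp_op0. Qed.

Lemma exp_int_lt0 n v : n < 0 -> exp_int n v = 0.
Proof. by case: n. Qed.

Lemma exp_part_commute (f : {linear V -> V}) s n v :
  (forall m u, f (a m u) = a m (f u)) ->
  f (exp_part s n v) = exp_part s n (f v).
Proof.
move=> fa; elim: s n => [|s IHs] n /=; first by case: eqP => _; rewrite ?linear0.
by rewrite linear_sum; apply: eq_bigr => j _; rewrite fa IHs.
Qed.

Lemma exp_int_commute (f : {linear V -> V}) n v :
  (forall m u, f (a m u) = a m (f u)) -> f (exp_int n v) = exp_int n (f v).
Proof.
case: n => n fa /=; last by rewrite linear0.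
rewrite /exp_op linear_sum; apply: eq_bigr => s _.
by rewrite linearZ /= exp_part_commute.
Qed.

Hypothesis a_comm : forall i j v, a i (a j v) = a j (a i v).

Lemma exp_part_exchange (c : nat -> C) s n v :
  \sum_(m < n) a m.+1 (\sum_(k < n - m.+1)
     c k *: a k.+1 (exp_part s (n - m.+1 - k.+1) v)) =
  \sum_(k < n) c k *: a k.+1 (\sum_(m < n - k.+1)
     a m.+1 (exp_part s (n - k.+1 - m.+1) v)).
Proof.
have widen (F : nat -> nat -> V) :
    \sum_(m < n) \sum_(k < n - m.+1) F m k =
    \sum_(m < n) \sum_(k < n) if (m.+1 + k < n)%N then F m k else 0.
  apply: eq_bigr => m _; rewrite -big_mkcond /=.
  rewrite (big_ord_widen n (F m)) ?leq_subr //; apply: eq_bigl => k; lia.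
under eq_bigr do rewrite linear_sum.
under [RHS]eq_bigr do rewrite linear_sum scaler_sumr.
rewrite (widen (fun m k => a m.+1 (c k *: a k.+1 (exp_part s (n - m.+1 - k.+1) v)))).
rewrite (widen (fun k m => c k *: a k.+1 (a m.+1 (exp_part s (n - k.+1 - m.+1) v)))).
rewrite exchange_big; apply: eq_bigr => k _; apply: eq_bigr => m _.
rewrite addnC addnS -addSn addnC addnC; case: ifP => // _.
by rewrite linearZ a_comm; do 4 congr (_ _); rewrite -!subnDA addnC.
Qed.

(** With [A = \sum_(m >= 1) a m z^m], this is the coefficient of [z^n] in
    [z d/dz A^(s+1) = (s+1) (z dA/dz) A^s]. *)
Lemma exp_part_rec s n v :
  n%:R *: exp_part s.+1 n v =
  s.+1%:R *: \sum_(m < n) m.+1%:R *: a m.+1 (exp_part s (n - m.+1) v).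
Proof.
elim: s n v => [|s IHs] n v.
  rewrite scale1r /= scaler_sumr; apply: eq_bigr => i _.
  case: eqP => [ni|_]; last by rewrite !linear0 ?scaler0.
  have ltin := ltn_ord i; have E : n = i.+1 by lia.
  by rewrite {1}E.
rewrite [exp_part]lock /= -lock scaler_sumr.
transitivity (\sum_(m < n) (m.+1%:R *: a m.+1 (exp_part s.+1 (n - m.+1) v) +
   a m.+1 ((n - m.+1)%:R *: exp_part s.+1 (n - m.+1) v))).
  apply: eq_bigr => m _; rewrite linearZ -scalerDl -natrD.
  by have ltmn := ltn_ord m; rewrite subnKC.
rewrite big_split /=; under [X in _ + X]eq_bigr do rewrite IHs linearZ.
rewrite -[X in _ + X]scaler_sumr (exp_part_exchange (fun k => k.+1%:R)).
by rewrite -[in RHS]natr1 scalerDl scale1r addrC.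
Qed.

(** The differential equation [z d/dz exp A = (z dA/dz) exp A]. In characteristic 0 it determines
    every coefficient from the constant one, so later facts about the exponential are inductions
    along it. *)
Lemma exp_op_rec n v :
  n%:R *: exp_op n v =
  \sum_(m < n) m.+1%:R *: a m.+1 (exp_op (n - m.+1) v).
Proof.
pose w (s : nat) : C := s`!%:R^-1.
have w_rec s : w s.+1 * s.+1%:R = w s.
  by rewrite /w factS natrM invfM mulrAC mulVf ?mul1r // pnatr_eq0.
have expE k : exp_op k v =
    \sum_(s < k.+1) w s *: exp_part s k v := erefl.
clearbody w; rewrite expE scaler_sumr big_ord_recl.
rewrite [X in X + _](_ : _ = 0) ?add0r; last first.
  by case: n => [|n]; rewrite ?scale0r //= !scaler0.
transitivity (\sum_(s < n) w s *:
   \sum_(m < n) m.+1%:R *: a m.+1 (exp_part s (n - m.+1) v)).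
  apply: eq_bigr => s _; rewrite lift0.
  by rewrite scalerA mulrC -scalerA exp_part_rec scalerA w_rec.
transitivity (\sum_(s < n) \sum_(m < n)
    w s *: (m.+1%:R *: a m.+1 (exp_part s (n - m.+1) v))).
  by apply: eq_bigr => s _; exact: scaler_sumr.
rewrite exchange_big; apply: eq_bigr => m _ /=.
rewrite expE linear_sum scaler_sumr.
have ltmn := ltn_ord m; rewrite (_ : (n - m.+1).+1 = n - m)%N; last by lia.
transitivity (\sum_(s < n) m.+1%:R *: a m.+1 (w s *: exp_part s (n - m.+1) v)).
  by apply: eq_bigr => s _; rewrite [a m.+1 (w _ *: _)]linearZ !scalerA mulrC.
apply/esym; apply: (big_ord_extend (F := fun s =>
  m.+1%:R *: a m.+1 (w s *: exp_part s (n - m.+1) v))); first exact: leq_subr.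
by move=> s lts; rewrite exp_part_gt ?scaler0 ?linear0 ?scaler0 //; lia.
Qed.

(** The free bound [N] lets recursions at different indices share one range of summation. *)
Lemma exp_int_rec N (n : int) v : n <= N%:Z ->
  n%:~R *: exp_int n v =
  \sum_(m < N) m.+1%:R *: a m.+1 (exp_int (n - m.+1%:Z) v).
Proof.
have [n_lt0 _|] := ltP n 0.
  rewrite exp_int_lt0 // scaler0 big1 // => m _.
  by rewrite exp_int_lt0 ?linear0 ?scaler0 //; lia.
case: n => // n _ nN.
rewrite (exp_op_rec n v) -(big_ord_extend (k := n) (F := fun m =>
  m.+1%:R *: a m.+1 (exp_int (n%:Z - m.+1%:Z) v))) => [|//|m nm].
  by apply: eq_bigr => m _; rewrite subzn //; apply: ltn_ord.
by rewrite exp_int_lt0 ?linear0 ?scaler0 //; lia.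
Qed.

(** If [f] commutes with all [a m] except for a scalar commutator [kap] with [a k], then [[f, exp A]
    = kap z^k exp A]. *)
Lemma exp_int_derivation (f : {linear V -> V}) (k : nat) kap n v : (0 < k)%N ->
  (forall m u, f (a m.+1 u) = a m.+1 (f u) + (if m.+1 == k then kap else 0) *: u) ->
  f (exp_int n v) = exp_int n (f v) + kap *: exp_int (n - k%:Z) v.
Proof.
move=> k0 fa; case: n => n /=; last first.
  by rewrite linear0 exp_int_lt0 ?scaler0 ?addr0 //; lia.
elim/ltn_ind: n => n IHn.
have [->|n0] := posnP n.
  by rewrite exp_op0 exp_op0 exp_int_lt0 ?scaler0 ?addr0 //; lia.
have nC0 : n%:R != 0 :> C by rewrite pnatr_eq0 -lt0n.
apply: (scalerI nC0); pose N := (n + k)%N.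
have recN (j : int) u : j <= n%:Z -> j%:~R *: exp_int j u =
    \sum_(m < N) m.+1%:R *: a m.+1 (exp_int (j - m.+1%:Z) u).
  by move=> jn; apply: exp_int_rec; rewrite /N; lia.
rewrite scalerDr -linearZ /=.
have -> : n%:R *: exp_op n v = n%:~R *: exp_int n v by [].
have -> : n%:R *: exp_op n (f v) = n%:~R *: exp_int n (f v) by [].
rewrite !recN // linear_sum.
(* The three summands are the recursion at [n] for [f v], the recursion at [n - k] for [v], and the
   single commutator term [m.+1 = k]; the scalars match because [n kap = kap (n - k) + k kap]. *)
transitivity (\sum_(m < N) (m.+1%:R *: a m.+1 (exp_int (n%:Z - m.+1%:Z) (f v)) +
    (kap *: (m.+1%:R *: a m.+1 (exp_int (n%:Z - k%:Z - m.+1%:Z) v)) +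
     (if m.+1 == k then (k%:R * kap) *: exp_int (n%:Z - k%:Z) v else 0)))).
  apply: eq_bigr => m _; rewrite linearZ /= fa.
  have -> : f (exp_int (n%:Z - m.+1%:Z) v) = exp_int (n%:Z - m.+1%:Z) (f v) +
      kap *: exp_int (n%:Z - k%:Z - m.+1%:Z) v.
    have [lmn|lnm] := leqP m.+1 n; last first.
      by rewrite !exp_int_lt0 ?linear0 ?scaler0 ?addr0 //; lia.
    have := IHn (n - m.+1)%N; rewrite -subzn // [n%:Z - k%:Z - _]addrAC.
    by rewrite subzn // => -> //; lia.
  rewrite [a m.+1 (_ + _)]linearD !scalerDr [a m.+1 (kap *: _)]linearZ /=.
  rewrite !scalerA [kap * _]mulrC -addrA.
  by congr (_ + (_ + _)); case: eqP => [->|_]; rewrite ?mulr0 ?scale0r ?scalerA.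
rewrite !big_split /= -scaler_sumr -recN; last by lia.
have -> : \sum_(m < N) (if m.+1 == k then (k%:R * kap) *: exp_int (n%:Z - k%:Z) v
    else 0) = (k%:R * kap) *: exp_int (n%:Z - k%:Z) v.
  case: k k0 @N {recN fa IHn} => // k _ N.
  have ltk : (k < N)%N by rewrite /N; lia.
  rewrite (bigD1 (Ordinal ltk)) //= eqxx big1 ?addr0 // => m.
  by rewrite -val_eqE /= eqSS => /negPf ->.
congr (_ + _); rewrite -recN; last by lia.
rewrite !scalerA -scalerDl; congr (_ *: _).
by rewrite mulrzBr /= -!pmulrn; ring.
Qed.

Lemma exp_int_vacuum n v :
  (forall m, a m.+1 v = 0) -> exp_int n v = (n == 0)%:R *: v.
Proof.
move=> av0; case: eqP => [->|/eqP n0]; first by rewrite exp_int0 scale1r.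
rewrite scale0r; case: n n0 => // n n0.
have nC0 : n%:~R != 0 :> C by rewrite intr_eq0.
apply: (scalerI nC0); rewrite (exp_int_rec (N := n)) // scaler0.
apply: big1 => m _; rewrite exp_int_commute => [|j u]; last by rewrite a_comm.
by rewrite av0 linear0 scaler0.
Qed.

(** In the recursion at [m.+1] every term but the last contains a positive coefficient of the
    exponential. This recovers Heisenberg modes from vertex operators. *)
Lemma exp_int_eq0 v : (forall n, 0 < n -> exp_int n v = 0) -> forall m, a m.+1 v = 0.
Proof.
move=> Ev0 m; have := exp_int_rec (N := m.+1) (n := m.+1%:Z) v (lexx _).
rewrite Ev0 // scaler0 big_ord_recr /= big1 => [|i _]; last first.
  by rewrite Ev0 ?linear0 ?scaler0 //; have := ltn_ord i; lia.
rewrite add0r subrr exp_int0 => /esym/eqP.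
by rewrite scaler_eq0 pnatr_eq0 /= => /eqP.
Qed.

End ExpCoef.

(* Conversion on {malg C[K]} unfolds down to finite maps and is intractable, so
   computations take place in a copy that cannot be unfolded. *)
Lemma free_module_key (C : fieldType) (K : choiceType) :
  {F : lmodType C & {to : {linear {malg C[K]} -> F} &
    {from : {linear F -> {malg C[K]}} | cancel to from /\ cancel from to}}}.
Proof. by exists {malg C[K]}, idfun, idfun. Qed.

Definition free_module (C : fieldType) (K : choiceType) : lmodType C :=
  projT1 (free_module_key C K).

Definition seal {C : fieldType} {K : choiceType} :
    {linear {malg C[K]} -> free_module C K} :=
  projT1 (projT2 (free_module_key C K)).

Definition unseal {C : fieldType} {K : choiceType} :
    {linear free_module C K -> {malg C[K]}} :=
  sval (projT2 (projT2 (free_module_key C K))).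

Lemma sealK (C : fieldType) (K : choiceType) : cancel (@seal C K) unseal.
Proof. exact: (proj1 (svalP (projT2 (projT2 (free_module_key C K))))). Qed.

Lemma unsealK (C : fieldType) (K : choiceType) : cancel (@unseal C K) seal.
Proof. exact: (proj2 (svalP (projT2 (projT2 (free_module_key C K))))). Qed.

HB.lock Definition bvec (C : fieldType) (K : choiceType) (b : K) :
  free_module C K := seal << b >>.

HB.lock Definition fcoef (C : fieldType) (K : choiceType) (b : K)
  (x : free_module C K) : C := (unseal x)@_b.

HB.lock Definition ext (C : fieldType) (K : choiceType) (V : lmodType C)
  (f : K -> V) (x : free_module C K) : V := lin_ext f (unseal x).

Fact ext_linear (C : fieldType) (K : choiceType) (V : lmodType C) (f : K -> V) :
  linear (ext f).
Proof. by move=> a x y; rewrite ext.unlock !linearP. Qed.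
HB.instance Definition _ (C : fieldType) (K : choiceType) (V : lmodType C)
  (f : K -> V) := GRing.isLinear.Build C _ V *:%R (ext f) (ext_linear f).

(** * Coefficients and supports in free modules *)

Section Support.
Context {C : fieldType} {K : choiceType}.
Local Notation F := (free_module C K).
Implicit Types (P Q : K -> Prop) (x y : F) (b : K).

Lemma unseal_bvec b : unseal (bvec C b) = << b >>.
Proof. by rewrite bvec.unlock sealK. Qed.

Lemma seal_basis b : seal << b >> = bvec C b.
Proof. by rewrite bvec.unlock. Qed.

Lemma fcoef_bvec b b' : fcoef b' (bvec C b) = (b == b')%:R.
Proof. by rewrite fcoef.unlock unseal_bvec mcoeffU. Qed.

Lemma fcoefD b x y : fcoef b (x + y) = fcoef b x + fcoef b y.
Proof. by rewrite fcoef.unlock linearD mcoeffD. Qed.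

Lemma fcoefZ b a x : fcoef b (a *: x) = a * fcoef b x.
Proof. by rewrite fcoef.unlock linearZ mcoeffZ. Qed.

Lemma fcoefN b x : fcoef b (- x) = - fcoef b x.
Proof. by rewrite -scaleN1r fcoefZ mulN1r. Qed.

Lemma fcoef0 b : fcoef b (0 : F) = 0.
Proof. by rewrite fcoef.unlock linear0 mcoeff0. Qed.

Lemma fcoefP x y : (forall b, fcoef b x = fcoef b y) -> x = y.
Proof.
move=> xy; apply: (can_inj (@unsealK C K)); apply/malgP => b.
by have := xy b; rewrite fcoef.unlock.
Qed.

Lemma extE (V : lmodType C) (f : K -> V) b : ext f (bvec C b) = f b.
Proof.
rewrite ext.unlock unseal_bvec /lin_ext msuppU oner_eq0 big_seq_fset1.
by rewrite mcoeffU eqxx scale1r.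
Qed.

Lemma bvec_sumE x :
  x = \sum_(b <- msupp (unseal x)) fcoef b x *: bvec C b.
Proof.
apply: (can_inj (@unsealK C K)); rewrite linear_sum {1}[unseal x]monalgE.
apply: eq_bigr => b _; rewrite linearZ /= unseal_bvec fcoef.unlock.
by apply/malgP => b'; rewrite mcoeffZ !mcoeffU mulr_natr.
Qed.

(** An inductive wrapper, so that unification does not see the product inside. *)
Variant supported P x : Prop :=
  Supported of (forall b, fcoef b x != 0 -> P b).

Lemma supported_in P x b : supported P x -> fcoef b x != 0 -> P b.
Proof. by case=> xP /xP. Qed.

Lemma supported_coef P x b : ~ P b -> supported P x -> fcoef b x = 0.
Proof. by move=> nP [xP]; apply/eqP/negPn/negP => /xP. Qed.

Lemma supported0 P : supported P 0.
Proof. by split=> b; rewrite fcoef0 eqxx. Qed.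

Lemma supportedU P b : P b -> supported P (bvec C b).
Proof.
by move=> Pb; split=> b'; rewrite fcoef_bvec; case: (eqVneq b b') => [<-|]; rewrite ?eqxx.
Qed.

Lemma supportedD P x y : supported P x -> supported P y -> supported P (x + y).
Proof.
move=> [xP] [yP]; split=> b; rewrite fcoefD; have [->|/xP //] := eqVneq (fcoef b x) 0.
by rewrite add0r => /yP.
Qed.

Lemma supportedZ P a x : supported P x -> supported P (a *: x).
Proof.
move=> [xP]; split=> b; rewrite fcoefZ => ax0; apply: xP.
by apply: contra_neq ax0 => ->; rewrite mulr0.
Qed.

Lemma supportedN P x : supported P x -> supported P (- x).
Proof. by move=> xP; rewrite -scaleN1r; apply: supportedZ. Qed.

Lemma supportedB P x y : supported P x -> supported P y -> supported P (x - y).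
Proof. by move=> xP yP; apply: supportedD => //; apply: supportedN. Qed.

Lemma supported_sum P (I : Type) (r : seq I) (S : pred I) (f : I -> F) :
  (forall i, S i -> supported P (f i)) -> supported P (\sum_(i <- r | S i) f i).
Proof.
move=> SP; elim/big_ind: _ => [|x y|i Si]; first exact: supported0.
  exact: supportedD.
exact: SP.
Qed.

Lemma supported_sum_seq P (I : eqType) (r : seq I) (f : I -> F) :
  (forall i, i \in r -> supported P (f i)) -> supported P (\sum_(i <- r) f i).
Proof.
by move=> rP; rewrite big_seq_cond; apply: supported_sum => i /andP[/rP].
Qed.

Lemma supportedW P Q x : (forall b, P b -> Q b) -> supported P x -> supported Q x.
Proof. by move=> PQ [xP]; split=> b /xP /PQ. Qed.

Lemma supportedI P Q x : supported P x -> supported Q x ->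
  supported (fun b => P b /\ Q b) x.
Proof. by move=> [xP] [xQ]; split=> b bx; split; [exact: xP | exact: xQ]. Qed.

Lemma supported_none P x : (forall b, ~ P b) -> supported P x -> x = 0.
Proof.
by move=> nP xP; apply/fcoefP => b; rewrite fcoef0 (supported_coef (nP b) xP).
Qed.

Lemma supported_ind P (T : F -> Prop) :
  T 0 -> (forall a b x, P b -> T x -> T (a *: bvec C b + x)) ->
  forall x, supported P x -> T x.
Proof.
move=> T0 TD x [xP].
have sumP (r : seq K) : {subset r <= msupp (unseal x)} ->
    T (\sum_(b <- r) fcoef b x *: bvec C b).
  elim: r => [|b r IHr] rP; first by rewrite big_nil.
  rewrite big_cons; apply: TD; last by apply: IHr => b' b'r; apply: rP; rewrite inE b'r orbT.
  by apply: xP; rewrite fcoef.unlock mcoeff_neq0; apply: rP; rewrite mem_head.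
by rewrite [x]bvec_sumE; exact: sumP.
Qed.

Lemma eq_linear_on P (V : lmodType C) (f g : {linear F -> V}) :
  (forall b, P b -> f (bvec C b) = g (bvec C b)) ->
  forall x, supported P x -> f x = g x.
Proof.
move=> fg; apply: supported_ind; first by rewrite !linear0.
by move=> a b x Pb IH; rewrite !linearP fg // IH.
Qed.

Lemma eq_linear (V : lmodType C) (f g : {linear F -> V}) :
  (forall b, f (bvec C b) = g (bvec C b)) -> f =1 g.
Proof. by move=> fg x; apply: (@eq_linear_on (fun=> True)). Qed.

End Support.

Lemma supported_linear (C : fieldType) (K L : choiceType) P Q
    (f : {linear free_module C K -> free_module C L}) :
  (forall b, P b -> supported Q (f (bvec C b))) ->
  forall x, supported P x -> supported Q (f x).
Proof.
move=> fP; apply: supported_ind; first by rewrite linear0; exact: supported0.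
move=> a b x /fP fb IH; rewrite linearP.
by apply: supportedD => //; apply: supportedZ.
Qed.

Definition restr (C : fieldType) (K : choiceType) (D : K -> Prop) :
    free_module C K -> free_module C K :=
  ext (fun b => if `[< D b >] then bvec C b else 0).
HB.instance Definition _ (C : fieldType) (K : choiceType) (D : K -> Prop) :=
  GRing.Linear.on (@restr C K D).

Section Restr.
Context {C : fieldType} {K : choiceType}.
Implicit Types (D : K -> Prop) (x : free_module C K).

Lemma restr_id D x : supported D x -> restr D x = x.
Proof.
apply: (eq_linear_on (f := restr D) (g := idfun)) => b Db.
by rewrite /= /restr extE asboolT.
Qed.

Lemma restr_eq0 D E x : (forall b, D b -> ~ E b) -> supported D x -> restr E x = 0.
Proof.
move=> DE; apply: (eq_linear_on (f := restr E) (g := \0)) => b /DE Db.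
by rewrite /= /restr extE asboolF.
Qed.

Lemma supported_restr D E x :
  supported E x -> supported (fun b => D b /\ E b) (restr D x).
Proof.
apply: supported_linear => b Eb; rewrite /= /restr extE.
by case: asboolP => Db; [exact: supportedU | exact: supported0].
Qed.

End Restr.

(* T s n b b' : b' occurs after s letters a m of total degree n act on b. *)
Lemma supported_exp_part (C : numFieldType) (K : choiceType)
    (a : nat -> {linear free_module C K -> free_module C K})
    (T : nat -> nat -> K -> K -> Prop) :
  (forall b, T 0 0 b b) ->
  (forall s n i b b', T s n b b' ->
     supported (T s.+1 (i.+1 + n)%N b) (a i.+1 (bvec C b'))) ->
  forall s n b, supported (T s n b) (exp_part a s n (bvec C b)).
Proof.
move=> T0 Ta; elim=> [|s IHs] n b /=.
  by case: eqP => [->|_]; [apply: supportedU | apply: supported0].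
apply: supported_sum => i _.
apply: supported_linear (IHs (n - i.+1)%N b) => b' /(Ta _ _ i).
by rewrite subnKC.
Qed.

Lemma supported_exp_int (C : numFieldType) (K : choiceType)
    (a : nat -> {linear free_module C K -> free_module C K})
    (T : nat -> nat -> K -> K -> Prop) :
  (forall b, T 0 0 b b) ->
  (forall s n i b b', T s n b b' ->
     supported (T s.+1 (i.+1 + n)%N b) (a i.+1 (bvec C b'))) ->
  forall n b, supported (fun b' => exists s m, n = m%:Z /\ T s m b b')
    (exp_int a n (bvec C b)).
Proof.
move=> T0 Ta [] n b /=; last exact: supported0.
apply: supported_sum => s _; apply: supportedZ.
apply: (supportedW (P := T s n b)); last exact: supported_exp_part.
by move=> b' Tb'; exists s, n.
Qed.

(** The composition of [n.+1] into one part contributes exactly [a n.+1], and a positive number has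
    no composition into zero parts; what remains has at least two letters. *)
Lemma supported_exp_int_leading (C : numFieldType) (K : choiceType)
    (a : nat -> {linear free_module C K -> free_module C K})
    (T : nat -> nat -> K -> K -> Prop) :
  (forall b, T 0 0 b b) ->
  (forall s n i b b', T s n b b' ->
     supported (T s.+1 (i.+1 + n)%N b) (a i.+1 (bvec C b'))) ->
  forall n b, supported (fun b' => exists2 s, (1 < s)%N & T s n.+1 b b')
    (exp_int a n.+1 (bvec C b) - a n.+1 (bvec C b)).
Proof.
move=> T0 Ta n b /=.
have -> : exp_op a n.+1 (bvec C b) - a n.+1 (bvec C b) =
    \sum_(s < n) (s.+2)`!%:R^-1 *: exp_part a s.+2 n.+1 (bvec C b).
  have -> : a n.+1 (bvec C b) = exp_part a 1 n.+1 (bvec C b).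
    rewrite /= big_ord_recr big1 /= => [|i _]; first by rewrite subnn add0r.
    by rewrite subSS subn_eq0 leqNgt ltn_ord linear0.
  rewrite /exp_op big_ord_recl [exp_part]lock /= -{1}lock scaler0 add0r -lock.
  by rewrite big_ord_recl invr1 scale1r addrC addKr.
apply: supported_sum => s _; apply: supportedZ.
apply: (supportedW (P := T s.+2 n.+1 b)); last exact: supported_exp_part.
by move=> b' Tb'; exists s.+2.
Qed.

(* Sealed so that unification never evaluates multisets. *)
HB.lock Definition mset_add (K : choiceType) (a : K) (s : {mset K}%mset) :
  {mset K}%mset := (a +` s)%mset.
HB.lock Definition mset_rem (K : choiceType) (a : K) (s : {mset K}%mset) :
  {mset K}%mset := (s `\ a)%mset.

(** * Oscillator modes *)

Section MsetAddRem.
Context {K : choiceType}.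
Implicit Types (a : K) (s : {mset K}%mset).

Lemma mset_addD a s : (a +` s)%mset = mset_add a s.
Proof. by rewrite mset_add.unlock. Qed.

Lemma mset_remB a s : (s `\ a)%mset = mset_rem a s.
Proof. by rewrite mset_rem.unlock. Qed.

Lemma mset_addE a s b : mset_add a s b = ((b == a) + s b)%N.
Proof. by rewrite mset_add.unlock mset1DE. Qed.

Lemma mset_remE a s b : mset_rem a s b = (s b - (b == a))%N.
Proof. by rewrite mset_rem.unlock msetB1E. Qed.

Lemma mset_addC a b s : mset_add a (mset_add b s) = mset_add b (mset_add a s).
Proof. by apply/msetP => c; rewrite !mset_addE addnCA. Qed.

Lemma mset_remC a b s : mset_rem a (mset_rem b s) = mset_rem b (mset_rem a s).
Proof. by apply/msetP => c; rewrite !mset_remE subnAC. Qed.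

Lemma mset_addK a s : mset_rem a (mset_add a s) = s.
Proof. by apply/msetP => c; rewrite mset_remE mset_addE addKn. Qed.

Lemma mset_remK a s : (0 < s a)%N -> mset_add a (mset_rem a s) = s.
Proof.
move=> sa; apply/msetP => c; rewrite mset_addE mset_remE.
by case: eqP => [->|_]; rewrite ?subn0 // subnKC.
Qed.

Lemma mset_rem_add a b s : a != b ->
  mset_rem a (mset_add b s) = mset_add b (mset_rem a s).
Proof.
move=> neq; apply/msetP => d; rewrite mset_remE !mset_addE mset_remE.
by have [->|_] := eqVneq d a; [rewrite (negPf neq) | rewrite !subn0].
Qed.

End MsetAddRem.
Section LetterDegree.
Context {K : choiceType}.
Variable f : K -> int.
Implicit Types (a : K) (s : {mset K}%mset).

Definition letter_deg s : int := \sum_(a <- enum_mset s) f a.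

Lemma letter_deg0 : letter_deg mset0 = 0.
Proof. by rewrite /letter_deg enum_mset0 big_nil. Qed.

Lemma letter_deg_add a s : letter_deg (mset_add a s) = f a + letter_deg s.
Proof.
rewrite mset_add.unlock /letter_deg.
transitivity (\sum_(b <- a :: enum_mset s) f b); last by rewrite big_cons.
apply: perm_big; apply/allP => b _ /=; apply/eqP.
by rewrite !count_mem_mset mset1DE eq_sym.
Qed.

Lemma letter_deg_rem a s : (0 < s a)%N ->
  letter_deg (mset_rem a s) = letter_deg s - f a.
Proof.
by move=> /mset_remK {2}<-; rewrite letter_deg_add addrC addrA addNr add0r.
Qed.

Lemma letter_deg_ge0 s : (forall a, 0 <= f a) -> 0 <= letter_deg s.
Proof. by move=> f0; apply: sumr_ge0. Qed.

End LetterDegree.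

Lemma letter_deg_le {K : choiceType} (f g : K -> int) (s : {mset K}%mset) :
  (forall a, f a <= g a) -> letter_deg f s <= letter_deg g s.
Proof. by move=> fg; apply: ler_sum. Qed.

Section Oscillators.
Context {C : numFieldType} {l : nat}.
Local Notation V := (free_module C (fock_basis C l)).
Local Notation letter := ('I_l * nat)%type.
Implicit Types (a : letter) (v : V) (b : fock_basis C l).

Definition creator a : V -> V :=
  ext (fun b : fock_basis C l => bvec C (mset_add a b.1, b.2)).
HB.instance Definition _ a := GRing.Linear.on (creator a).

Definition annihilator a : V -> V :=
  ext (fun b : fock_basis C l => (b.1 a)%:R *: bvec C (mset_rem a b.1, b.2)).
HB.instance Definition _ a := GRing.Linear.on (annihilator a).

Definition shift (nu : 'rV[C]_l) : V -> V :=
  ext (fun b : fock_basis C l => bvec C (b.1, b.2 + nu)).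
HB.instance Definition _ (nu : 'rV[C]_l) := GRing.Linear.on (shift nu).

Lemma creatorE a b : creator a (bvec C b) = bvec C (mset_add a b.1, b.2).
Proof. exact: extE. Qed.

Lemma annihilatorE a b :
  annihilator a (bvec C b) = (b.1 a)%:R *: bvec C (mset_rem a b.1, b.2).
Proof. exact: extE. Qed.

Lemma shiftE nu b : shift nu (bvec C b) = bvec C (b.1, b.2 + nu).
Proof. exact: extE. Qed.

Lemma creatorC a a' v : creator a (creator a' v) = creator a' (creator a v).
Proof.
apply: (eq_linear (f := creator a \o creator a')
  (g := creator a' \o creator a)) => b.
by rewrite /= !creatorE /= mset_addC.
Qed.

Lemma annihilatorC a a' v :
  annihilator a (annihilator a' v) = annihilator a' (annihilator a v).
Proof.
apply: (eq_linear (f := annihilator a \o annihilator a')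
  (g := annihilator a' \o annihilator a)) => b.
rewrite /= !annihilatorE !linearZ /= !annihilatorE /= !scalerA.
have [->//|neq] := eqVneq a a'.
by rewrite !mset_remE mset_remC [a' == a]eq_sym (negPf neq) !subn0 mulrC.
Qed.

Lemma annihilator_creator a a' v :
  annihilator a (creator a' v) =
  creator a' (annihilator a v) + (a == a')%:R *: v.
Proof.
apply: (eq_linear (f := annihilator a \o creator a')
  (g := (creator a' \o annihilator a) \+ ((a == a')%:R \*: idfun))) => b /=.
rewrite annihilatorE creatorE annihilatorE linearZ /= creatorE /= mset_addE.
have [->|neq] := eqVneq a a'; last first.
  by rewrite add0n scale0r addr0 mset_rem_add.
rewrite mset_addK -surjective_pairing natrD scalerDl [LHS]addrC.
have [b0|bpos] := posnP (b.1 a'); first by rewrite b0 !scale0r.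
by rewrite mset_remK -?surjective_pairing.
Qed.

Variable G : 'M[C]_l.
Implicit Type h : 'rV[C]_l.

(** At [n = 0] this is a default value 0 and not the zero mode: the action of [h(0)] is carried by
    integer shifts in the indices of the vertex operators. Hence these modes commute with all
    lattice shifts. *)
Definition hmode h (n : int) (v : V) : V :=
  match n with
  | Negz m => \sum_j h 0 j *: creator (j, m) v
  | Posz 0 => 0
  | Posz m.+1 => \sum_j (m.+1%:R * pairing G h (delta_mx 0 j)) *: annihilator (j, m) v
  end.

Fact hmode_linear h n : linear (hmode h n).
Proof.
case: n => [[|m]|m] c u v /=; first by rewrite scaler0 addr0.
  rewrite scaler_sumr -big_split; apply: eq_bigr => j _.
  by rewrite linearP scalerDr !scalerA mulrC.
rewrite scaler_sumr -big_split; apply: eq_bigr => j _.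
by rewrite linearP scalerDr !scalerA mulrC.
Qed.
HB.instance Definition _ h n :=
  GRing.isLinear.Build C V V *:%R (hmode h n) (hmode_linear h n).

Lemma pairingDr h h' h'' :
  pairing G h (h' + h'') = pairing G h h' + pairing G h h''.
Proof. by rewrite /pairing linearD mulmxDr mxE. Qed.

Lemma pairingZl x h h' : pairing G (x *: h) h' = x * pairing G h h'.
Proof. by rewrite /pairing -!scalemxAl mxE. Qed.

Lemma pairingZr x h h' : pairing G h (x *: h') = x * pairing G h h'.
Proof. by rewrite /pairing linearZ -scalemxAr mxE. Qed.

Lemma pairing_sumr h h' :
  pairing G h h' = \sum_j h' 0 j * pairing G h (delta_mx 0 j).
Proof.
rewrite {1}[h']row_sum_delta; elim/big_rec2: _ => [|j x y _ <-].
  by rewrite /pairing linear0 mulmx0 mxE.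
by rewrite pairingDr pairingZr.
Qed.

Hypothesis G_sym : G^T = G.

Lemma pairingC h h' : pairing G h h' = pairing G h' h.
Proof.
rewrite /pairing; transitivity ((h *m G *m h'^T)^T 0 0); first by rewrite [RHS]mxE.
by rewrite !trmx_mul trmxK G_sym mulmxA.
Qed.

Lemma hmode_creationC h h' m n v :
  hmode h (Negz m) (hmode h' (Negz n) v) =
  hmode h' (Negz n) (hmode h (Negz m) v).
Proof.
have := sum_op_commutator (fun i => h 0 i) (fun j => h' 0 j)
  (fun i => creator (i, m)) (fun j => creator (j, n)) (fun _ _ => 0) v.
rewrite /hmode => -> => [|i j u]; last by rewrite /= creatorC scale0r addr0.
rewrite [X in X *: v]big1 ?scale0r ?addr0 // => i _.
by apply: big1 => j _; rewrite mulr0.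
Qed.

Lemma hmode_annihilationC h h' m n v :
  hmode h m.+1 (hmode h' n.+1 v) = hmode h' n.+1 (hmode h m.+1 v).
Proof.
have := sum_op_commutator
  (fun i => m.+1%:R * pairing G h (delta_mx 0 i))
  (fun j => n.+1%:R * pairing G h' (delta_mx 0 j))
  (fun i => annihilator (i, m)) (fun j => annihilator (j, n)) (fun _ _ => 0) v.
rewrite /hmode => -> => [|i j u]; last by rewrite /= annihilatorC scale0r addr0.
rewrite [X in X *: v]big1 ?scale0r ?addr0 // => i _.
by apply: big1 => j _; rewrite mulr0.
Qed.

Lemma hmode_annihilation_creation h h' m n v :
  hmode h m.+1 (hmode h' (Negz n) v) =
  hmode h' (Negz n) (hmode h m.+1 v) +
  ((m == n)%:R * (m.+1%:R * pairing G h h')) *: v.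
Proof.
have := sum_op_commutator
  (fun i => m.+1%:R * pairing G h (delta_mx 0 i)) (fun j => h' 0 j)
  (fun i => annihilator (i, m)) (fun j => creator (j, n))
  (fun i j => ((i, m) == (j, n))%:R) v.
rewrite /hmode => -> => [|i j u]; last by rewrite /= annihilator_creator.
congr (_ + _ *: _); rewrite (pairing_sumr h h') !mulr_sumr.
apply: eq_bigr => i _; rewrite (bigD1 i) //= big1 => [|j neq]; rewrite xpair_eqE.
  by rewrite eqxx addr0 /=; ring.
by rewrite eq_sym (negPf neq) mulr0.
Qed.

Lemma hmode_comm h h' (m n : int) v : m != 0 -> n != 0 ->
  hmode h m (hmode h' n v) =
  hmode h' n (hmode h m v) +
  (if m + n == 0 then m%:~R * pairing G h h' else 0) *: v.
Proof.
case: m n => [[|m]|m] [[|n]|n] // _ _.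
- by rewrite hmode_annihilationC scale0r addr0.
- rewrite hmode_annihilation_creation; congr (_ + _ *: _).
  rewrite (_ : (m.+1%:Z + Negz n == 0) = (m == n)); last by apply/idP/idP; lia.
  by case: eqP => _; rewrite ?mul1r ?mul0r.
- rewrite hmode_annihilation_creation -addrA -scalerDl.
  rewrite (_ : (Negz m + n.+1%:Z == 0) = (n == m)); last by apply/idP/idP; lia.
  case: eqP => [->|_]; last by rewrite mul0r add0r scale0r addr0.
  by rewrite pairingC NegzE mulrNz mulNr mul1r subrr scale0r addr0.
- by rewrite hmode_creationC scale0r addr0.
Qed.

Lemma shift_hmode nu h (n : int) v :
  shift nu (hmode h n v) = hmode h n (shift nu v).
Proof.
apply: (eq_linear (f := shift nu \o hmode h n) (g := hmode h n \o shift nu)) => b.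
case: n => [[|m]|m] /=; rewrite ?linear0 // shiftE linear_sum.
  apply: eq_bigr => j _.
  by rewrite linearZ /= !annihilatorE linearZ /= shiftE.
by apply: eq_bigr => j _; rewrite linearZ /= !creatorE shiftE.
Qed.

Lemma shiftD nu nu' v : shift nu (shift nu' v) = shift (nu' + nu) v.
Proof.
apply: (eq_linear (f := shift nu \o shift nu') (g := shift (nu' + nu))).
by move=> b; rewrite /= !shiftE /= addrA.
Qed.

Lemma shift0 v : shift 0 v = v.
Proof.
apply: (eq_linear (f := shift 0) (g := idfun)) => b /=.
by rewrite shiftE addr0 -surjective_pairing.
Qed.

(** A creation mode adds a letter and an annihilation mode removes one, whence the opposite signs;
    at [n = 0] the operator is 0 and nothing is required. *)
Definition changes_deg (f : letter -> int) h (n q : int) : Prop :=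
  match n with
  | Negz m => forall j, h 0 j != 0 -> f (j, m) = q
  | Posz 0 => True
  | Posz m.+1 => forall j, pairing G h (delta_mx 0 j) != 0 -> f (j, m) = - q
  end.

Lemma supported_hmode f h n q b : changes_deg f h n q ->
  supported (fun b' => b'.2 = b.2 /\ letter_deg f b'.1 = letter_deg f b.1 + q)
    (hmode h n (bvec C b)).
Proof.
case: n => [[|m]|m] fq; first exact: supported0.
  apply: supported_sum => j _.
  have [->|hj] := eqVneq (pairing G h (delta_mx 0 j)) 0.
    by rewrite mulr0 scale0r; exact: supported0.
  apply: supportedZ; rewrite annihilatorE.
  have [->|bpos] := posnP (b.1 (j, m)); first by rewrite scale0r; exact: supported0.
  apply: supportedZ; apply: supportedU; split=> //=.
  by rewrite letter_deg_rem // fq // opprK.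
apply: supported_sum => j _.
have [->|hj] := eqVneq (h 0 j) 0; first by rewrite scale0r; exact: supported0.
apply: supportedZ; rewrite creatorE; apply: supportedU; split=> //=.
by rewrite letter_deg_add fq // addrC.
Qed.

Definition weight_deg (a : letter) : int := a.2.+1%:Z.
Definition weight (s : {mset letter}%mset) : int := letter_deg weight_deg s.

Lemma weight_ge0 s : 0 <= weight s.
Proof. exact: letter_deg_ge0. Qed.

Lemma changes_weight h n : changes_deg weight_deg h n (- n).
Proof. by case: n => [[|m]|m] //= j _; rewrite /weight_deg /=; lia. Qed.

Lemma weight_eq0 s : weight s = 0 -> s = mset0.
Proof.
move=> s0; apply/msetP => a; rewrite mset0E; apply/eqP.
rewrite -leqn0 leqNgt; apply/negP => sa.
have := letter_deg_rem weight_deg sa; rewrite -/(weight _) -/(weight s) s0.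
by have := weight_ge0 (mset_rem a s); rewrite /weight_deg; lia.
Qed.

Lemma mset_ind (T : {mset letter}%mset -> Prop) :
  T mset0 -> (forall a s, T s -> T (mset_add a s)) -> forall s, T s.
Proof.
move=> T0 TD s; have [n] := ubnP `|weight s|%N; elim: n s => // n IHn s lts.
have [s0|[a sa]] : s = mset0 \/ exists a, (0 < s a)%N.
- have [s0|[a]] := fset_0Vmem (finsupp s).
    left; apply/msetP => a; rewrite mset0E; apply/eqP; rewrite mset_eq0.
    by rewrite -msuppE s0 inE.
  by rewrite msuppE -mset_gt0 => sa; right; exists a.
- by rewrite s0.
rewrite -(mset_remK sa); apply/TD/IHn; move: lts; rewrite ltnS.
have := letter_deg_rem weight_deg sa; rewrite -/(weight _) -/(weight s).
have := weight_ge0 s; have := weight_ge0 (mset_rem a s).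
by rewrite /weight_deg /=; lia.
Qed.

Definition wt (b : fock_basis C l) : int := weight b.1.

Lemma wt_ge0 b : 0 <= wt b.
Proof. exact: weight_ge0. Qed.

Lemma supported_hmode_wt h n b :
  supported (fun b' => b'.2 = b.2 /\ wt b' = wt b - n) (hmode h n (bvec C b)).
Proof. exact: supported_hmode (changes_weight h n). Qed.

End Oscillators.

Arguments hmode : simpl never.

(** * Vertex operators *)

Section VertexOperator.
Context {C : numFieldType} {l : nat}.
Local Notation V := (free_module C (fock_basis C l)).
Variable G : 'M[C]_l.
Hypothesis G_sym : G^T = G.
Implicit Types (h g : 'rV[C]_l) (v : V) (b : fock_basis C l) (n : int).

Definition cmode g (m : nat) (v : V) : V := m%:R^-1 *: hmode G g (- m%:Z) v.
HB.instance Definition _ g m :=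
  GRing.Linear.copy (cmode g m) (m%:R^-1 \*: hmode G g (- m%:Z)).

Definition amode g (m : nat) (v : V) : V := (- m%:R^-1) *: hmode G g m%:Z v.
HB.instance Definition _ g m :=
  GRing.Linear.copy (amode g m) ((- m%:R^-1) \*: hmode G g m%:Z).

(* The coefficients of exp (\sum_(m >= 1) g(-m) z^m / m) and of
   exp (- \sum_(m >= 1) g(m) z^-m / m). *)
Definition creation_exp g (n : int) : V -> V := exp_int (fun m => cmode g m) n.
HB.instance Definition _ g n := GRing.Linear.on (creation_exp g n).

Definition annihilation_exp g (n : int) : V -> V :=
  exp_int (fun m => amode g m) n.
HB.instance Definition _ g n := GRing.Linear.on (annihilation_exp g n).

Arguments creation_exp : simpl never.
Arguments annihilation_exp : simpl never.

Local Notation P := creation_exp.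
Local Notation Q := annihilation_exp.

Lemma hmode0 h v : hmode G h 0 v = 0. Proof. by []. Qed.

Lemma cmode0 g v : cmode g 0 v = 0.
Proof. by rewrite /cmode hmode0 scaler0. Qed.

Lemma amode0 g v : amode g 0 v = 0.
Proof. by rewrite /amode hmode0 scaler0. Qed.

Lemma hmode_cmode h (k : int) g m v : k != 0 ->
  hmode G h k (cmode g m.+1 v) =
  cmode g m.+1 (hmode G h k v) +
  (if m.+1%:Z == k then pairing G h g else 0) *: v.
Proof.
move=> k0; rewrite /cmode linearZ /= hmode_comm // scalerDr scalerA.
congr (_ + _ *: _); rewrite subr_eq0 eq_sym; case: eqP => [<-|_]; last by rewrite mulr0.
by rewrite mulrA -pmulrn mulVf ?mul1r // pnatr_eq0.
Qed.

Lemma hmode_amode h (k : int) g m v : k != 0 ->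
  hmode G h k (amode g m.+1 v) =
  amode g m.+1 (hmode G h k v) +
  (if m.+1%:Z == - k then pairing G h g else 0) *: v.
Proof.
move=> k0; rewrite /amode linearZ /= hmode_comm // scalerDr scalerA.
congr (_ + _ *: _); rewrite addr_eq0 eq_sym [_ == k]eqr_oppLR.
case: eqP => [kE|_]; last by rewrite mulr0.
have -> : k = - m.+1%:Z by rewrite kE opprK.
by rewrite mulrNz !mulNr mulrN opprK mulrA -pmulrn mulVf ?mul1r // pnatr_eq0.
Qed.

Lemma cmodeC g g' i j v : cmode g i (cmode g' j v) = cmode g' j (cmode g i v).
Proof.
case: i => [|i]; first by rewrite /= !cmode0 linear0.
rewrite {1}/cmode; case: j => [|j]; first by rewrite !cmode0 linear0 scaler0.
by rewrite hmode_cmode // scale0r addr0 -linearZ.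
Qed.

Lemma amodeC g g' i j v : amode g i (amode g' j v) = amode g' j (amode g i v).
Proof.
case: i => [|i]; first by rewrite /= !amode0 linear0.
rewrite {1}/amode; case: j => [|j]; first by rewrite !amode0 linear0 scaler0.
by rewrite hmode_amode // scale0r addr0 -linearZ.
Qed.

Lemma hmode_creation_exp h g (k n : int) v : k != 0 ->
  hmode G h k (P g n v) =
  P g n (hmode G h k v) + (if 0 < k then pairing G h g else 0) *: P g (n - k) v.
Proof.
move=> k0; have [kpos|kneg] := ltP 0 k.
  case: k k0 kpos => // -[|k] // _ _.
  have gC i j u := cmodeC g g i j u.
  apply: (exp_int_derivation gC (f := hmode G h k.+1) (kap := pairing G h g)
    n v (ltn0Sn k)) => m u.
  exact: hmode_cmode.
rewrite scale0r addr0; apply: exp_int_commute => -[|m] u.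
  by rewrite /= !cmode0 linear0.
rewrite /= hmode_cmode // (_ : (_ == k) = false) ?scale0r ?addr0 //.
by apply/eqP; lia.
Qed.

Lemma hmode_annihilation_exp h g (k n : int) v : k != 0 ->
  hmode G h k (Q g n v) =
  Q g n (hmode G h k v) + (if k < 0 then pairing G h g else 0) *: Q g (n + k) v.
Proof.
move=> k0; have [kneg|kpos] := ltP k 0.
  case: k k0 kneg => // k _ _; rewrite NegzE.
  have gC i j u := amodeC g g i j u.
  apply: (exp_int_derivation gC (f := hmode G h (- k.+1%:Z))
    (kap := pairing G h g) n v (ltn0Sn k)) => m u.
  by have := hmode_amode h g m u (_ : - k.+1%:Z != 0); rewrite opprK; apply.
rewrite scale0r addr0; apply: exp_int_commute => -[|m] u.
  by rewrite /= !amode0 linear0.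
rewrite /= hmode_amode // (_ : (_ == - k) = false) ?scale0r ?addr0 //.
by apply/eqP; lia.
Qed.

Lemma shift_creation_exp nu g n v : shift nu (P g n v) = P g n (shift nu v).
Proof.
by apply: exp_int_commute => m u; rewrite /= /cmode linearZ /= shift_hmode.
Qed.

Lemma shift_annihilation_exp nu g n v : shift nu (Q g n v) = Q g n (shift nu v).
Proof.
by apply: exp_int_commute => m u; rewrite /= /amode linearZ /= shift_hmode.
Qed.

Lemma creation_exp_lt0 g n v : n < 0 -> P g n v = 0.
Proof. exact: exp_int_lt0. Qed.

Lemma annihilation_exp_lt0 g n v : n < 0 -> Q g n v = 0.
Proof. exact: exp_int_lt0. Qed.

Lemma creation_exp0 g v : P g 0 v = v.
Proof. exact: exp_int0. Qed.

Lemma annihilation_exp0 g v : Q g 0 v = v.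
Proof. exact: exp_int0. Qed.

Definition has_weight (n : int) (b : fock_basis C l) : Prop := wt b = n.

Lemma supported_cmode g m b :
  supported (fun b' => b'.2 = b.2 /\ wt b' = wt b + m%:Z)
    (cmode g m (bvec C b)).
Proof.
apply: supportedZ; have := supported_hmode_wt G g (- m%:Z) b.
by rewrite opprK.
Qed.

Lemma supported_amode g m b :
  supported (fun b' => b'.2 = b.2 /\ wt b' = wt b - m%:Z)
    (amode g m (bvec C b)).
Proof. by apply: supportedZ; exact: supported_hmode_wt. Qed.

Lemma supported_creation_exp g n b :
  supported (fun b' => b'.2 = b.2 /\ wt b' = wt b + n)
    (P g n (bvec C b)).
Proof.
have := @supported_exp_int C _ (fun m => cmode g m)
  (fun _ (n : nat) b b' => b'.2 = b.2 /\ wt b' = wt b + n%:Z).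
move=> /(_ _ _ n b) H; apply: (supportedW _ (H _ _)).
- by move=> b' [s [m [-> ]]].
- by move=> b'; rewrite addr0.
move=> s m i b1 b2 [e1 e2] /=; apply: (supportedW _ (supported_cmode g i.+1 b2)).
by move=> b3 [-> ->]; split=> //; rewrite e2 PoszD; lia.
Qed.

Lemma supported_annihilation_exp g n b :
  supported (fun b' => b'.2 = b.2 /\ wt b' = wt b - n)
    (Q g n (bvec C b)).
Proof.
have := @supported_exp_int C _ (fun m => amode g m)
  (fun _ (n : nat) b b' => b'.2 = b.2 /\ wt b' = wt b - n%:Z).
move=> /(_ _ _ n b) H; apply: (supportedW _ (H _ _)).
- by move=> b' [s [m [-> ]]].
- by move=> b'; rewrite subr0.
move=> s m i b1 b2 [e1 e2] /=; apply: (supportedW _ (supported_amode g i.+1 b2)).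
by move=> b3 [-> ->]; split=> //; rewrite e2 PoszD; lia.
Qed.

Lemma annihilation_exp_eq0 g n v :
  supported (fun b => wt b < n) v -> Q g n v = 0.
Proof.
apply: (eq_linear_on (f := Q g n) (g := \0)) => b bn /=.
apply: (supported_none _ (supported_annihilation_exp g n b)) => b' [_ b'b].
by have := wt_ge0 b'; lia.
Qed.

(* The coefficient of z^a in the product of the two exponentials. *)
Definition vertex g (a : int) : V -> V :=
  ext (fun b => \sum_(t < `|wt b|.+1) P g (a + t%:Z) (Q g t%:Z (bvec C b))).
HB.instance Definition _ g a := GRing.Linear.on (vertex g a).

(** An annihilation exponential of degree above the weight vanishes, so any weight bound may serve
    as the range; vectors of different weights can then share one. *)
Lemma vertexE N g a v : supported (fun b => wt b < N%:Z) v ->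
  vertex g a v = \sum_(t < N) P g (a + t%:Z) (Q g t%:Z v).
Proof.
pose f (u : V) : V := \sum_(t < N) P g (a + t%:Z) (Q g t%:Z u).
have f_linear : linear f.
  move=> c u w; rewrite /f scaler_sumr -big_split; apply: eq_bigr => t _ /=.
  by rewrite !linearP.
pose fl := GRing.isLinear.Build C V V *:%R f f_linear.
pose F : {linear V -> V} := HB.pack f fl.
apply: (eq_linear_on (f := vertex g a) (g := F)) => b bN.
rewrite /= /vertex extE /f.
apply: (big_ord_extend (F := fun t => P g (a + t%:Z) (Q g t%:Z (bvec C b)))).
  by have := wt_ge0 b; lia.
move=> t wt; rewrite annihilation_exp_eq0 ?linear0 //.
by apply: supportedU; have := wt_ge0 b; lia.
Qed.

Lemma vertex_bound v : exists N, supported (fun b => wt b < N%:Z) v.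
Proof.
apply: (@supported_ind _ _ (fun=> True) (fun v => exists N,
  supported (fun b => wt b < N%:Z) v)) => //.
  by exists 0; exact: supported0.
move=> c b x _ [N xN]; exists (N + `|wt b|).+1.
apply: supportedD.
  by apply: supportedZ; apply: supportedU; have := wt_ge0 b; lia.
by apply: supportedW xN => b'; lia.
Qed.

Lemma supported_vertex g a b :
  supported (fun b' => b'.2 = b.2 /\ wt b' = wt b + a)
    (vertex g a (bvec C b)).
Proof.
rewrite /vertex extE; apply: supported_sum => t _.
apply: supported_linear (supported_annihilation_exp g t%:Z b) => b1 [e1 e2].
apply: (supportedW _ (supported_creation_exp g (a + t%:Z) b1)) => b2 [-> ->].
by rewrite e1 e2; split=> //; lia.
Qed.

Lemma vertex_weight g a n v : supported (has_weight n) v ->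
  supported (has_weight (n + a)) (vertex g a v).
Proof.
apply: supported_linear => b bn.
apply: (supportedW _ (supported_vertex g a b)) => b' [_ e].
by rewrite /has_weight e bn.
Qed.

Lemma shift_vertex nu g a v : shift nu (vertex g a v) = vertex g a (shift nu v).
Proof.
apply: (eq_linear (f := shift nu \o vertex g a) (g := vertex g a \o shift nu)) => b.
rewrite /= shiftE /vertex !extE linear_sum /=; apply: eq_bigr => t _.
by rewrite /= shift_creation_exp /= shift_annihilation_exp shiftE.
Qed.

(** The Heisenberg commutator [[h(k), Y(e^g, z)] = <h, g> z^k Y(e^g, z)]: for [k > 0] the extra term
    comes from the creation exponential, for [k < 0] from the annihilation exponential. *)
Lemma hmode_vertex h g (k a : int) v : k != 0 ->
  hmode G h k (vertex g a v) =
  vertex g a (hmode G h k v) + pairing G h g *: vertex g (a - k) v.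
Proof.
move=> k0; have [N vN] := vertex_bound v.
(* The extra [|k|] covers the weight that [h(k)] may add and, for [k < 0], the reindexing of the
   annihilation degree by [|k|]. *)
pose M := (`|k| + N)%N.
have vM : supported (fun b => wt b < M%:Z) v.
  by apply: supportedW vN => b; rewrite /M; lia.
have hvM : supported (fun b => wt b < M%:Z) (hmode G h k v).
  apply: supported_linear vN => b bN.
  apply: (supportedW _ (supported_hmode_wt G h k b)) => b' [_].
  by rewrite /M => ->; lia.
rewrite (vertexE _ _ vM) (vertexE _ _ hvM) linear_sum /=.
under eq_bigr do rewrite hmode_creation_exp // hmode_annihilation_exp //
  linearD /= linearZ /= -addrA.
rewrite big_split; congr (_ + _).
have [kneg|kpos] := ltP k 0.
  rewrite ltNge ltW //=.
  under eq_bigr do rewrite scale0r addr0.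
  rewrite -scaler_sumr; congr (_ *: _); rewrite (vertexE _ _ vN).
  rewrite big_split_ord big1 /= => [|t _]; last first.
    by rewrite annihilation_exp_lt0 ?linear0 //; have := ltn_ord t; lia.
  rewrite add0r; apply: eq_bigr => t _.
  have e1 : a + (absz k + t)%N%:Z = a - k + t%:Z by lia.
  have e2 : (absz k + t)%N%:Z + k = t%:Z by lia.
  by rewrite e1 e2.
rewrite lt_neqAle eq_sym k0 kpos /=.
under eq_bigr do rewrite scale0r add0r.
by rewrite -scaler_sumr (vertexE _ _ vM); congr (_ *: _); apply: eq_bigr => t _;
  rewrite addrAC.
Qed.

End VertexOperator.

Arguments creation_exp : simpl never.
Arguments annihilation_exp : simpl never.
Arguments vertex : simpl never.

(** * Vacuum vectors and two-point functions *)

Section Vacuum.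
Context {C : numFieldType} {l : nat}.
Local Notation V := (free_module C (fock_basis C l)).
Variable G : 'M[C]_l.
Hypothesis G_sym : G^T = G.
Implicit Types (h g : 'rV[C]_l) (v : V) (b w : fock_basis C l) (n : int).

Definition is_vacuum b : Prop := b.1 = mset0.

Lemma fcoef_annihilator a b v :
  fcoef b (annihilator a v) = (b.1 a).+1%:R * fcoef (mset_add a b.1, b.2) v.
Proof.
apply: (@supported_ind _ _ (fun=> True) (fun v => fcoef b (annihilator a v) =
  (b.1 a).+1%:R * fcoef (mset_add a b.1, b.2) v)) => //.
  by rewrite linear0 !fcoef0 mulr0.
move=> c d x _ IH; rewrite linearP !fcoefD !fcoefZ IH mulrDr mulrCA; congr (_ * _ + _).
rewrite /= annihilatorE fcoefZ !fcoef_bvec.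
have [->|neq] := eqVneq d (mset_add a b.1, b.2).
  by rewrite /= mset_addE eqxx mset_addK -surjective_pairing eqxx.
rewrite mulr0; have [->|dpos] := posnP (d.1 a); first by rewrite mul0r.
case: eqP => [bE|_]; last by rewrite mulr0.
by case/eqP: neq; rewrite -bE /= mset_remK -?surjective_pairing.
Qed.

(** If [b] contains a letter [a], the coefficient of [v] at [b] is, up to a positive integer, the
    coefficient of [annihilator a v] at [b] with one [a] removed. *)
Lemma supported_vacuum v :
  (forall a, annihilator a v = 0) -> supported is_vacuum v.
Proof.
move=> av0; split=> b; apply: contra_neqP => bn0.
have [a ba] : exists a, (0 < b.1 a)%N.
  apply: contrapT => nba; apply: bn0; apply/msetP => a; rewrite mset0E.
  by apply/eqP; rewrite -leqn0 leqNgt; apply/negP => ba; apply: nba; exists a.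
have := fcoef_annihilator a (mset_rem a b.1, b.2) v.
rewrite av0 fcoef0 /= mset_remK // -surjective_pairing => /esym/eqP.
by rewrite mulf_eq0 pnatr_eq0 => /eqP.
Qed.

Lemma hmode_vacuum h m w : is_vacuum w -> hmode G h m.+1 (bvec C w) = 0.
Proof.
move=> w0; apply: big1 => j _.
by rewrite annihilatorE w0 mset0E scale0r scaler0.
Qed.

Lemma annihilation_exp_vacuum g n w : is_vacuum w ->
  annihilation_exp G g n (bvec C w) = (n == 0)%:R *: bvec C w.
Proof.
move=> w0; apply: exp_int_vacuum => [i j u|m]; first exact: amodeC.
by rewrite /= /amode hmode_vacuum // scaler0.
Qed.

Lemma vertex_vacuum g n w : is_vacuum w ->
  vertex G g n (bvec C w) = creation_exp G g n (bvec C w).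
Proof.
move=> w0; rewrite (@vertexE _ _ G 1 g).
  by rewrite big_ord1 addr0 annihilation_exp_vacuum // eqxx scale1r.
by apply: supportedU; rewrite /wt w0 /weight letter_deg0.
Qed.

Lemma creation_exp_vacuum_weight g n w : is_vacuum w ->
  supported (has_weight n) (creation_exp G g n (bvec C w)).
Proof.
move=> w0; apply: (supportedW _ (supported_creation_exp G g n w)) => b [_].
by rewrite /has_weight {2}/wt w0 /weight letter_deg0 add0r.
Qed.

Lemma vertex_lowest g (s : nat) v : supported (has_weight s%:Z) v ->
  vertex G g (- s%:Z) v = annihilation_exp G g s%:Z v.
Proof.
move=> vs; rewrite (@vertexE _ _ G s.+1 g); last first.
  by apply: supportedW vs => b; rewrite /has_weight => ->; lia.
rewrite big_ord_recr big1 /= => [|t _]; last first.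
  by rewrite creation_exp_lt0 //; have := ltn_ord t; lia.
by rewrite add0r addNr creation_exp0.
Qed.

(* The coefficient of x^b in (1 - x)^kap, for kap = 1 or kap = -1. *)
Definition binom_coef (kap b : int) : C :=
  if b < 0 then 0 else if kap == 1 then (b == 0)%:R - (b == 1)%:R else 1.

(** Only the creation exponential of the inner operator and the annihilation exponential of the
    outer one act, and their contraction is the two-point function [(1 - x)^<g, g'>]. *)
Lemma vertex_vertex_vacuum g g' (kap a b : int) w :
  kap = 1 \/ kap = -1 -> pairing G g g' = kap%:~R -> is_vacuum w -> a + b = 0 ->
  vertex G g a (vertex G g' b (bvec C w)) = binom_coef kap b *: bvec C w.
Proof.
move=> kapE gg' w0 ab0; rewrite vertex_vacuum // /binom_coef.
have [b0|b0] := ltP b 0; first by rewrite creation_exp_lt0 // linear0 scale0r.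
case: b b0 ab0 => // s _ as0; have -> : a = - s%:Z by lia.
rewrite vertex_lowest; last exact: creation_exp_vacuum_weight.
pose D (s : nat) := annihilation_exp G g s%:Z (creation_exp G g' s%:Z (bvec C w)).
have D0 : D 0%N = bvec C w by rewrite /D annihilation_exp0 creation_exp0.
(* The logarithmic derivative of [(1 - x)^kap], in the form [x D' = - kap (x / (1 - x)) D]. *)
have Drec (n : nat) : n%:R *: D n = - kap%:~R *: \sum_(m < n) D (n - m.+1)%N.
  have gC i j u := amodeC G_sym g g i j u.
  have -> : n%:R *: D n = (n%:Z)%:~R *: D n by [].
  rewrite /D (exp_int_rec gC (N := n)) // scaler_sumr; apply: eq_bigr => m _.
  have lemn : (m < n)%N by [].
  rewrite exp_int_commute => [|j u]; last exact: gC.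
  rewrite /= /amode hmode_creation_exp // hmode_vacuum // linear0 add0r /= gg'.
  rewrite !linearZ /= !scalerA mulrAC mulNr mulVf ?pnatr_eq0 // mulN1r.
  by rewrite subzn.
rewrite -/(D s); case: kapE => kE; rewrite {}kE in gg' Drec *; last first.
  rewrite scale1r; elim/ltn_ind: s {as0} => n IHn.
  case: n IHn => [|n] IHn; first exact: D0.
  apply: (@scalerI _ _ n.+1%:R); first by rewrite pnatr_eq0.
  rewrite Drec mulrNz opprK scale1r.
  under eq_bigr => m _ do rewrite IHn ?ltnS ?subSS ?leq_subr //.
  by rewrite sumr_const card_ord scaler_nat.
rewrite eqxx; elim/ltn_ind: s {as0} => -[|[|n]] IHn.
- by rewrite D0 subr0 scale1r.
- by have := Drec 1%N; rewrite scale1r big_ord1 subnn D0 => ->; rewrite sub0r.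
apply: (@scalerI _ _ n.+2%:R); first by rewrite pnatr_eq0.
rewrite Drec !big_ord_recr /= big1 => [|m _]; last first.
  rewrite IHn; last by rewrite ltnS; lia.
  have lt := ltn_ord m; rewrite (_ : (n.+2 - m.+1)%N = (n - m.+1).+2); last by lia.
  by rewrite subrr scale0r.
rewrite subSS subSnn subnn D0 (IHn 1%N) //= sub0r scaleN1r add0r.
by rewrite scaleN1r addNr oppr0 subrr scale0r scaler0.
Qed.

End Vacuum.

(** * Clifford relations on the fermionic lattice *)

Section Fermion.
Context {C : numFieldType}.
Local Notation V := (free_module C (fock_basis C 1)).
Local Notation G := (phi_gram C).
Local Notation phi := (phi C).
Implicit Types (v : V) (b w : fock_basis C 1) (i j k m n : int).

Lemma phi_gram_sym : G^T = G.
Proof. exact: trmx1. Qed.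

Lemma pairing_phi : pairing G phi phi = 1.
Proof. by rewrite /pairing mulmx1 mxE big_ord1 !mxE mulr1. Qed.

Lemma hmode_phi_creator (m : nat) v :
  hmode G phi (Negz m) v = creator (ord0, m) v.
Proof. by rewrite /hmode big_ord1 mxE scale1r. Qed.

Lemma hmode_phi_annihilator (m : nat) v :
  hmode G phi m.+1 v = m.+1%:R *: annihilator (ord0, m) v.
Proof.
rewrite /hmode big_ord1 (_ : delta_mx 0 0 = phi) ?pairing_phi ?mulr1 //.
by apply/matrixP => i j; rewrite !mxE !ord1 eqxx.
Qed.

Lemma supported_phi_vacuum v :
  (forall m : nat, hmode G phi m.+1 v = 0) -> supported is_vacuum v.
Proof.
move=> v0; apply: supported_vacuum => -[j m]; rewrite ord1.
apply: (@scalerI _ _ m.+1%:R); first by rewrite pnatr_eq0.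
by rewrite -hmode_phi_annihilator v0 scaler0.
Qed.

Lemma binom_coef_pos j :
  binom_coef 1 j + binom_coef 1 (1 - j) = 0 :> C.
Proof.
rewrite /binom_coef eqxx.
have [->|[->|[lt|gt]]] : j = 0 \/ j = 1 \/ j < 0 \/ 1 < j by lia.
- by rewrite subr0 /=; ring.
- by rewrite subrr /=; ring.
- have e0 : (1 - j < 0) = false by lia.
  have e1 : (1 - j == 0) = false by lia.
  have e2 : (1 - j == 1) = false by lia.
  by rewrite lt e0 e1 e2 subrr addr0.
- have e0 : (1 - j < 0) = true by lia.
  have e1 : (j < 0) = false by lia.
  have e2 : (j == 0) = false by lia.
  have e3 : (j == 1) = false by lia.
  by rewrite e0 e1 e2 e3 subrr addr0.
Qed.

(** Exactly one of [j] and [-1 - j] is nonnegative: the two orders of opposite charges together give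
    the delta function, whereas for equal charges the coefficients 1 and -1 of [1 - x] cancel. *)
Lemma binom_coef_neg j :
  binom_coef (-1) j + binom_coef (-1) (-1 - j) = 1 :> C.
Proof.
rewrite /binom_coef /=; have [lt|ge] := ltP j 0.
  have e0 : (-1 - j < 0) = false by lia.
  by rewrite e0 add0r.
have e0 : (-1 - j < 0) = true by lia.
by rewrite e0 addr0.
Qed.

(* A family that the Heisenberg modes permute like the modes of a product of
   two vertex operators is determined by its lowest terms on the vacua. *)
Lemma mode_family_eq0 (Z : int -> int -> {linear V -> V}) (e e' : C) :
  (forall k i j v, k != 0 -> hmode G phi k (Z i j v) =
     Z i j (hmode G phi k v) + e *: Z (i - k) j v + e' *: Z i (j - k) v) ->
  (forall i j w, is_vacuum w -> supported (has_weight (i + j)) (Z i j (bvec C w))) ->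
  (forall i j w, is_vacuum w -> i + j = 0 -> Z i j (bvec C w) = 0) ->
  forall i j v, Z i j v = 0.
Proof.
move=> ZC Zw Z0.
have Zvac w : is_vacuum w -> forall (n : nat) i j, i + j = n%:Z ->
    Z i j (bvec C w) = 0.
  move=> w0; elim/ltn_ind => n IHn i j ijn.
  have Zneg i' j' : i' + j' < n%:Z -> Z i' j' (bvec C w) = 0.
    move=> lt; have [neg|pos] := ltP (i' + j') 0; last first.
      by apply: (IHn (absz (i' + j')%R)); lia.
    apply: (supported_none _ (Zw i' j' w w0)) => b.
    by rewrite /has_weight; have := wt_ge0 b; lia.
  have [n0|npos] := posnP n; first by apply: Z0 => //; rewrite ijn n0.
  (* Positive modes kill [Z i j w], since they lower [i + j], where the family already vanishes.
     Being supported on vacua, it has weight 0, while its weight is [i + j > 0]. *)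
  have vacZ : supported is_vacuum (Z i j (bvec C w)).
    apply: supported_phi_vacuum => m; rewrite ZC // hmode_vacuum // linear0 add0r.
    by rewrite !Zneg ?scaler0 ?addr0 //; lia.
  apply: (supported_none _ (supportedI vacZ (Zw i j w w0))) => b [b0].
  by rewrite /has_weight /wt b0 /weight letter_deg0; lia.
move=> i j v; apply: (eq_linear (f := Z i j) (g := \0)) => -[s beta] /=.
elim/(@mset_ind 1): s i j => [|[a m] s IHs] i j.
  have [neg|pos] := ltP (i + j) 0; last by apply: (Zvac _ _ (absz (i + j)%R)) => //; lia.
  apply: (supported_none _ (Zw i j _ _)) => // b.
  by rewrite /has_weight; have := wt_ge0 b; lia.
(* Every basis vector arises from a vacuum by modes [phi(-m-1)], and commuting [Z] past such a mode
   produces only members of the family on shorter monomials. *)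
have -> : bvec C (mset_add (a, m) s, beta) =
    hmode G phi (Negz m) (bvec C (s, beta)).
  by rewrite hmode_phi_creator creatorE ord1.
have := ZC (Negz m) i j (bvec C (s, beta)) isT.
by rewrite !IHs !scaler0 !addr0 linear0 => <-.
Qed.

(** The shifts by [kap] stand for the zero modes: applying one field first changes the exponent of
    [z] in the other by [<g, g'> = kap]. The subtracted scalar is the expected delta function for
    opposite charges. *)
Definition anticommutator (g g' : 'rV[C]_1) (kap i j : int) (v : V) : V :=
  vertex G g i (vertex G g' j v) + vertex G g' (j - kap) (vertex G g (i + kap) v)
  + (- ((kap == -1) && (i + j == 0))%:R) *: v.
HB.instance Definition _ g g' kap i j :=
  GRing.Linear.copy (anticommutator g g' kap i j)
    ((vertex G g i \o vertex G g' j) \+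
     (vertex G g' (j - kap) \o vertex G g (i + kap)) \+
     ((- ((kap == -1) && (i + j == 0))%:R) \*: idfun)).

Lemma anticommutator_eq0 g g' (kap : int) i j v :
  pairing G phi g * pairing G phi g' = kap%:~R ->
  pairing G g g' = kap%:~R ->
  kap = 1 \/ (kap = -1 /\ pairing G phi g + pairing G phi g' = 0) ->
  anticommutator g g' kap i j v = 0.
Proof.
move=> ee gg' kapE; have sym := phi_gram_sym.
have kap1 : kap = 1 \/ kap = -1 by case: kapE => [|[]]; [left | right].
set e := pairing G phi g in ee kapE; set e' := pairing G phi g' in ee kapE.
apply: (mode_family_eq0 (Z := fun i j => anticommutator g g' kap i j)
  (e := e) (e' := e')) => {i j v}.
- move=> k i j v k0; rewrite /= /anticommutator !linearD /= !linearZ /=.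
  rewrite !hmode_vertex // -/e -/e' !linearD /= !linearZ /=.
  rewrite [i - k + kap]addrAC [j - k - kap]addrAC.
  rewrite [i - k + j]addrAC [i + (j - k)]addrA.
  set d := ((kap == -1) && (i + j - k == 0))%:R : C.
  (* The scalar term must obey the same commutation rule as the products: it occurs in both shifted
     members at [i + j = k], and the two occurrences cancel because [e + e' = 0] for opposite
     charges. *)
  have ed : e * d = - e' * d.
    case: kapE => [k1|[_ ee0]]; first by rewrite /d k1 !mulr0.
    by congr (_ * _); apply/eqP; rewrite -addr_eq0 ee0.
  apply/fcoefP => b; rewrite !(fcoefD, fcoefZ).
  by ring: ed.
- move=> i j w w0 /=; have vw : supported (has_weight 0) (bvec C w).
    by apply: supportedU; rewrite /has_weight /wt w0 /weight letter_deg0.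
  apply: supportedD; first apply: supportedD.
  + have := vertex_weight G g i (vertex_weight G g' j vw).
    by rewrite add0r [j + i]addrC.
  + have := vertex_weight G g' (j - kap) (vertex_weight G g (i + kap) vw).
    by rewrite add0r (_ : i + kap + (j - kap) = i + j) //; lia.
  + case: eqP => _; last by rewrite oppr0 scale0r; exact: supported0.
    case: eqP => [->|_]; last by rewrite oppr0 scale0r; exact: supported0.
    exact: supportedZ.
- move=> i j w w0 ij0; rewrite /= /anticommutator ij0 eqxx andbT.
  rewrite (vertex_vertex_vacuum sym kap1 gg' w0 ij0).
  have g'g : pairing G g' g = kap%:~R by rewrite pairingC.
  rewrite (vertex_vertex_vacuum sym kap1 g'g w0); last by rewrite -ij0; lia.
  rewrite -!scalerDl -[RHS](scale0r (bvec C w)); congr (_ *: _).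
  have -> : i = - j by lia.
  rewrite addrC [- j + _]addrC; apply/eqP; rewrite addrC subr_eq0; apply/eqP.
  by case: kap1 => ->; rewrite ?binom_coef_pos ?binom_coef_neg.
Qed.

(** The exponent is [- n - 1 - <gamma, beta>] with [n = j] and [<phi, beta> = i]; in [eta],
    [n = - m - 1] and [<- phi, beta> = - i] give [m + i]. The lattice shifts are added later. *)
Definition psi (i j : int) : V -> V := vertex G phi (- j - 1 - i).
HB.instance Definition _ i j := GRing.Linear.on (psi i j).

Definition eta (i m : int) : V -> V := vertex G (- phi) (m + i).
HB.instance Definition _ i m := GRing.Linear.on (eta i m).

Lemma pairing_phiN : pairing G phi (- phi) = -1.
Proof. by rewrite -scaleN1r pairingZr pairing_phi mulr1. Qed.

Lemma pairing_phiNN : pairing G (- phi) (- phi) = 1.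
Proof. by rewrite -{1}scaleN1r pairingZl pairing_phiN mulrNN mulr1. Qed.

Lemma psi_psi i j k v : psi (i + 1) j (psi i k v) = - psi (i + 1) k (psi i j v).
Proof.
apply/eqP; rewrite -addr_eq0; apply/eqP.
have := @anticommutator_eq0 phi phi 1 (- j - 1 - (i + 1)) (- k - 1 - i) v.
rewrite /anticommutator pairing_phi mulr1 => /(_ erefl erefl (or_introl erefl)).
rewrite /= oppr0 scale0r addr0 /psi => <-.
have e1 : - k - 1 - (i + 1) = - k - 1 - i - 1 by lia.
have e2 : - j - 1 - i = - j - 1 - (i + 1) + 1 by lia.
by rewrite e1 -e2.
Qed.

Lemma eta_eta i j k v : eta (i - 1) j (eta i k v) = - eta (i - 1) k (eta i j v).
Proof.
apply/eqP; rewrite -addr_eq0; apply/eqP.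
have := @anticommutator_eq0 (- phi) (- phi) 1 (j + (i - 1)) (k + i) v.
rewrite /anticommutator pairing_phiN pairing_phiNN mulrNN mulr1.
move=> /(_ erefl erefl (or_introl erefl)).
rewrite /= oppr0 scale0r addr0 /eta => <-.
have e1 : k + (i - 1) = k + i - 1 by lia.
have e2 : j + i = j + (i - 1) + 1 by lia.
by rewrite e1 -e2.
Qed.

Lemma psi_eta i j m v :
  psi (i - 1) j (eta i m v) + eta (i + 1) m (psi i j v) = (j == m)%:R *: v.
Proof.
apply/eqP; rewrite -subr_eq0 -scaleNr; apply/eqP.
have := @anticommutator_eq0 phi (- phi) (-1) (- j - 1 - (i - 1)) (m + i) v.
rewrite /anticommutator pairing_phi pairing_phiN mul1r subrr.
move=> /(_ erefl erefl (or_intror (conj erefl erefl))).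
rewrite eqxx /= /psi /eta => <-.
have e0 : (- j - 1 - (i - 1) + (m + i) == 0) = (j == m) by apply/idP/idP; lia.
have e1 : m + (i + 1) = m + i - -1 by lia.
have e2 : - j - 1 - i = - j - 1 - (i - 1) + -1 by lia.
by rewrite e0 e1 -e2.
Qed.

(* Total weight w on the charge i part, where e^(i phi) has weight i (i + 1) / 2. *)
Definition of_weight (i w : int) (b : fock_basis C 1) : Prop :=
  2 * wt b + i * (i + 1) = 2 * w.

Lemma of_weight_ge0 i n b : of_weight i n b -> 0 <= n.
Proof.
rewrite /of_weight; have := wt_ge0 b.
have : 0 <= i * (i + 1) by case: (lerP 0 i) => ?; [|rewrite -mulrNN]; apply: mulr_ge0; lia.
lia.
Qed.

Lemma psi_weight i j (w : int) v : supported (of_weight i w) v ->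
  supported (of_weight (i + 1) (w - j)) (psi i j v).
Proof.
apply: supported_linear => b bw.
apply: (supportedW _ (supported_vertex G phi (- j - 1 - i) b)) => b' [_].
rewrite /of_weight in bw *; have -> : (i + 1) * (i + 1 + 1) = i * (i + 1) + 2 * (i + 1) by ring.
lia.
Qed.

Lemma eta_weight i m (w : int) v : supported (of_weight i w) v ->
  supported (of_weight (i - 1) (w + m)) (eta i m v).
Proof.
apply: supported_linear => b bw.
apply: (supportedW _ (supported_vertex G (- phi) (m + i) b)) => b' [_].
rewrite /of_weight in bw *; have -> : (i - 1) * (i - 1 + 1) = i * (i + 1) - 2 * i by ring.
lia.
Qed.

End Fermion.

(** * The energy operator of the fermions *)

Section Energy.
Context {C : numFieldType}.
Local Notation V := (free_module C (fock_basis C 1)).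
Local Notation G := (phi_gram C).
Local Notation phi := (phi C).
Implicit Types (v : V) (b : fock_basis C 1) (i j k m n : int).

(** Descending induction on [t]: in the sum for [vertex G g (- t)], degrees below [t] meet a
    creation exponential of negative index and degrees above [t] vanish by induction, leaving the
    annihilation exponential of degree [t]. *)
Lemma annihilation_exp_vanish g n v :
  (forall t : nat, n < t%:Z -> vertex G g (- t%:Z) v = 0) ->
  forall t : nat, n < t%:Z -> annihilation_exp G g t%:Z v = 0.
Proof.
move=> v0; have [N vN] := vertex_bound v.
suff H d (t : nat) : (N - t <= d)%N -> n < t%:Z -> annihilation_exp G g t%:Z v = 0.
  by move=> t; apply: (H (N - t)%N).
elim: d t => [|d IHd] t Nt nt; (have [leNt|ltN] := leqP N t; first by
  apply: annihilation_exp_eq0; apply: supportedW vN => b; lia); first by lia.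
have := v0 t nt; rewrite (vertexE _ _ _ vN) (bigD1 (Ordinal ltN)) //=.
rewrite addNr creation_exp0 big1 ?addr0 // => s; rewrite -val_eqE /= => st.
have [lts|les] := ltnP s t; first by rewrite creation_exp_lt0 //; lia.
by rewrite IHd ?linear0 //; lia.
Qed.

(** The lowering modes force the annihilation exponentials of [phi] to vanish in degrees above
    [i + 1], and those of [- phi] in degrees above [- i]. If [i < -1] or [i > 0], one of these
    ranges contains degree 0, where the exponential is the identity. For [i = -1] or [i = 0], one
    contains all positive degrees, so every [phi(m)] with [m > 0] kills [v]. *)
Lemma fermion_vacuum i v :
  (forall j, 0 < j -> psi i j v = 0) -> (forall m, m < 0 -> eta i m v = 0) ->
  v = 0 \/ ((i = 0 \/ i = -1) /\ supported is_vacuum v).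
Proof.
move=> v_psi v_eta.
have v_p : forall t : nat, i + 1 < t%:Z -> annihilation_exp G phi t%:Z v = 0.
  apply: annihilation_exp_vanish => t it.
  have := v_psi (t%:Z - 1 - i); rewrite /psi.
  have -> : - (t%:Z - 1 - i) - 1 - i = - t%:Z by lia.
  by apply; lia.
have v_m : forall t : nat, - i < t%:Z -> annihilation_exp G (- phi) t%:Z v = 0.
  apply: annihilation_exp_vanish => t it.
  have := v_eta (- t%:Z - i); rewrite /eta.
  have -> : - t%:Z - i + i = - t%:Z by lia.
  by apply; lia.
have [i_lt|i_ge] := ltP i (-1).
  by left; have := v_p 0%N; rewrite annihilation_exp0; apply; lia.
have [i_gt|i_le] := ltP 0 i.
  by left; have := v_m 0%N; rewrite annihilation_exp0; apply; lia.
have iE : i = 0 \/ i = -1 by lia.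
right; split=> //; apply: supported_phi_vacuum => m.
have sym := phi_gram_sym (C := C).
have aE g : (forall n, 0 < n -> annihilation_exp G g n v = 0) -> amode G g m.+1 v = 0.
  move=> H; have gC (s t : nat) u := amodeC sym g g s t u.
  exact: (exp_int_eq0 gC H).
have m0 : - m.+1%:R^-1 != 0 :> C by rewrite oppr_eq0 invr_eq0 pnatr_eq0.
case: iE => iE; rewrite {}iE in v_p v_m.
  have : amode G (- phi) m.+1 v = 0.
    by apply: aE => -[] // n n0; apply: v_m; rewrite oppr0.
  rewrite /amode => /eqP; rewrite scaler_eq0 (negPf m0) /= => /eqP.
  rewrite -scaleN1r /hmode big_ord1 pairingZl => H.
  rewrite /hmode big_ord1; apply: oppr_inj; rewrite oppr0 -[RHS]H -scaleNr.
  by congr (_ *: _); ring.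
have : amode G phi m.+1 v = 0 by apply: aE => -[] // n n0; apply: v_p; rewrite addNr.
by rewrite /amode => /eqP; rewrite scaler_eq0 (negPf m0) /= => /eqP.
Qed.

Definition energy_term i (m : nat) (v : V) : V :=
  eta (i + 1) m.+1 (psi i m.+1 v) + psi (i - 1) (- m.+1%:Z) (eta i (- m.+1%:Z) v).

(** The normally ordered sum of [m (h_m psi_m + psi_(-m) h_(-m))] over [1 <= m <= M]: the conformal
    weight operator for which [e^phi] has weight 1 and [e^(-phi)] weight 0. *)
Definition energy (M : nat) i (v : V) : V :=
  \sum_(m < M) m.+1%:R *: energy_term i m v.

Lemma energy_term_psi i (m n : nat) v :
  energy_term (i + 1) m (psi i n.+1 v) =
  psi i n.+1 (energy_term i m v) - (n == m)%:R *: psi i n.+1 v.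
Proof.
rewrite /energy_term linearD /= [RHS]addrAC addrK; congr (_ + _).
  rewrite psi_psi linearN /=.
  have := psi_eta (i + 1) n.+1 m.+1 (psi i m.+1 v).
  rewrite addrK => /(canRL (addKr _)) ->.
  rewrite opprD opprK; congr (_ - _); rewrite (_ : (n.+1%:Z == m.+1) = (n == m)) //.
  by case: eqP => [->|]; rewrite ?scale0r.
have := psi_eta i n.+1 (- m.+1%:Z) v.
rewrite (_ : (n.+1%:Z == - m.+1%:Z) = false) // scale0r.
move=> /(canRL (addKr _)) ->; rewrite addr0 linearN /=.
by have := psi_psi (i - 1) (- m.+1%:Z) n.+1 (eta i (- m.+1%:Z) v);
  rewrite subrK => ->; rewrite opprK.
Qed.

Lemma energy_term_eta i (m n : nat) v :
  energy_term (i - 1) m (eta i (- n.+1%:Z) v) =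
  eta i (- n.+1%:Z) (energy_term i m v) - (n == m)%:R *: eta i (- n.+1%:Z) v.
Proof.
rewrite /energy_term linearD /= subrK -[RHS]addrA; congr (_ + _).
  have := psi_eta i m.+1 (- n.+1%:Z) v.
  rewrite (_ : (m.+1%:Z == - n.+1%:Z) = false) // scale0r.
  move=> /eqP; rewrite addr_eq0 => /eqP ->; rewrite linearN /=.
  by have := eta_eta (i + 1) m.+1 (- n.+1%:Z) (psi i m.+1 v);
    rewrite addrK => ->; rewrite opprK.
rewrite eta_eta linearN /=.
have := psi_eta (i - 1) (- m.+1%:Z) (- n.+1%:Z) (eta i (- m.+1%:Z) v).
rewrite subrK => /(canRL (addrK _)) ->.
rewrite opprB eqr_opp; congr (_ - _).
rewrite (_ : (m.+1%:Z == n.+1) = (n == m)); last by rewrite eq_sym.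
by case: eqP => [->|]; rewrite ?scale0r.
Qed.

Lemma sum_energy_delta (M n : nat) v : (n < M)%N ->
  \sum_(m < M) m.+1%:R *: ((n == m)%:R *: v) = n.+1%:R *: v.
Proof.
move=> nM; rewrite (bigD1 (Ordinal nM)) //= eqxx scale1r big1 ?addr0 // => m.
by rewrite -val_eqE eq_sym /= => /negPf ->; rewrite scale0r scaler0.
Qed.

Lemma energy_psi M i (n : nat) v : (n < M)%N ->
  energy M (i + 1) (psi i n.+1 v) = psi i n.+1 (energy M i v) - n.+1%:R *: psi i n.+1 v.
Proof.
move=> nM; rewrite /energy linear_sum -(sum_energy_delta _ nM) -sumrB.
by apply: eq_bigr => m _; rewrite energy_term_psi scalerBr [in RHS]linearZ.
Qed.

Lemma energy_eta M i (n : nat) v : (n < M)%N ->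
  energy M (i - 1) (eta i (- n.+1%:Z) v) =
  eta i (- n.+1%:Z) (energy M i v) - n.+1%:R *: eta i (- n.+1%:Z) v.
Proof.
move=> nM; rewrite /energy linear_sum -(sum_energy_delta _ nM) -sumrB.
by apply: eq_bigr => m _; rewrite energy_term_eta scalerBr [in RHS]linearZ.
Qed.

Lemma energy_weight M i (w : int) v :
  supported (of_weight i w) v -> supported (of_weight i w) (energy M i v).
Proof.
move=> vw; apply: supported_sum => m _; apply: supportedZ; apply: supportedD.
  by have := eta_weight m.+1 (psi_weight m.+1 vw); rewrite addrK subrK.
by have := psi_weight (- m.+1%:Z) (eta_weight (- m.+1%:Z) vw); rewrite subrK opprK subrK.
Qed.

(** Induction on the weight. Lowering modes commute with the energy up to their degree, so by
    induction they kill [y], the difference of the two sides. Then [y] is zero or a vacuum of charge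
    0 or -1, which has weight 0; and in weight 0 every term of the energy vanishes. *)
Lemma energyE M i (w : nat) v : (w <= M)%N ->
  supported (of_weight i w%:Z) v -> energy M i v = w%:R *: v.
Proof.
elim/ltn_ind: w i v => w IHw i v wM vw; apply/eqP; rewrite -subr_eq0; apply/eqP.
have low_psi (n : nat) : (w < n.+1)%N -> forall u : V,
    supported (of_weight i w%:Z) u -> psi i n.+1 u = 0.
  move=> wn u uw; apply: (supported_none _ (psi_weight n.+1 uw)) => b.
  by move/of_weight_ge0; lia.
have low_eta (n : nat) : (w < n.+1)%N -> forall u : V,
    supported (of_weight i w%:Z) u -> eta i (- n.+1%:Z) u = 0.
  move=> wn u uw; apply: (supported_none _ (eta_weight (- n.+1%:Z) uw)) => b.
  by move/of_weight_ge0; lia.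
set y := _ - _; have yw : supported (of_weight i w%:Z) y.
  by apply: supportedB; [exact: energy_weight | exact: supportedZ].
have y_psi j : 0 < j -> psi i j y = 0.
  case: j => // -[|n] // _; have [wn|nw] := ltnP w n.+1; first exact: low_psi.
  rewrite /y linearB linearZ /=.
  have := energy_psi i v (_ : (n < M)%N); rewrite (IHw (w - n.+1)%N); try by lia.
    move=> /(_ (leq_trans nw wM)) /eqP; rewrite eq_sym subr_eq => /eqP ->.
    by rewrite -scalerDl -natrD subnK // subrr.
  by have := psi_weight n.+1 vw; rewrite subzn.
have y_eta m : m < 0 -> eta i m y = 0.
  case: m => // n _; rewrite NegzE; have [wn|nw] := ltnP w n.+1; first exact: low_eta.
  rewrite /y linearB linearZ /=.
  have := energy_eta i v (_ : (n < M)%N); rewrite (IHw (w - n.+1)%N); try by lia.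
    move=> /(_ (leq_trans nw wM)) /eqP; rewrite eq_sym subr_eq => /eqP ->.
    by rewrite -scalerDl -natrD subnK // subrr.
  by have := eta_weight (- n.+1%:Z) vw; rewrite subzn.
have [//|[iE yvac]] := fermion_vacuum y_psi y_eta.
have [w0|wpos] := posnP w; last first.
  apply: (supported_none _ (supportedI yvac yw)) => b [b0].
  rewrite /of_weight /wt b0 /weight letter_deg0.
  by case: iE => ->; rewrite ?mul0r ?addNr ?mulr0; lia.
rewrite /y w0 scale0r subr0; apply: big1 => m _.
have lt : (w < m.+1)%N by rewrite w0.
by rewrite /energy_term (low_psi m lt v vw) (low_eta m lt v vw) !linear0 addr0 scaler0.
Qed.

End Energy.

(** * The filtration on the c, d side *)

Section CDSide.
Context {C : numFieldType}.
Local Notation V := (free_module C (fock_basis C 2)).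
Local Notation G := (cd_gram C).
Local Notation c := (cv C).
Local Notation d := (dv C).
Local Notation P := (creation_exp G c).
Local Notation Q := (annihilation_exp G c).
Local Notation X := (vertex G c).
Implicit Types (u : V) (a b : fock_basis C 2) (i j k n p : int).

Lemma cd_gram_sym : G^T = G.
Proof. by apply/matrixP => i j; rewrite !mxE eq_sym. Qed.

Lemma pairing_delta (i j : 'I_2) :
  pairing G (delta_mx 0 i) (delta_mx 0 j) = if i == j then 0 else 2.
Proof.
rewrite /pairing mxE (bigD1 j) //= big1 => [|k neq]; last first.
  by rewrite !mxE eqxx (negPf neq) mulr0.
rewrite !mxE !eqxx mulr1 addr0 (bigD1 i) //= big1 => [|k neq]; last first.
  by rewrite !mxE eqxx (negPf neq) mul0r.
by rewrite !mxE !eqxx mul1r addr0.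
Qed.

Lemma pairing_cc : pairing G c c = 0. Proof. by rewrite pairing_delta. Qed.
Lemma pairing_cd : pairing G c d = 2. Proof. by rewrite pairing_delta. Qed.
Lemma pairing_dc : pairing G d c = 2. Proof. by rewrite pairing_delta. Qed.

Definition cd_deg (a : 'I_2 * nat) : int := if a.1 == 0 then 1 else -1.
Definition cd_excess b : int := letter_deg cd_deg b.1.

(** Since [<c, c> = 0], an annihilation mode of [c] removes a letter [d], and a creation mode adds a
    letter [c]: both raise the excess by one. *)
Lemma changes_cd_c n : changes_deg G cd_deg c n 1.
Proof.
case: n => [[|m]|m] //= j; rewrite /cd_deg ?mxE.
  by rewrite pairing_delta; case: (eqVneq 0 j); rewrite ?eqxx.
by case: (j == 0); rewrite ?andbF ?eqxx.
Qed.

Lemma changes_cd_d n : changes_deg G cd_deg d n (-1).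
Proof.
have j01 (j : 'I_2) : j != 1 -> j == 0 by case: j => -[|[]].
case: n => [[|m]|m] //= j; rewrite /cd_deg ?mxE.
  by rewrite pairing_delta; case: (eqVneq 1 j) => [_|]; rewrite ?eqxx // eq_sym => /j01 ->.
by case: (eqVneq j 1) => [->|]; rewrite ?andbF ?eqxx.
Qed.

Lemma cd_excess_le_wt b : cd_excess b <= wt b.
Proof.
apply: letter_deg_le => -[j m]; rewrite /cd_deg /weight_deg /=.
by case: ifP => _; lia.
Qed.

Definition excess_ge p b : Prop := p <= cd_excess b.

Lemma hmode_c_excess n p u : supported (excess_ge p) u ->
  supported (excess_ge (p + 1)) (hmode G c n u).
Proof.
apply: supported_linear => b bp.
apply: (supportedW _ (supported_hmode b (changes_cd_c n))) => b' [_].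
by rewrite /excess_ge /cd_excess in bp * => ->; lia.
Qed.

Lemma hmode_d_excess n p u : supported (excess_ge (p + 1)) u ->
  supported (excess_ge p) (hmode G d n u).
Proof.
apply: supported_linear => b bp.
apply: (supportedW _ (supported_hmode b (changes_cd_d n))) => b' [_].
by rewrite /excess_ge /cd_excess in bp * => ->; lia.
Qed.

(** Each letter of a composition raises the excess by one, and only degree 0 admits the empty
    composition. So a coefficient of nonzero degree gains at least 1, and at least 2 once its linear
    part is removed. *)
Lemma excess_exp (a : nat -> {linear V -> V}) :
  (forall m p u, supported (excess_ge p) u -> supported (excess_ge (p + 1)) (a m u)) ->
  forall n p u, supported (excess_ge p) u ->
    supported (excess_ge (p + (n != 0)%:Z)) (exp_int a n u) /\
    (0 < n -> supported (excess_ge (p + 2)) (exp_int a n u - a (absz n) u)).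
Proof.
move=> a1; pose T (s n : nat) b b' := cd_excess b + s%:Z <= cd_excess b' /\ (s = 0%N -> n = 0%N).
have T0 b : T 0%N 0%N b b by split=> //; rewrite addr0.
have Ta (s n i : nat) b b' : T s n b b' ->
    supported (T s.+1 (i.+1 + n)%N b) (a i.+1 (bvec C b')).
  move=> [sb _]; have := a1 i.+1 (cd_excess b') (bvec C b').
  move=> /(_ (supportedU (lexx _ : excess_ge (cd_excess b') b'))).
  by apply: supportedW => b''; rewrite /excess_ge => ?; split=> //; lia.
move=> n p u up; split.
  apply: supported_linear up => b bp.
  apply: (supportedW _ (supported_exp_int T0 Ta n b)) => b' [s [m [nm [sb s0]]]].
  rewrite /excess_ge in bp *; case: eqP => n0; rewrite /=; first by lia.
  by case: s sb s0 => [|s] sb s0; [case: n0; rewrite nm s0 | lia].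
case: n => // -[|n] // _.
apply: (supported_linear (f := exp_int a n.+1 \- a n.+1)) up => b bp.
apply: (supportedW _ (supported_exp_int_leading T0 Ta n b)) => b' [s s2 [sb _]].
by rewrite /excess_ge in bp *; lia.
Qed.

Lemma creation_excess n p u : supported (excess_ge p) u ->
  supported (excess_ge (p + (n != 0)%:Z)) (P n u) /\
  (0 < n -> supported (excess_ge (p + 2)) (P n u - cmode G c (absz n) u)).
Proof.
by apply: excess_exp => m q w wq; apply: supportedZ; exact: hmode_c_excess.
Qed.

Lemma annihilation_excess n p u : supported (excess_ge p) u ->
  supported (excess_ge (p + (n != 0)%:Z)) (Q n u) /\
  (0 < n -> supported (excess_ge (p + 2)) (Q n u - amode G c (absz n) u)).
Proof.
by apply: excess_exp => m q w wq; apply: supportedZ; exact: hmode_c_excess.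
Qed.

Lemma term_excess n n' p u : supported (excess_ge p) u ->
  supported (excess_ge (p + (n != 0)%:Z + (n' != 0)%:Z)) (P n (Q n' u)).
Proof.
move=> up; have [H _] := annihilation_excess n' up.
by have [H' _] := creation_excess n H; rewrite addrAC.
Qed.

Lemma excess_geW p q u : q <= p -> supported (excess_ge p) u -> supported (excess_ge q) u.
Proof. by move=> qp; apply: supportedW => b; apply: le_trans. Qed.

(** The range contains the index [|n|], so the corresponding leading term can be split off. *)
Lemma vertex_split n u : exists N : nat,
  [/\ (absz n < N)%N & forall k, X k u = \sum_(t < N) P (k + t%:Z) (Q t%:Z u)].
Proof.
have [N uN] := vertex_bound u; exists (N + (absz n).+1)%N; split; first by lia.
by move=> k; apply: vertexE; apply: supportedW uN => b; lia.
Qed.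

Lemma vertex0_excess p u : supported (excess_ge p) u ->
  supported (excess_ge (p + 1)) (X 0 u - u).
Proof.
move=> up; have [N [N0 XE]] := vertex_split 0 u.
rewrite XE; case: N N0 {XE} => // N _.
rewrite big_ord_recl addr0 creation_exp0 annihilation_exp0.
rewrite [Y in supported _ Y]addrC addKr.
apply: supported_sum => t _; apply: excess_geW (term_excess _ _ up).
by rewrite /= /bump /=; lia.
Qed.

Lemma vertex_excess n p u : n != 0 -> supported (excess_ge p) u ->
  supported (excess_ge (p + 1)) (X n u).
Proof.
move=> n0 up; have [N [_ ->]] := vertex_split 0 u.
apply: supported_sum => t _; apply: excess_geW (term_excess _ _ up).
by case: eqP; case: eqP => /=; lia.
Qed.

(** The leading term is [c(-m-1) / (m+1)], and in the opposite degree [- c(m+1) / (m+1)]. An error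
    of order 2 is required because a mode of [d], applied afterwards, lowers the excess by one. *)
Lemma vertex_pos_excess (m : nat) p u : supported (excess_ge p) u ->
  supported (excess_ge (p + 2)) (X m.+1 u - cmode G c m.+1 u).
Proof.
move=> up; have [N [N0 XE]] := vertex_split 0 u.
rewrite XE; case: N N0 {XE} => // N _.
rewrite big_ord_recl addr0 annihilation_exp0 [Y in supported _ Y]addrAC.
apply: supportedD; first by have [_] := creation_excess m.+1 up; apply.
apply: supported_sum => t _; apply: excess_geW (term_excess _ _ up).
by rewrite /= /bump /=; lia.
Qed.

Lemma vertex_neg_excess (m : nat) p u : supported (excess_ge p) u ->
  supported (excess_ge (p + 2)) (X (- m.+1%:Z) u - amode G c m.+1 u).
Proof.
move=> up; have [N [mN ->]] := vertex_split m.+1 u.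
rewrite (bigD1 (Ordinal mN)) //= addNr creation_exp0 [Y in supported _ Y]addrAC.
apply: supportedD; first by have [_] := annihilation_excess m.+1 up; apply.
apply: supported_sum => t; rewrite -val_eqE /= => tm.
have [lt|le] := ltnP t m.+1; first by rewrite creation_exp_lt0; [exact: supported0 | lia].
apply: excess_geW (term_excess _ _ up).
by case: eqP; case: eqP => /=; lia.
Qed.

(** The Heisenberg weight operator for the hyperbolic pair [c], [d]; the factor [2^-1] is the
    inverse of [<c, d>]. *)
Definition boson_energy (M : nat) u : V :=
  \sum_(m < M) 2^-1 *: (hmode G c (- m.+1%:Z) (hmode G d m.+1 u) +
                        hmode G d (- m.+1%:Z) (hmode G c m.+1 u)).

Lemma creator_annihilator (x : 'I_2 * nat) b :
  creator x (annihilator x (bvec C b)) = (b.1 x)%:R *: bvec C b.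
Proof.
rewrite annihilatorE linearZ /= creatorE /=.
have [->|bx] := posnP (b.1 x); first by rewrite !scale0r.
by rewrite mset_remK // -surjective_pairing.
Qed.

Lemma weight_sum (M : nat) (s : {mset ('I_2 * nat)}%mset) : weight s <= M%:Z ->
  (weight s)%:~R =
  \sum_(m < M) m.+1%:R * ((s (0, m : nat))%:R + (s (1, m : nat))%:R) :> C.
Proof.
elim/(@mset_ind 2): s => [_|[j m] s IHs].
  rewrite /weight letter_deg0 big1 // => m _.
  by rewrite !mset0E addr0 mulr0.
rewrite /weight letter_deg_add -/(weight s) => sM.
have s0 := weight_ge0 s; have mM : (m < M)%N by move: sM; rewrite /weight_deg /=; lia.
rewrite intrD IHs; last by move: sM; rewrite /weight_deg /=; lia.
under [RHS]eq_bigr do rewrite !mset_addE !natrD addrACA mulrDr.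
rewrite big_split; congr (_ + _); rewrite (bigD1 (Ordinal mM)) //= big1 => [|k].
  rewrite addr0 !xpair_eqE eqxx !andbT /weight_deg /= -pmulrn.
  by case: j {sM} => -[|[|//]] p; rewrite -!val_eqE /= ?addr0 ?add0r mulr1.
by rewrite -val_eqE /= => /negPf km; rewrite !xpair_eqE km !andbF addr0 mulr0.
Qed.

Lemma boson_energyE (M : nat) b : wt b <= M%:Z ->
  boson_energy M (bvec C b) = (wt b)%:~R *: bvec C b.
Proof.
move=> bM; rewrite /wt (weight_sum bM) scaler_suml; apply: eq_bigr => m _.
have two : 2 != 0 :> C by rewrite pnatr_eq0.
rewrite /hmode /= !big_ord_recl !big_ord0 !pairing_delta !mxE /=.
rewrite !(mulr0, scale0r, scale1r, add0r, addr0) !linearZ /=.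
rewrite (_ : lift ord0 ord0 = 1); last exact: val_inj.
rewrite !creator_annihilator -scalerDr !scalerA -scalerDl scalerA; congr (_ *: _).
by field.
Qed.

(** As [<c, c> = 0], [X j] commutes with all nonzero modes of [c], of which [X i] is composed. *)
Lemma vertex_vertexC i j u : X i (X j u) = X j (X i u).
Proof.
have [N uN] := vertex_bound u; have [N' uN'] := vertex_bound (X j u).
pose M := (N + N')%N.
have uM : supported (fun b => wt b < M%:Z) u by apply: supportedW uN => b; rewrite /M; lia.
have uM' : supported (fun b => wt b < M%:Z) (X j u).
  by apply: supportedW uN' => b; rewrite /M; lia.
have XC n w : n != 0 -> X j (hmode G c n w) = hmode G c n (X j w).
  by move=> n0; rewrite (hmode_vertex cd_gram_sym) // pairing_cc scale0r addr0.
have XcC m w : X j (cmode G c m w) = cmode G c m (X j w).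
  case: m => [|m]; first by rewrite !cmode0 linear0.
  by rewrite /cmode linearZ /= XC.
have XaC m w : X j (amode G c m w) = amode G c m (X j w).
  case: m => [|m]; first by rewrite !amode0 linear0.
  by rewrite /amode linearZ /= XC.
rewrite (vertexE G c i uM') (vertexE G c i uM) linear_sum.
apply: eq_bigr => t _ /=.
by rewrite [RHS](exp_int_commute (f := X j)) // [in RHS](exp_int_commute (f := X j)).
Qed.

End CDSide.

(** * The tensor product complex and its homotopies *)

Section Tensor.
Context {C : fieldType} {A B : choiceType}.
Local Notation VA := (free_module C A).
Local Notation VB := (free_module C B).
Local Notation VAB := (free_module C (A * B)%type).
Implicit Types (x : VA) (y : VB) (z : VAB) (a : A) (b : B).

Definition tensr x y : VAB := ext (fun a => ext (fun b => bvec C (a, b)) y) x.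

Lemma tensr_linl y : linear (tensr^~ y).
Proof. by move=> c x x'; rewrite /tensr linearP. Qed.

Definition tensl y : VA -> VAB := tensr^~ y.
HB.instance Definition _ y := GRing.isLinear.Build C VA VAB *:%R (tensl y) (tensr_linl y).

Lemma tensr_linr x : linear (tensr x).
Proof.
move=> c y y'; apply: (eq_linear (f := tensl (c *: y + y'))
  (g := (c \*: tensl y) \+ tensl y')) => a /=.
by rewrite /tensl /tensr !extE linearP.
Qed.
HB.instance Definition _ x := GRing.isLinear.Build C VB VAB *:%R (tensr x) (tensr_linr x).

Lemma tensrDl x x' y : tensr (x + x') y = tensr x y + tensr x' y.
Proof. exact: (linearD (tensl y)). Qed.
Lemma tensrBl x x' y : tensr (x - x') y = tensr x y - tensr x' y.
Proof. exact: (linearB (tensl y)). Qed.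
Lemma tensrZl e x y : tensr (e *: x) y = e *: tensr x y.
Proof. exact: (linearZ_LR (tensl y)). Qed.
Lemma tensr0l y : tensr 0 y = 0.
Proof. exact: (linear0 (tensl y)). Qed.
Lemma tensr_suml (I : Type) (r : seq I) (F : I -> VA) y :
  tensr (\sum_(i <- r) F i) y = \sum_(i <- r) tensr (F i) y.
Proof. exact: (linear_sum (tensl y)). Qed.
Lemma tensrDr x y y' : tensr x (y + y') = tensr x y + tensr x y'.
Proof. exact: linearD. Qed.
Lemma tensrBr x y y' : tensr x (y - y') = tensr x y - tensr x y'.
Proof. exact: linearB. Qed.
Lemma tensrNr x y : tensr x (- y) = - tensr x y.
Proof. exact: linearN. Qed.
Lemma tensrZr e x y : tensr x (e *: y) = e *: tensr x y.
Proof. exact: linearZ_LR. Qed.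
Lemma tensr0r x : tensr x 0 = 0.
Proof. exact: linear0. Qed.

Lemma tensr_bvec a b : tensr (bvec C a) (bvec C b) = bvec C (a, b).
Proof. by rewrite /tensr !extE. Qed.

Lemma supported_tensr (P : A -> Prop) (Q : B -> Prop) x y :
  supported P x -> supported Q y ->
  supported (fun ab : A * B => P ab.1 /\ Q ab.2) (tensr x y).
Proof.
move=> xP yQ; apply: (supported_linear (f := tensl y)) xP => a Pa.
apply: (supported_linear (f := tensr (bvec C a))) yQ => b Qb.
by rewrite /= tensr_bvec; apply: supportedU.
Qed.

Definition opL (f : VA -> VA) : VAB -> VAB :=
  ext (fun ab : A * B => tensr (f (bvec C ab.1)) (bvec C ab.2)).
HB.instance Definition _ f := GRing.Linear.on (opL f).

Definition opR (g : VB -> VB) : VAB -> VAB :=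
  ext (fun ab : A * B => tensr (bvec C ab.1) (g (bvec C ab.2))).
HB.instance Definition _ g := GRing.Linear.on (opR g).

Lemma opL_tensr (f : {linear VA -> VA}) x y : opL f (tensr x y) = tensr (f x) y.
Proof.
apply: (eq_linear (f := opL f \o tensl y) (g := tensl y \o f)) => a /=.
apply: (eq_linear (f := opL f \o tensr (bvec C a)) (g := tensr (f (bvec C a)))) => b.
by rewrite /= tensr_bvec /opL extE.
Qed.

Lemma opR_tensr (g : {linear VB -> VB}) x y : opR g (tensr x y) = tensr x (g y).
Proof.
apply: (eq_linear (f := opR g \o tensl y) (g := tensl (g y))) => a /=.
apply: (eq_linear (f := opR g \o tensr (bvec C a)) (g := tensr (bvec C a) \o g)) => b.
by rewrite /= tensr_bvec /opR extE.
Qed.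

Lemma eq_tensr (W : lmodType C) (f g : {linear VAB -> W}) :
  (forall x y, f (tensr x y) = g (tensr x y)) -> f =1 g.
Proof. by move=> fg; apply: eq_linear => -[a b]; rewrite -tensr_bvec. Qed.

End Tensor.

Section Window.
Definition window (J : nat) : seq int := [seq n%:Z - J%:Z | n <- iota 0 J.*2.+1].

Lemma window_uniq J : uniq (window J).
Proof. by rewrite map_inj_uniq ?iota_uniq // => n n' /addIr[]. Qed.

Lemma mem_window J (j : int) : (j \in window J) = (- J%:Z <= j <= J%:Z).
Proof.
apply/mapP/idP => [[n]|jJ]; first by rewrite mem_iota => nJ ->; lia.
by exists (absz (j + J%:Z)%R); rewrite ?mem_iota; lia.
Qed.

Lemma sum_window_delta (W : nmodType) J (m : int) (F : int -> W) : m \in window J ->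
  \sum_(j <- window J) (if j == m then F j else 0) = F m.
Proof.
move=> mJ; rewrite (bigD1_seq m) ?window_uniq //= eqxx big1 ?addr0 // => j.
by move=> /negPf ->.
Qed.

End Window.

Section Complex.
Context {C : numFieldType}.
Local Notation VA := (free_module C (fock_basis C 2)).
Local Notation VB := (free_module C (fock_basis C 1)).
Local Notation VAB := (free_module C (fock_basis C 2 * fock_basis C 1)%type).
Local Notation G := (cd_gram C).
Local Notation c := (cv C).
Local Notation d := (dv C).
Local Notation phi := (phi C).
Local Notation X := (vertex G c).
Implicit Types (u : VA) (v : VB) (z : VAB) (i j k m n p r : int).

(* The coefficient of z^j in Y(e^c, z) + 1, on weights beta with <c, beta> = r. *)
Definition dmode r j u : VA := shift c (X (j - r) u) + (j == 0)%:R *: u.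
HB.instance Definition _ r j := GRing.Linear.copy (dmode r j)
  ((shift c \o X (j - r)) \+ ((j == 0)%:R \*: idfun)).

(* The modes e^phi_(j) and e^(-phi)_(- m - 1), on charge i. *)
Definition fpsi i j v : VB := shift phi (psi i j v).
HB.instance Definition _ i j := GRing.Linear.copy (fpsi i j) (shift phi \o psi i j).

Definition feta i m v : VB := shift (- phi) (eta i m v).
HB.instance Definition _ i m := GRing.Linear.copy (feta i m) (shift (- phi) \o eta i m).

Lemma fpsi_fpsi i j k v : fpsi (i + 1) j (fpsi i k v) = - fpsi (i + 1) k (fpsi i j v).
Proof.
by rewrite /fpsi /psi -!shift_vertex -!/(psi _ _ _) psi_psi !linearN.
Qed.

Lemma fpsi_feta i j m v :
  fpsi (i - 1) j (feta i m v) + feta (i + 1) m (fpsi i j v) = (j == m)%:R *: v.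
Proof.
rewrite /fpsi /feta /psi /eta -!shift_vertex !shiftD subrr addNr !shift0.
exact: psi_eta.
Qed.

Lemma dmodeC r j k u : dmode r j (dmode r k u) = dmode r k (dmode r j u).
Proof.
rewrite /dmode !linearD !linearZ /= !shift_vertex vertex_vertexC.
by apply/fcoefP => w; rewrite !(fcoefD, fcoefZ); ring.
Qed.

Lemma dmode_shift r j nu u : dmode r j (shift nu u) = shift nu (dmode r j u).
Proof.
rewrite /dmode [in RHS]linearD [in RHS]linearZ /= -shift_vertex !shiftD.
by rewrite [nu + c]addrC.
Qed.

Lemma dmode_d r j n u : n != 0 ->
  dmode r j (hmode G d n u) =
  hmode G d n (dmode r j u) - 2 *: shift c (X (j - r - n) u).
Proof.
move=> n0; rewrite /dmode linearD linearZ /= -shift_hmode.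
rewrite (hmode_vertex cd_gram_sym) // pairing_dc linearD linearZ /=.
by rewrite addrAC addrK.
Qed.

(** The differential truncated to modes in [[-J, J]]. Since the Clifford relations hold mode by
    mode, its square is zero for every [J] and the homotopy formulas need only a window containing
    the chosen mode; a large [J] matters only for agreement with the actual differential. *)
Definition dwin r i (J : nat) z : VAB :=
  \sum_(j <- window J) opL (dmode r j) (opR (fpsi i j) z).

Fact dwin_linear r i J : linear (dwin r i J).
Proof.
move=> e z z'; rewrite /dwin scaler_sumr -big_split; apply: eq_bigr => j _ /=.
by rewrite !linearP.
Qed.
HB.instance Definition _ r i J :=
  GRing.isLinear.Build C VAB VAB *:%R (dwin r i J) (dwin_linear r i J).

Lemma dwin_tensr r i J u v :
  dwin r i J (tensr u v) = \sum_(j <- window J) tensr (dmode r j u) (fpsi i j v).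
Proof. by apply: eq_bigr => j _; rewrite opR_tensr opL_tensr. Qed.

Lemma dwin_dwin r i J z : dwin r (i + 1) J (dwin r i J z) = 0.
Proof.
apply: (eq_tensr (f := dwin r (i + 1) J \o dwin r i J) (g := \0)) => u v /=.
rewrite dwin_tensr linear_sum /=; under eq_bigr do rewrite dwin_tensr.
(* The bosonic modes commute and the fermionic ones anticommute, so exchanging the two summations
   changes the sign. *)
set S := LHS; have S2 : S = - S.
  rewrite {1}/S exchange_big /S -sumrN; apply: eq_bigr => j _.
  by rewrite -sumrN; apply: eq_bigr => k _; rewrite dmodeC fpsi_fpsi tensrNr.
have : 2%:R *: S = 0 by rewrite scaler_nat mulr2n {2}S2 subrr.
by move/eqP; rewrite scaler_eq0 pnatr_eq0 /= => /eqP.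
Qed.

(** The Clifford relation collapses the anticommutator with [B (x) h_m] to the mode [j = m], apart
    from the error caused by the commutators [K j] of the bosonic modes with [B]. *)
Lemma homotopy_tensr r i (J : nat) m (B : {linear VA -> VA}) (K : int -> VA -> VA) u v :
  m \in window J ->
  (forall j, dmode r j (B u) = B (dmode r j u) + K j u) ->
  dwin r (i - 1) J (tensr (B u) (feta i m v)) +
  opL B (opR (feta (i + 1) m) (dwin r i J (tensr u v))) =
  tensr (B (dmode r m u)) v +
  \sum_(j <- window J) tensr (K j u) (fpsi (i - 1) j (feta i m v)).
Proof.
move=> mJ BK; rewrite !dwin_tensr !linear_sum -big_split /=.
rewrite -(sum_window_delta (fun j => tensr (B (dmode r j u)) v) mJ) -big_split /=.
apply: eq_bigr => j _; rewrite opR_tensr opL_tensr BK tensrDl addrAC; congr (_ + _).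
rewrite -tensrDr fpsi_feta tensrZr.
by case: eqP => _; rewrite ?scale1r ?scale0r.
Qed.

End Complex.

(** * The homotopy for [r = 0] and its leading part *)

Section Homotopy.
Context {C : numFieldType}.
Local Notation VA := (free_module C (fock_basis C 2)).
Local Notation VB := (free_module C (fock_basis C 1)).
Local Notation AB := (fock_basis C 2 * fock_basis C 1)%type.
Local Notation VAB := (free_module C AB).
Local Notation G := (cd_gram C).
Local Notation c := (cv C).
Local Notation d := (dv C).
Local Notation phi := (phi C).
Local Notation X := (vertex G c).
Implicit Types (u : VA) (v : VB) (z : VAB) (i j k n p r : int).

Definition excessAB p (ab : AB) : Prop := excess_ge p ab.1.

Lemma excess_tensr p u v : supported (excess_ge p) u -> supported (excessAB p) (tensr u v).
Proof.
move=> up; have vT : supported (fun _ => True) v by split.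
by apply: supportedW (supported_tensr up vT) => ab [].
Qed.

(** The shift cancels the one in [e^c]. The summand 1 of the field sits in mode 0 and commutes with
    this operator, so for [k != 0] it leaves no trace in the anticommutator. *)
Definition dshift k u : VA := shift (- c) (hmode G d k u).
HB.instance Definition _ k :=
  GRing.Linear.copy (dshift k) (shift (- c) \o hmode G d k).

Lemma dmode_dshift j k u : k != 0 ->
  dmode 0 j (dshift k u) = dshift k (dmode 0 j u) - 2 *: X (j - k) u.
Proof.
move=> k0; rewrite /dshift dmode_shift dmode_d // linearB linearZ /= shiftD subrr.
by rewrite shift0 subr0.
Qed.

Lemma dshift_dmode k u : k != 0 -> dshift k (dmode 0 k u) = hmode G d k (X k u).
Proof.
move=> k0; rewrite /dmode (negPf k0) scale0r addr0 subr0 /dshift -shift_hmode.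
by rewrite shiftD subrr shift0.
Qed.

Definition hterm i k z : VAB := opL (dshift k) (opR (feta i k) z).
HB.instance Definition _ i k :=
  GRing.Linear.copy (hterm i k) (opL (dshift k) \o opR (feta i k)).

Definition sterm i J k z : VAB :=
  dwin 0 (i - 1) J (hterm i k z) + hterm (i + 1) k (dwin 0 i J z).

Lemma sterm_tensr i (J : nat) k u v : k \in window J -> k != 0 ->
  sterm i J k (tensr u v) =
  tensr (hmode G d k (X k u)) v -
  2 *: \sum_(j <- window J) tensr (X (j - k) u) (fpsi (i - 1) j (feta i k v)).
Proof.
move=> kJ k0; rewrite /sterm /hterm opR_tensr opL_tensr.
rewrite (homotopy_tensr i v (B := dshift k)
  (K := fun j u => - (2 *: X (j - k) u)) kJ) => [|j]; last exact: dmode_dshift.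
rewrite /= dshift_dmode //; congr (_ + _); rewrite scaler_sumr -sumrN.
by apply: eq_bigr => j _; rewrite -scaleNr tensrZl scaleNr.
Qed.

(** At leading order [X 0] is the identity and every other [X n] vanishes, which selects [j = k]. *)
Lemma sum_leading p i (J : nat) k u v : k \in window J -> supported (excess_ge p) u ->
  supported (excessAB (p + 1))
    (\sum_(j <- window J) tensr (X (j - k) u) (fpsi (i - 1) j (feta i k v)) -
     tensr u (fpsi (i - 1) k (feta i k v))).
Proof.
move=> kJ up; pose F j := tensr u (fpsi (i - 1) j (feta i k v)).
rewrite -[tensr u _]/(F k) -(sum_window_delta F kJ) -sumrB; apply: supported_sum => j _.
case: eqP => [->|/eqP jk].
  by rewrite subrr -tensrBl; apply: excess_tensr; exact: vertex0_excess.
rewrite subr0; apply: excess_tensr; apply: vertex_excess => //.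
by rewrite subr_eq0.
Qed.

(** In the coefficient [k / 2] of the mode [k], the factor [k] undoes the denominator in the linear
    part of the exponential and the [1 / 2] is the inverse of [<c, d>]; the sign for [k < 0] matches
    that of the annihilation exponential. *)
Definition hop i (M : nat) z : VAB :=
  \sum_(m < M) (m.+1%:R / 2) *: (hterm i m.+1 z - hterm i (- m.+1%:Z) z).

Fact hop_linear i M : linear (hop i M).
Proof.
move=> e z z'; rewrite /hop scaler_sumr -big_split; apply: eq_bigr => m _ /=.
by apply/fcoefP => w; rewrite !linearP /= !(fcoefD, fcoefZ, fcoefN); ring.
Qed.
HB.instance Definition _ i M :=
  GRing.isLinear.Build C VAB VAB *:%R (hop i M) (hop_linear i M).

Definition sop i M J z : VAB :=
  dwin 0 (i - 1) J (hop i M z) + hop (i + 1) M (dwin 0 i J z).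
HB.instance Definition _ i M J := GRing.Linear.copy (sop i M J)
  ((dwin 0 (i - 1) J \o hop i M) \+ (hop (i + 1) M \o dwin 0 i J)).

Lemma sopE i M J z :
  sop i M J z = \sum_(m < M) (m.+1%:R / 2) *: (sterm i J m.+1 z - sterm i J (- m.+1%:Z) z).
Proof.
rewrite /sop /hop linear_sum -big_split; apply: eq_bigr => m _ /=.
rewrite linearZ linearB /= -scalerDr; congr (_ *: _); rewrite /sterm.
by rewrite opprD addrACA.
Qed.

Lemma sop_leading p i (M J : nat) u v : (M <= J)%N -> supported (excess_ge p) u ->
  supported (excessAB (p + 1))
    (sop i M J (tensr u v) - (tensr (boson_energy M u) v + tensr u (energy M i v))).
Proof.
move=> MJ up; rewrite sopE /boson_energy /energy tensr_suml linear_sum -big_split.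
rewrite -sumrB; apply: supported_sum => m _ /=.
have mJ : m.+1%:Z \in window J by rewrite mem_window; have := ltn_ord m; lia.
have mJ' : - m.+1%:Z \in window J by rewrite mem_window; have := ltn_ord m; lia.
have m0 : m.+1%:R != 0 :> C by rewrite pnatr_eq0.
have two0 : 2 != 0 :> C by rewrite pnatr_eq0.
rewrite !sterm_tensr //.
set S1 := \sum_(j <- window J) _; set S2 := \sum_(j <- window J) _.
pose Y1 := hmode G d m.+1 (X m.+1 u - cmode G c m.+1 u).
pose Y2 := hmode G d (- m.+1%:Z) (X (- m.+1%:Z) u - amode G c m.+1 u).
pose T1 := S1 - tensr u (fpsi (i - 1) m.+1 (feta i m.+1 v)).
pose T2 := S2 - tensr u (fpsi (i - 1) (- m.+1%:Z) (feta i (- m.+1%:Z) v)).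
have Y1p : supported (excessAB (p + 1)) (tensr Y1 v).
  apply: excess_tensr; apply: hmode_d_excess; rewrite -addrA.
  exact: vertex_pos_excess.
have Y2p : supported (excessAB (p + 1)) (tensr Y2 v).
  apply: excess_tensr; apply: hmode_d_excess; rewrite -addrA.
  exact: vertex_neg_excess.
have T1p : supported (excessAB (p + 1)) T1 by exact: sum_leading.
have T2p : supported (excessAB (p + 1)) T2 by exact: sum_leading.
(* Moving [d(m+1)] to the right of [c(-m-1)] creates the scalar [2 (m+1)]; in [w1], rewriting
   [psi h] as [1 - h psi] creates another. The two cancel in [Z], so no zero-point energy remains
   and only the four error terms survive. *)
have XE1 : tensr (hmode G d m.+1 (X m.+1 u)) v =
    tensr Y1 v + m.+1%:R^-1 *: (tensr (hmode G c (- m.+1%:Z) (hmode G d m.+1 u)) v +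
      (m.+1%:R * 2) *: tensr u v).
  rewrite /Y1 linearB tensrBl /= /cmode linearZ /= (hmode_comm cd_gram_sym) //.
  by rewrite subrr eqxx pairing_dc tensrZl tensrDl tensrZl subrK.
have XE2 : tensr (hmode G d (- m.+1%:Z) (X (- m.+1%:Z) u)) v =
    tensr Y2 v - m.+1%:R^-1 *: tensr (hmode G d (- m.+1%:Z) (hmode G c m.+1 u)) v.
  by rewrite /Y2 linearB tensrBl /= /amode linearZ /= tensrZl scaleNr subrK.
have w1 : fpsi (i - 1) m.+1 (feta i m.+1 v) = v - eta (i + 1) m.+1 (psi i m.+1 v).
  have := fpsi_feta i m.+1 m.+1 v; rewrite eqxx scale1r => /(canRL (addrK _)) ->.
  by congr (_ - _); rewrite /feta /fpsi /eta -shift_vertex shiftD subrr shift0.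
have w2 : fpsi (i - 1) (- m.+1%:Z) (feta i (- m.+1%:Z) v) =
    psi (i - 1) (- m.+1%:Z) (eta i (- m.+1%:Z) v).
  by rewrite /feta /fpsi /psi -shift_vertex shiftD addNr shift0.
have -> : S1 = T1 + tensr u v - tensr u (eta (i + 1) m.+1 (psi i m.+1 v)).
  by rewrite /T1 w1 tensrBr opprB addrA subrK addrK.
have -> : S2 = T2 + tensr u (psi (i - 1) (- m.+1%:Z) (eta i (- m.+1%:Z) v)).
  by rewrite /T2 w2 subrK.
rewrite XE1 XE2 tensrZl tensrDl tensrZr /energy_term tensrDr.
set Z := (X in supported _ X).
have -> : Z = (m.+1%:R / 2) *: (tensr Y1 v - tensr Y2 v - 2 *: T1 + 2 *: T2).
  rewrite /Z; apply/fcoefP => w; rewrite !(fcoefD, fcoefZ, fcoefN).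
by field; rewrite addrC natr1.
apply: supportedZ; apply: supportedD; last exact: supportedZ.
by apply: supportedB; [exact: supportedB | exact: supportedZ].
Qed.

End Homotopy.

(** * Effect of the operators on cosets, charges and weights *)

Section Moves.
Context {C : numFieldType}.
Local Notation VA := (free_module C (fock_basis C 2)).
Local Notation VB := (free_module C (fock_basis C 1)).
Local Notation AB := (fock_basis C 2 * fock_basis C 1)%type.
Local Notation VAB := (free_module C AB).
Local Notation G := (cd_gram C).
Local Notation c := (cv C).
Local Notation d := (dv C).
Local Notation phi := (phi C).
Implicit Types (a : fock_basis C 2) (b : fock_basis C 1) (ab : AB).
Implicit Types (z : VAB) (i j k n r : int).

Definition wt2 ab : int := wt ab.1 + wt ab.2.

Lemma wt2_ge0 ab : 0 <= wt2 ab.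
Proof. by apply: addr_ge0; exact: wt_ge0. Qed.

Definition same_coset (beta beta' : 'rV[C]_2) : Prop :=
  exists n : int, beta' = beta + n%:~R *: c.

Lemma same_coset_refl beta : same_coset beta beta.
Proof. by exists 0; rewrite scale0r addr0. Qed.

Lemma same_coset_trans beta1 beta2 beta3 :
  same_coset beta1 beta2 -> same_coset beta2 beta3 -> same_coset beta1 beta3.
Proof.
by move=> [n ->] [m ->]; exists (n + m); rewrite intrD scalerDl addrA.
Qed.

Lemma same_coset_c beta : same_coset beta (beta + c).
Proof. by exists 1; rewrite scale1r. Qed.

Lemma same_coset_Nc beta : same_coset beta (beta - c).
Proof. by exists (-1); rewrite scaleN1r. Qed.

Lemma supported_dmode r j a :
  supported (fun a' => same_coset a.2 a'.2 /\ (r = 0 -> wt a' = wt a + j))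
    (dmode r j (bvec C a)).
Proof.
apply: supportedD.
  apply: supported_linear (supported_vertex G c (j - r) a) => a' [e1 e2].
  rewrite /= shiftE; apply: supportedU; rewrite /= e1; split; first exact: same_coset_c.
  by move=> r0; rewrite [LHS]e2 r0 subr0.
case: eqP => [->|_]; last by rewrite scale0r; exact: supported0.
apply: supportedZ; apply: supportedU; split; first exact: same_coset_refl.
by rewrite addr0.
Qed.

Lemma supported_fpsi i j b :
  supported (fun b' => b'.2 = b.2 + phi /\ wt b' = wt b - j - 1 - i)
    (fpsi i j (bvec C b)).
Proof.
apply: supported_linear (supported_vertex (phi_gram C) phi (- j - 1 - i) b) => b' [e1 e2].
rewrite /= shiftE; apply: supportedU; rewrite /= e1; split=> //.
by rewrite [LHS]e2; lia.
Qed.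

Lemma supported_feta i m b :
  supported (fun b' => b'.2 = b.2 - phi /\ wt b' = wt b + m + i)
    (feta i m (bvec C b)).
Proof.
apply: supported_linear (supported_vertex (phi_gram C) (- phi) (m + i) b) => b' [e1 e2].
rewrite /= shiftE; apply: supportedU; rewrite /= e1; split=> //.
by rewrite [LHS]e2 addrA.
Qed.

(** For [r = 0] the change [- 1 - i] does not depend on the mode and offsets the growth of
    [i (i + 1) / 2] by [i + 1]: the differential preserves the total weight. *)
Lemma supported_dwin r i J ab :
  supported (fun ab' => [/\ same_coset ab.1.2 ab'.1.2, ab'.2.2 = ab.2.2 + phi &
     r = 0 -> wt2 ab' = wt2 ab - 1 - i]) (dwin r i J (bvec C ab)).
Proof.
case: ab => a b; rewrite -tensr_bvec dwin_tensr; apply: supported_sum => j _.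
apply: supportedW (supported_tensr (supported_dmode r j a) (supported_fpsi i j b)).
move=> [a' b'] /= [[e1 e2] [e3 e4]]; split=> // r0.
by rewrite /wt2 /= e4 (e2 r0); lia.
Qed.

Lemma supported_dshift k a :
  supported (fun a' => same_coset a.2 a'.2 /\ wt a' = wt a - k)
    (dshift k (bvec C a)).
Proof.
apply: supported_linear (supported_hmode_wt G d k a) => a' [e1 e2].
rewrite /= shiftE; apply: supportedU; rewrite /= e1; split; first exact: same_coset_Nc.
by rewrite [LHS]e2.
Qed.

Lemma supported_hterm i k ab :
  supported (fun ab' => [/\ same_coset ab.1.2 ab'.1.2, ab'.2.2 = ab.2.2 - phi &
     wt2 ab' = wt2 ab + i]) (hterm i k (bvec C ab)).
Proof.
case: ab => a b; rewrite -tensr_bvec /hterm opR_tensr opL_tensr.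
apply: supportedW (supported_tensr (supported_dshift k a) (supported_feta i k b)).
move=> [a' b'] /= [[e1 e2] [e3 e4]]; split=> //.
by rewrite /wt2 /= e4 e2; lia.
Qed.

Lemma supported_hop i M ab :
  supported (fun ab' => [/\ same_coset ab.1.2 ab'.1.2, ab'.2.2 = ab.2.2 - phi &
     wt2 ab' = wt2 ab + i]) (hop i M (bvec C ab)).
Proof.
apply: supported_sum => m _; apply: supportedZ.
by apply: supportedB; exact: supported_hterm.
Qed.

End Moves.

(** * Cohomology of the complex *)

Section Exactness.
Context {C : numFieldType}.
Local Notation VA := (free_module C (fock_basis C 2)).
Local Notation VB := (free_module C (fock_basis C 1)).
Local Notation AB := (fock_basis C 2 * fock_basis C 1)%type.
Local Notation VAB := (free_module C AB).
Local Notation G := (cd_gram C).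
Local Notation c := (cv C).
Local Notation d := (dv C).
Local Notation phi := (phi C).
Implicit Types (a : fock_basis C 2) (b : fock_basis C 1) (ab : AB).
Implicit Types (x y z : VAB) (i j k n p : int).

Variables (r : int) (beta0 : 'rV[C]_2).

Definition cochain_basis i ab : Prop :=
  same_coset beta0 ab.1.2 /\ ab.2.2 = i%:~R *: phi.
Local Notation cochain i := (supported (cochain_basis i)).

(** The differential stays abstract here, known only through its agreement with large windows on
    each cochain. *)
Variable dd : {linear VAB -> VAB}.
Hypothesis dd_dwin : forall i z, cochain i z ->
  exists J0, forall J : nat, (J0 <= J)%N -> dd z = dwin r i J z.

Lemma supported_dd i ab : cochain_basis i ab ->
  supported (fun ab' => [/\ same_coset ab.1.2 ab'.1.2, ab'.2.2 = ab.2.2 + phi &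
     r = 0 -> wt2 ab' = wt2 ab - 1 - i]) (dd (bvec C ab)).
Proof.
move=> abi; have [J0 /(_ J0 (leqnn _)) ->] := dd_dwin (supportedU abi).
exact: supported_dwin.
Qed.

Lemma cochain_dd i z : cochain i z -> cochain (i + 1) (dd z).
Proof.
apply: supported_linear => ab abi; apply: supportedW (supported_dd abi) => ab'.
case: abi => b0 e [e1 e2 _]; split; first exact: same_coset_trans e1.
by rewrite e2 e intrD scalerDl scale1r.
Qed.

Lemma dd_dd i z : cochain i z -> dd (dd z) = 0.
Proof.
move=> zi; have [J1 H1] := dd_dwin zi; have [J2 H2] := dd_dwin (cochain_dd zi).
rewrite (H2 (maxn J1 J2)) ?leq_maxr // (H1 (maxn J1 J2)) ?leq_maxl //.
exact: dwin_dwin.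
Qed.

Lemma cochain_hop i M z : cochain i z -> cochain (i - 1) (hop i M z).
Proof.
apply: supported_linear => ab [b0 e]; apply: supportedW (supported_hop i M ab) => ab'.
case=> e1 e2 _; split; first exact: same_coset_trans e1.
by rewrite e2 e intrD scalerDl scaleN1r.
Qed.

Definition hshift i z : VAB := opL (shift (- c)) (opR (feta i r) z).
HB.instance Definition _ i :=
  GRing.Linear.copy (hshift i) (opL (shift (- c)) \o opR (feta i r)).

Lemma cochain_hshift i z : cochain i z -> cochain (i - 1) (hshift i z).
Proof.
apply: supported_linear => -[a b] [b0 e].
rewrite -tensr_bvec /= /hshift opR_tensr opL_tensr /= shiftE.
have aP : supported (fun a' : fock_basis C 2 => a' = (a.1, a.2 - c))
    (bvec C (a.1, a.2 - c)) by exact: supportedU.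
apply: supportedW (supported_tensr aP (supported_feta i r b)) => -[a' b'] /=.
move=> [-> [e3 _]]; split=> /=; first exact: same_coset_trans (same_coset_Nc _).
by rewrite e3 [b.2]e intrD scalerDl scaleN1r.
Qed.

(** If [d h - w x = d y] by induction on the remaining excess, then [x = d (w^-1 (h - y))]; beyond
    [pmax] only zero is left. *)
Lemma exact_of_steps (E : int -> VAB -> Prop) i (w : C) (pmax : int) :
  w != 0 ->
  (forall p x, E p x -> exists2 h, cochain (i - 1) h & E (p + 1) (dd h - w *: x)) ->
  (forall p x, pmax < p -> E p x -> x = 0) ->
  forall p x, E p x -> exists2 y, cochain (i - 1) y & x = dd y.
Proof.
move=> w0 step top.
suff H (t : nat) p x : pmax - p < t%:Z -> E p x -> exists2 y, cochain (i - 1) y & x = dd y.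
  move=> p x; have [lt|] := ltP pmax p.
    by move=> /(top _ _ lt) ->; exists 0; [exact: supported0 | rewrite linear0].
  by move=> le; apply: (H (absz (pmax - p)%R).+1); lia.
elim: t p x => [|t IHt] p x pt Ex.
  by rewrite (top p x _ Ex); [exists 0; [exact: supported0 | rewrite linear0] | lia].
have [h hi Eh] := step p x Ex; have [||y yi dy] := IHt (p + 1) (dd h - w *: x) => //.
  by lia.
exists (w^-1 *: (h - y)); first by apply: supportedZ; apply: supportedB.
rewrite linearZ linearB /= -dy opprB addrC subrK scalerA mulVf ?scale1r //.
Qed.

Lemma dd_cocycle_step i h x (w : C) :
  cochain i x -> cochain (i - 1) h -> dd x = 0 ->
  cochain i (dd h - w *: x) /\ dd (dd h - w *: x) = 0.
Proof.
move=> xi hi dx; split.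
  by apply: supportedB; [have := cochain_dd hi; rewrite subrK | exact: supportedZ].
by rewrite linearB linearZ /= dx scaler0 subr0 (dd_dd hi).
Qed.

Lemma wt_bound x : exists N : nat, supported (fun ab : AB => wt2 ab < N%:Z) x.
Proof.
apply: (@supported_ind _ _ (fun=> True) (fun x => exists N : nat,
  supported (fun ab : AB => wt2 ab < N%:Z) x)) => //.
  by exists 0%N; exact: supported0.
move=> e ab y _ [N yN]; exists (N + absz (wt2 ab)).+1.
apply: supportedD.
  by apply: supportedZ; apply: supportedU; have := wt2_ge0 ab; lia.
by apply: supportedW yN => ab'; lia.
Qed.

Lemma exact_charged i x : r != 0 -> cochain i x -> dd x = 0 ->
  exists2 y, cochain (i - 1) y & x = dd y.
Proof.
move=> r0 xi dx; have [N xN] := wt_bound x.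
have [p xp] : exists p, supported (excessAB p) x.
  apply: (@supported_ind _ _ (fun=> True) (fun x => exists p,
    supported (excessAB p) x)) => //.
    by exists 0; exact: supported0.
  move=> e ab y _ [p yp]; exists (Order.min p (cd_excess ab.1)).
  apply: supportedD; last by apply: supportedW yp => ab'; rewrite /excessAB /excess_ge; lia.
  by apply: supportedZ; apply: supportedU; rewrite /excessAB /excess_ge; lia.
pose E p x := [/\ cochain i x, dd x = 0, supported (fun ab : AB => wt2 ab < N%:Z) x &
  supported (excessAB p) x].
(* The bound [N] works because the excess is at most the weight, which is below [N]. *)
apply: (@exact_of_steps E i 1 N%:Z) (And4 xi dx xN xp); first exact: oner_neq0.
  move=> {xi dx xN xp} {}p {}x [xi dx xN xp]; exists (hshift i x); first exact: cochain_hshift.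
  have [H1 H2] := dd_cocycle_step 1 xi (cochain_hshift xi) dx.
  (* The homotopy formula has no error term, as [shift (- c)] commutes with every bosonic mode. At
     mode [r] the summand 1 is absent because [r != 0], and the shifts by [c] cancel. *)
  have dE : dd (hshift i x) = opL (vertex G c 0) x.
    have [J1 H1'] := dd_dwin xi; have [J2 H2'] := dd_dwin (cochain_hshift xi).
    pose J := (maxn (maxn J1 J2) (absz r)).
    have rJ : r \in window J by rewrite mem_window /J; lia.
    rewrite (H2' J); last by rewrite /J; lia.
    have dwx : dwin r i J x = 0 by rewrite -(H1' J) ?dx // /J; lia.
    transitivity (dwin r (i - 1) J (hshift i x) + hshift (i + 1) (dwin r i J x)).
      by rewrite dwx linear0 addr0.
    apply: (eq_tensr (f := (dwin r (i - 1) J \o hshift i) \+ (hshift (i + 1) \o dwin r i J))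
      (g := opL (vertex G c 0))) => u v /=.
    rewrite {1}/hshift opR_tensr opL_tensr /hshift.
    rewrite (homotopy_tensr i v (B := shift (- c)) (K := fun _ _ => 0) rJ) => [|j]; last first.
      by rewrite dmode_shift addr0.
    rewrite big1 => [|j _]; last exact: tensr0l.
    by rewrite addr0 opL_tensr /= /dmode (negPf r0) scale0r addr0 subrr shiftD subrr shift0.
  have XE : supported (fun ab : AB => wt2 ab < N%:Z) (opL (vertex G c 0) x).
    apply: supported_linear xN => -[a b] abN; rewrite -tensr_bvec /= opL_tensr.
    have bb : supported (fun b' => b' = b) (bvec C b) by exact: supportedU.
    apply: supportedW (supported_tensr (supported_vertex G c 0 a) bb) => -[a' b'] /=.
    by move=> [[_ e] ->]; move: abN; rewrite /wt2 /= e addr0.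
  split=> //; rewrite scale1r dE; first exact: supportedB.
  apply: (supported_linear (f := opL (vertex G c 0) \- idfun)) xp => -[a b] abp /=.
  rewrite -tensr_bvec /= opL_tensr -tensrBl; apply: excess_tensr.
  by apply: vertex0_excess; apply: supportedU.
move=> {xi dx xN xp} {}p {}x Np [_ _ xN xp].
apply: (supported_none _ (supportedI xN xp)) => ab [].
rewrite /excessAB /excess_ge /wt2; have := cd_excess_le_wt ab.1; have := wt_ge0 ab.2.
lia.
Qed.

Lemma int_triangular i : exists2 q : int, 0 <= q & i * (i + 1) = 2 * q.
Proof.
have [k [iE|iE]] : exists k : int, i = 2 * k \/ i = 2 * k + 1.
- by exists (i %/ 2)%Z; lia.
- exists (k * (2 * k + 1)); last by rewrite iE; ring.
  by case: (lerP 0 k) => k0; [|rewrite -mulrNN]; apply: mulr_ge0; lia.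
- exists ((2 * k + 1) * (k + 1)); last by rewrite iE; ring.
  by case: (lerP 0 k) => k0; [|rewrite -mulrNN]; apply: mulr_ge0; lia.
Qed.

(** The positive quantity is twice the total weight [w], the scalar by which the homotopy acts at
    leading order. Truncating at [w] loses nothing, because neither tensor factor has larger
    weight. *)
Lemma exact_weight i n x : r = 0 -> 0 < 2 * n + i * (i + 1) ->
  cochain i x -> dd x = 0 -> supported (fun ab => wt2 ab = n) x ->
  exists2 y, cochain (i - 1) y & x = dd y.
Proof.
move=> r0 npos xi dx xn; have [q q0 iq] := int_triangular i.
have [w wE] : exists w : nat, n + q = w%:Z by exists (absz (n + q)%R); lia.
have [p xp] : exists p, supported (excessAB p) x.
  apply: (@supported_ind _ _ (fun=> True) (fun x => exists p,
    supported (excessAB p) x)) => //.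
    by exists 0; exact: supported0.
  move=> e ab y _ [p yp]; exists (Order.min p (cd_excess ab.1)).
  apply: supportedD; last by apply: supportedW yp => ab'; rewrite /excessAB /excess_ge; lia.
  by apply: supportedZ; apply: supportedU; rewrite /excessAB /excess_ge; lia.
pose E p x := [/\ cochain i x, dd x = 0, supported (fun ab : AB => wt2 ab = n) x &
  supported (excessAB p) x].
apply: (@exact_of_steps E i w%:R n) (And4 xi dx xn xp).
- by rewrite pnatr_eq0; lia.
- move=> {xi dx xn xp} {}p {}x [xi dx xn xp]; exists (hop i w x); first exact: cochain_hop.
  have [H1 H2] := dd_cocycle_step w%:R xi (cochain_hop w xi) dx.
  have hn : supported (fun ab => cochain_basis (i - 1) ab /\ wt2 ab = n + i) (hop i w x).
    apply: supportedI; first exact: cochain_hop.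
    apply: supported_linear xn => ab <-.
    by apply: supportedW (supported_hop i w ab) => ab' [].
  have dhn : supported (fun ab => wt2 ab = n) (dd (hop i w x)).
    apply: supported_linear hn => ab [abi abn].
    apply: supportedW (supported_dd abi) => ab' [_ _ /(_ r0) ->].
    by rewrite abn; lia.
  split=> //; first by apply: supportedB => //; exact: supportedZ.
  have [J1 J1E] := dd_dwin xi; have [J2 J2E] := dd_dwin (cochain_hop w xi).
  pose J := maxn (maxn J1 J2) w.
  have dwx : dwin 0 i J x = 0 by rewrite -r0 -(J1E J) ?dx // /J; lia.
  have -> : dd (hop i w x) = sop i w J x.
    by rewrite (J2E J) ?r0 ?/sop ?dwx ?linear0 ?addr0 // /J; lia.
  apply: (supported_linear (f := sop i w J \- (w%:R \*: idfun)))
    (supportedI xn xp) => -[a b] [abn abp] /=.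
  have a0 := wt_ge0 a; have b0 := wt_ge0 b; rewrite /wt2 /= in abn.
  have up : supported (excess_ge p) (bvec C a) by exact: supportedU.
  have wJ : (w <= J)%N by rewrite /J; lia.
  have := sop_leading i (bvec C b) wJ up; rewrite -tensr_bvec.
  rewrite boson_energyE; last by lia.
  (* The fermionic share of the total weight, charge term included; together with the bosonic share
     [wt a] it gives [w]. *)
  have [w' w'E] : exists w' : nat, w%:Z - wt a = w'%:Z by exists (absz (w%:Z - wt a)%R); lia.
  rewrite (@energyE _ w i w'); [|lia|]; last first.
    by apply: supportedU; rewrite /of_weight; lia.
  rewrite tensrZl tensrZr -scalerDl (_ : (wt a)%:~R + w'%:R = w%:R) //.
  have -> : w'%:R = (w'%:Z)%:~R :> C by [].
  by rewrite -intrD -w'E addrC subrK.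
move=> {xi dx xn xp} {}p {}x np [_ _ xn xp].
apply: (supported_none _ (supportedI xn xp)) => ab [].
rewrite /excessAB /excess_ge /wt2; have := cd_excess_le_wt ab.1; have := wt_ge0 ab.2.
lia.
Qed.

Lemma restr_dd i n x : r = 0 -> cochain i x ->
  restr (fun ab : AB => wt2 ab = n - 1 - i) (dd x) =
  dd (restr (fun ab : AB => wt2 ab = n) x).
Proof.
move=> r0; apply: (eq_linear_on (f := restr (fun ab => wt2 ab = n - 1 - i) \o dd)
  (g := dd \o restr (fun ab => wt2 ab = n))) => ab abi /=.
rewrite {2}/restr extE; have dE := supported_dd abi; case: asboolP => abn.
  by apply: restr_id; apply: supportedW dE => ab' [_ _ /(_ r0) ->]; rewrite abn.
rewrite linear0; apply: restr_eq0 dE => ab' [_ _ /(_ r0) ->] e.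
by apply: abn; lia.
Qed.

Lemma cochain_restr (D : AB -> Prop) i x : cochain i x -> cochain i (restr D x).
Proof. by move=> xi; apply: supportedW (supported_restr D xi) => ab []. Qed.

Lemma supported_restrC (D P : AB -> Prop) x : supported P x ->
  supported (fun ab => P ab /\ ~ D ab) (x - restr D x).
Proof.
apply: (supported_linear (f := idfun \- restr D)) => ab Pab /=.
rewrite /restr extE; case: asboolP => Dab; first by rewrite subrr; exact: supported0.
by rewrite subr0; exact: supportedU.
Qed.

(** The Fock weight is meant, without the charge term: in charges other than -1 and 0 this part
    still has positive total weight. *)
Definition lowest x : VAB := restr (fun ab : AB => wt2 ab = 0) x.

(** The differential is homogeneous, so the component of top Fock weight is itself a cocycle; it is
    exact and can be peeled off. *)
Lemma reduce_to_lowest i x : r = 0 -> cochain i x -> dd x = 0 ->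
  exists2 y, cochain (i - 1) y & x = dd y + lowest x.
Proof.
move=> r0; have [N] := wt_bound x; elim: N x => [|N IHN] x xN xi dx.
  have -> : x = 0 by apply: supported_none xN => ab; have := wt2_ge0 ab; lia.
  by exists 0; [exact: supported0 | rewrite /lowest !linear0 addr0].
have [N0|Npos] := posnP N.
  exists 0; first exact: supported0.
  rewrite linear0 add0r /lowest restr_id //; apply: supportedW xN => ab.
  by have := wt2_ge0 ab; lia.
pose D (ab : AB) := wt2 ab = N%:Z; have xDi := cochain_restr D xi.
have dxD : dd (restr D x) = 0 by rewrite -(restr_dd N r0 xi) dx linear0.
have xDn : supported (fun ab => wt2 ab = N%:Z) (restr D x).
  by apply: supportedW (supported_restr D xi) => ab [].
have npos : 0 < 2 * N%:Z + i * (i + 1) by have [q q0 ->] := int_triangular i; lia.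
have [y1 y1i xDE] := exact_weight r0 npos xDi dxD xDn.
have [|||y2 y2i xE] := IHN (x - restr D x).
- by apply: supportedW (supported_restrC D xN) => ab []; rewrite /D; lia.
- exact: supportedB.
- by rewrite linearB /= dx dxD subr0.
exists (y1 + y2); first exact: supportedD.
rewrite linearD /= -xDE -addrA; apply/eqP; rewrite addrC -subr_eq; apply/eqP.
rewrite {1}xE; congr (_ + _); rewrite /lowest linearB /=.
rewrite [X in _ - X](_ : _ = 0) ?subr0 //.
apply: restr_eq0 (supported_restr D xi) => ab [] /=; rewrite /D; lia.
Qed.

Lemma wt2_eq0 ab : wt2 ab = 0 -> ab = ((mset0, ab.1.2), (mset0, ab.2.2)).
Proof.
rewrite /wt2; have := wt_ge0 ab.1; have := wt_ge0 ab.2 => h1 h2 h.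
have e1 : weight ab.1.1 = 0 by change (wt ab.1 = 0); lia.
have e2 : weight ab.2.1 = 0 by change (wt ab.2 = 0); lia.
case: ab {h1 h2 h} e1 e2 => -[s b1] [t b2] /= /weight_eq0 -> /weight_eq0 -> //.
Qed.

Definition vac (beta : 'rV[C]_2) i : VAB :=
  bvec C (((mset0, beta) : fock_basis C 2), ((mset0, i%:~R *: phi) : fock_basis C 1)).

Lemma cochain_vac n i : cochain i (vac (beta0 + n%:~R *: c) i).
Proof. by apply: supportedU; split=> //; exists n. Qed.

(** On a vacuum of charge -1 the bosonic mode needs degree [j >= 0] and the fermionic one
    [- j >= 0], so only [j = 0] survives. In charge 0 the fermionic degree is [- j - 1] and nothing
    survives. *)
Lemma dd_vac_neg n : r = 0 ->
  dd (vac (beta0 + n%:~R *: c) (-1)) =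
  vac (beta0 + (n + 1)%:~R *: c) 0 + vac (beta0 + n%:~R *: c) 0.
Proof.
have symc := cd_gram_sym (C := C); have symp := phi_gram_sym (C := C).
move=> r0; have [J0 /(_ J0 (leqnn _)) ->] := dd_dwin (cochain_vac n (-1)).
rewrite r0 /vac -tensr_bvec dwin_tensr.
set a := (mset0, _) : fock_basis C 2; set b := (mset0, _) : fock_basis C 1.
have a0 : is_vacuum a by []. have b0 : is_vacuum b by [].
have z0 : (0 : int) \in window J0 by rewrite mem_window; lia.
rewrite (bigD1_seq _ z0) ?window_uniq //= big1 ?addr0 => [|j j0].
  have e0 : 0 - 0 = 0 :> int by []. have e1 : - 0 - 1 - -1 = 0 :> int by [].
  rewrite /dmode /fpsi /psi eqxx scale1r e0 e1 !vertex_vacuum //.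
  rewrite (creation_exp0 G c (bvec C a) : creation_exp G c 0%Z _ = _).
  rewrite (creation_exp0 _ phi (bvec C b) : creation_exp _ phi 0%Z _ = _).
  rewrite !shiftE /= tensrDl !tensr_bvec /a /b /=.
  have -> : (-1)%:~R *: phi + phi = 0%:~R *: phi :> 'rV[C]_1.
    by rewrite scaleN1r addNr scale0r.
  by rewrite intrD scalerDl scale1r addrA.
have [jneg|jpos] := ltP j 0.
  rewrite /dmode (negPf j0) scale0r addr0 vertex_vacuum // creation_exp_lt0 ?subr0 //.
  by rewrite linear0 tensr0l.
rewrite /fpsi /psi vertex_vacuum // creation_exp_lt0 ?linear0 ?tensr0r //.
by move/eqP: j0; lia.
Qed.

Lemma dd_vac0 : r = 0 -> dd (vac beta0 0) = 0.
Proof.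
have symc := cd_gram_sym (C := C); have symp := phi_gram_sym (C := C).
move=> r0; have := cochain_vac 0 0; rewrite scale0r addr0 => vi.
have [J0 /(_ J0 (leqnn _)) ->] := dd_dwin vi.
rewrite r0 /vac -tensr_bvec dwin_tensr big1 // => j _.
have [jneg|jpos] := ltP j 0.
  rewrite /dmode (_ : (j == 0) = false) ?scale0r ?addr0; last by lia.
  by rewrite vertex_vacuum // creation_exp_lt0 ?subr0 // linear0 tensr0l.
rewrite /fpsi /psi vertex_vacuum // creation_exp_lt0 ?linear0 ?tensr0r //.
by lia.
Qed.

End Exactness.

Lemma fcoef_eventually0 (C : fieldType) (K : choiceType) (g : nat -> K)
    (x : free_module C K) : injective g ->
  exists N, forall n, (N <= n)%N -> fcoef (g n) x = 0.
Proof.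
move=> g_inj; apply: (@supported_ind _ _ (fun=> True) (fun x =>
  exists N, forall n, (N <= n)%N -> fcoef (g n) x = 0)) => //.
  by exists 0%N => n _; rewrite fcoef0.
move=> e b y _ [N yN].
have [[m gm]|nog] := pselect (exists m, g m = b); last first.
  exists N => n Nn; rewrite fcoefD fcoefZ fcoef_bvec yN // addr0.
  by case: eqP => [bg|]; rewrite ?mulr0 //; case: nog; exists n.
exists (N + m.+1)%N => n Nn; rewrite fcoefD fcoefZ fcoef_bvec yN ?addr0; last by lia.
by case: eqP => [bg|]; rewrite ?mulr0 //; move: (g_inj m n); rewrite gm => /(_ bg); lia.
Qed.

(** * The sector [r = 0]: Laurent polynomials in [e^c] and the residue *)

Section NeutralSector.
Context {C : numFieldType}.
Local Notation AB := (fock_basis C 2 * fock_basis C 1)%type.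
Local Notation VAB := (free_module C AB).
Local Notation c := (cv C).
Local Notation phi := (phi C).
Implicit Types (ab : AB) (x y z : VAB) (i j k n p : int).

Variable beta0 : 'rV[C]_2.
Local Notation cochain i := (supported (cochain_basis beta0 i)).
Local Notation vacn n i := (vac (beta0 + n%:~R *: c) i).

Variable dd : {linear VAB -> VAB}.
Hypothesis dd_dwin : forall i z, cochain i z ->
  exists J0, forall J : nat, (J0 <= J)%N -> dd z = dwin 0 i J z.

Lemma coset_inj : injective (fun n : int => beta0 + n%:~R *: c).
Proof.
move=> m n /addrI /eqP; rewrite -subr_eq0 -scalerBl => /eqP/rowP/(_ 0).
by rewrite !mxE eqxx mulr1 => /eqP; rewrite subr_eq0 => /eqP/intr_inj.
Qed.

Lemma cochain_lowestE i ab : cochain_basis beta0 i ab -> wt2 ab = 0 ->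
  exists n, bvec C ab = vacn n i.
Proof. by move=> [[n e] e'] /wt2_eq0 ->; exists n; rewrite e e'. Qed.

Lemma fcoef_vac n m i :
  fcoef ((mset0, beta0 + m%:~R *: c) : fock_basis C 2,
         (mset0, i%:~R *: phi) : fock_basis C 1) (vacn n i) = (n == m)%:R.
Proof.
rewrite fcoef_bvec; congr (_%:R); congr (nat_of_bool _).
by apply/eqP/eqP => [[/coset_inj]|->].
Qed.

(** Multiplication by [1 + e^c] is injective on Laurent polynomials: the coefficients of a kernel
    element alternate in sign, and all but finitely many vanish. *)
Lemma lowest_closed_eq0 x : cochain (-1) x -> supported (fun ab => wt2 ab = 0) x ->
  dd x = 0 -> x = 0.
Proof.
move=> xi x0 dx.
pose f n : C := fcoef ((mset0, beta0 + n%:~R *: c) : fock_basis C 2,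
  (mset0, (-1)%:~R *: phi) : fock_basis C 1) x.
have f_rec n : f (n + 1) = - f n.
  apply/eqP; rewrite -addr_eq0 addrC; apply/eqP.
  pose w : AB := ((mset0, beta0 + (n + 1)%:~R *: c) : fock_basis C 2,
    (mset0, 0%:~R *: phi) : fock_basis C 1).
  transitivity (fcoef w (dd x)); last by rewrite dx fcoef0.
  rewrite /f; elim/(@supported_ind C AB): (supportedI xi x0) => {xi x0 dx f}.
    by rewrite linear0 !fcoef0 addr0.
  move=> e ab y [abi ab0] IH; rewrite linearD linearZ /= !fcoefD !fcoefZ -IH.
  have [m ->] := cochain_lowestE abi ab0.
  rewrite (dd_vac_neg dd_dwin) // fcoefD !fcoef_vac (_ : (m + 1 == n + 1) = (m == n)).
    by ring.
  by rewrite (inj_eq (addIr _)).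
have f_zero n : f n = 0.
  pose g (k : nat) : AB := ((mset0, beta0 + (n + k%:Z)%:~R *: c) : fock_basis C 2,
     (mset0, (-1)%:~R *: phi) : fock_basis C 1).
  have g_inj : injective g by move=> k k' [/coset_inj/addrI[]].
  have [N /(_ N (leqnn _)) fN] := fcoef_eventually0 x g_inj.
  have {fN} : f (n + N%:Z) = 0 by [].
  elim: N => [|N IHN]; first by rewrite addr0.
  by rewrite -addn1 PoszD addrA f_rec => /eqP; rewrite oppr_eq0 => /eqP.
apply/fcoefP => ab; rewrite fcoef0; apply: contrapT => ab0.
have [abi abz] : cochain_basis beta0 (-1) ab /\ wt2 ab = 0.
  by split; [apply: supported_in xi _ | apply: supported_in x0 _]; apply/eqP.
case: abi ab0 => -[n e] e'; rewrite (wt2_eq0 abz) e e' => nz.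
by apply: nz; exact: f_zero.
Qed.

Lemma cochain_lowest i x : cochain i x -> cochain i (lowest x).
Proof. exact: cochain_restr. Qed.

Lemma supported_lowest x : supported (fun ab => wt2 ab = 0) (lowest x).
Proof.
have xT : supported (fun _ => True) x by split.
by apply: supportedW (supported_restr _ xT) => ab [].
Qed.

Lemma dd_lowest i x : cochain i x -> dd x = 0 -> dd (lowest x) = 0.
Proof. by move=> xi dx; rewrite /lowest -(restr_dd dd_dwin 0 _ xi) ?dx ?linear0. Qed.

(** For the part of Fock weight 0, charge -1 is settled by injectivity of [1 + e^c]; in the other
    charges [i (i + 1) > 0], so the total weight is positive. *)
Lemma exact_neutral i x : i != 0 -> cochain i x -> dd x = 0 ->
  exists2 y, cochain (i - 1) y & x = dd y.
Proof.
move=> i0 xi dx; have [y yi ->] := reduce_to_lowest dd_dwin (erefl _) xi dx.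
have [y' y'i ->] : exists2 y', cochain (i - 1) y' & lowest x = dd y'.
  have [iN|iN] := eqVneq i (-1).
    exists 0; first exact: supported0.
    rewrite linear0; apply: lowest_closed_eq0.
    - by rewrite -iN; exact: cochain_lowest.
    - exact: supported_lowest.
    - exact: dd_lowest xi dx.
  apply: (exact_weight dd_dwin (n := 0)) => //.
  - have [q q0 e] := int_triangular i; rewrite mulr0 add0r.
    have : i * (i + 1) != 0 by rewrite mulf_neq0 // addr_eq0.
    by rewrite e; lia.
  - exact: cochain_lowest.
  - exact: dd_lowest xi dx.
  - exact: supported_lowest.
by exists (y + y'); [exact: supportedD | rewrite linearD].
Qed.

(** Modulo the image of [1 + e^c], consecutive powers of [e^c] are opposite; the induction runs in
    both directions from exponent 0. *)
Lemma vac_exact_mod n : exists e : C, exists2 y, cochain (-1) y &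
  vacn n 0 = e *: vac beta0 0 + dd y.
Proof.
have step m : vacn (m + 1) 0 = dd (vacn m (-1)) - vacn m 0.
  by rewrite (dd_vac_neg dd_dwin) // addrK.
have vi m : cochain (-1) (vacn m (-1)) by exact: cochain_vac.
have base : vacn 0 0 = vac beta0 0 by rewrite scale0r addr0.
suff H (k : nat) : (exists e : C, exists2 y, cochain (-1) y &
    vacn k%:Z 0 = e *: vac beta0 0 + dd y) /\
    (exists e : C, exists2 y, cochain (-1) y &
    vacn (- k%:Z) 0 = e *: vac beta0 0 + dd y).
  by case: (intP n) => [|k|k]; [have [] := H 0%N | have [] := H k.+1 | have [] := H k.+1].
elim: k => [|k [[e [y yi yE]] [e' [y' y'i y'E]]]].
  by rewrite oppr0 base; split; exists 1; exists 0; rewrite ?linear0 ?scale1r ?addr0 //;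
    exact: supported0.
split.
  exists (- e); exists (vacn k%:Z (-1) - y); first exact: supportedB.
  have -> : k.+1%:Z = k%:Z + 1 by lia.
  by rewrite step yE linearB /= opprD addrCA scaleNr.
exists (- e'); exists (vacn (- k.+1%:Z) (-1) - y'); first exact: supportedB.
have := step (- k.+1%:Z); rewrite (_ : - k.+1%:Z + 1 = - k%:Z); last by lia.
move=> E; have -> : vacn (- k.+1%:Z) 0 = dd (vacn (- k.+1%:Z) (-1)) - vacn (- k%:Z) 0.
  by rewrite E opprB [RHS]addrCA subrr addr0.
by rewrite y'E linearB /= opprD [LHS]addrCA [- e' *: _]scaleNr.
Qed.

Lemma vacuum_generates x : cochain 0 x -> dd x = 0 ->
  exists e : C, exists2 y, cochain (-1) y & x = e *: vac beta0 0 + dd y.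
Proof.
move=> xi dx; have [y yi ->] := reduce_to_lowest dd_dwin (erefl _) xi dx.
have [e [y' y'i ->]] : exists e : C, exists2 y', cochain (-1) y' &
    lowest x = e *: vac beta0 0 + dd y'.
  elim/(@supported_ind C AB): (supportedI (cochain_lowest xi) (supported_lowest x)).
    exists 0; exists 0; first exact: supported0.
    by rewrite linear0 scale0r addr0.
  move=> e ab z [abi ab0] [e2 [y2 y2i ->]].
  have [m ->] := cochain_lowestE abi ab0.
  have [e1 [y1 y1i ->]] := vac_exact_mod m.
  exists (e * e1 + e2); exists (e *: y1 + y2).
    by apply: supportedD => //; exact: supportedZ.
  rewrite [dd (_ + _)]linearD [dd (_ *: _)]linearZ /=.
  by apply/fcoefP => w; rewrite !(fcoefD, fcoefZ); ring.
by exists e; exists (y + y'); [exact: supportedD | rewrite linearD addrCA].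
Qed.

(* Evaluation at e^c = -1, where the differential 1 + e^c of the weight zero part
   vanishes. *)
Definition residue : VAB -> C^o :=
  ext (fun ab : AB => if pselect (exists n, bvec C ab = vacn n 0) is left H
       then (-1) ^ projT1 (cid H) else 0).
HB.instance Definition _ := GRing.Linear.on residue.

Lemma residue_vac n : residue (vacn n 0) = (-1) ^ n.
Proof.
rewrite /residue extE; case: pselect => [H|[]]; last by exists n.
case: (cid H) => m /= e; congr (_ ^ _).
have := congr1 (fcoef ((mset0, beta0 + n%:~R *: c) : fock_basis C 2,
  (mset0, 0%:~R *: phi) : fock_basis C 1)) e.
rewrite !fcoef_vac eqxx; case: (eqVneq m n) => [-> //|_] /eqP.
by rewrite oner_eq0.
Qed.

Lemma residue_dd y : cochain (-1) y -> residue (dd y) = 0.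
Proof.
apply: (eq_linear_on (f := residue \o dd) (g := \0)) => ab abi /=.
have [ab0|ab0] := eqVneq (wt2 ab) 0.
  have [m ->] := cochain_lowestE abi ab0.
  rewrite (dd_vac_neg dd_dwin) // linearD /= !residue_vac expfzDr ?oppr_eq0 ?oner_eq0 //.
  by rewrite expr1z mulrN1 addNr.
(* In charge -1 the differential preserves the Fock weight, so a nonzero weight never reaches the
   vacua seen by [residue]. *)
apply: (eq_linear_on (f := residue) (g := \0)) (supported_dd dd_dwin abi) => ab'.
move=> [_ _ /(_ erefl) e] /=; rewrite /residue extE; case: pselect => // -[n abE].
case/eqP: ab0; have := congr1 (fcoef ab') abE; rewrite fcoef_bvec eqxx => /eqP.
rewrite fcoef_bvec eq_sym pnatr_eq1 eqb1 => /eqP ab'E; move: e; rewrite -ab'E.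
by rewrite /wt2 /wt /weight !letter_deg0; lia.
Qed.

Lemma vac_not_exact y : cochain (-1) y -> vac beta0 0 != dd y.
Proof.
move=> yi; apply/eqP => /(congr1 residue); rewrite residue_dd //.
have := residue_vac 0; rewrite scale0r addr0 => -> /eqP.
by rewrite oner_eq0.
Qed.

End NeutralSector.

(** * Comparison with the Drinfeld-Sokolov complex *)

Section ExpTransport.
Context {C : numFieldType} {V : lmodType C}.
Variable a : nat -> {linear V -> V}.

(** The alphabet ['I_N] is independent of [n], because passing to the tail of a tuple lowers the sum
    but not the alphabet. *)
Lemma exp_part_tuple N s n v : (n <= N)%N ->
  \sum_(t : s.-tuple 'I_N | (\sum_(i <- t) i.+1)%N == n)
    foldr (fun i : 'I_N => a i.+1 : V -> V) v t = exp_part a s n v.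
Proof.
elim: s n => [|s IHs] n nN /=.
  rewrite big_mkcond (big_pred1 [tuple]) => [|t]; last by apply/esym/eqP; exact: (tuple0 t).
  by rewrite /= big_nil eq_sym.
rewrite (reindex_onto (fun p : 'I_N * s.-tuple 'I_N => [tuple of p.1 :: p.2])
  (fun t => (thead t, [tuple of behead t]))) => [|t _]; last first.
  by rewrite [RHS]tuple_eta; apply: val_inj.
rewrite (big_ord_widen _ (fun i => a i.+1 (exp_part a s (n - i.+1) v)) nN).
rewrite [RHS]big_mkcond /=.
transitivity (\sum_(i < N) \sum_(t : s.-tuple 'I_N |
    (i < n)%N && ((\sum_(j <- t) j.+1)%N == (n - i.+1)%N))
    a i.+1 (foldr (fun j : 'I_N => a j.+1 : V -> V) v t)).
  rewrite pair_big_dep /=; apply: eq_bigl => -[i t] /=; rewrite theadE.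
  rewrite big_cons (_ : (_, _) = (i, t)); last by congr (_, _); apply: val_inj.
  by rewrite eqxx andbT; apply/idP/idP; lia.
apply: eq_bigr => i _; case: ifP => lein; last by rewrite big_pred0.
by rewrite -IHs ?linear_sum //; lia.
Qed.

End ExpTransport.

Section Transport.
Context {C : numFieldType}.

Lemma lin_extU (K : choiceType) (V : lmodType C) (f : K -> V) b :
  lin_ext f << b >> = f b.
Proof.
by rewrite /lin_ext msuppU oner_eq0 big_seq_fset1 mcoeffU eqxx scale1r.
Qed.

Lemma supported_seal (K : choiceType) (P : K -> Prop) (x : {malg C[K]}) :
  supported P (seal x) <-> forall b, b \in msupp x -> P b.
Proof.
have fE b : (fcoef b (seal x) != 0) = (b \in msupp x).
  by rewrite fcoef.unlock sealK mcoeff_neq0.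
split=> [[xP] b|xP]; first by rewrite -fE => /xP.
by split=> b; rewrite fE => /xP.
Qed.

Lemma seal_inj (K : choiceType) : injective (@seal C K).
Proof. exact: can_inj (@sealK C K). Qed.

Lemma seal_fsbig (K T : choiceType) (A : set T) (r : seq T) (f : T -> {malg C[K]}) :
  uniq r -> (forall i, i \in r -> A i) ->
  (forall i, A i -> i \notin r -> seal (f i) = 0) ->
  seal (\sum_(i \in A) f i) = \sum_(i <- r) seal (f i).
Proof.
move=> r_uniq rA f0; rewrite (fsbigE r) //= => [|i Ai ir]; last first.
  by apply: seal_inj; rewrite linear0; exact: f0.
rewrite linear_sum [LHS]big_seq_cond [RHS]big_seq; apply: eq_bigl => i.
by case: (boolP (i \in r)) => //= /rA Ai; rewrite mem_set.
Qed.

Section Fock.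
Context {l : nat}.
Local Notation V := (free_module C (fock_basis C l)).
Variable G : 'M[C]_l.

HB.instance Definition _ h n := GRing.Linear.on (@heis C l G h n).
HB.instance Definition _ (nu : 'rV[C]_l) := GRing.Linear.on (@mul_expv C l nu).

Lemma seal_heis h (n : int) (x : fock C l) : n != 0 ->
  seal (heis G h n x) = hmode G h n (seal x).
Proof.
move=> n0; rewrite -[x](sealK (K := fock_basis C l)); move: (seal x) => v.
rewrite unsealK.
apply: (eq_linear (f := seal \o heis G h n \o unseal) (g := hmode G h n)) => b.
rewrite /= unseal_bvec /heis lin_extU.
case: n n0 => [[|m]|m] // _; rewrite /hmode linear_sum; apply: eq_bigr => j _.
  by rewrite linearZ seal_basis mset_remB annihilatorE scalerA.
by rewrite linearZ seal_basis mset_addD creatorE.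
Qed.

Lemma seal_mul_expv nu (x : fock C l) : seal (mul_expv nu x) = shift nu (seal x).
Proof.
rewrite -[x](sealK (K := fock_basis C l)); move: (seal x) => v; rewrite unsealK.
apply: (eq_linear (f := seal \o @mul_expv C l nu \o unseal) (g := shift nu)) => b.
by rewrite /= unseal_bvec /mul_expv lin_extU seal_basis shiftE.
Qed.

Lemma seal_exp_coef (a : nat -> fock C l -> fock C l) (a' : nat -> {linear V -> V}) n x :
  (forall m y, seal (a m.+1 y) = a' m.+1 (seal y)) ->
  seal (exp_coef a n x) = exp_op a' n (seal x).
Proof.
move=> aa'; rewrite /exp_coef linear_sum; apply: eq_bigr => s _.
rewrite linearZ linear_sum -(exp_part_tuple a' s (seal x) (leqnn n)) /=.
congr (_ *: _); apply: eq_bigr => t _; elim: (tval t) => //= i t' IH.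
by rewrite aa' IH.
Qed.

Lemma seal_creation_exp g (n : nat) (x : fock C l) :
  seal (exp_coef (fun m => m%:R^-1 \*: heis G g (- m%:Z)) n x) =
  creation_exp G g n%:Z (seal x).
Proof. by apply: seal_exp_coef => m y; rewrite /= linearZ /= seal_heis. Qed.

Lemma seal_annihilation_exp g (n : nat) (x : fock C l) :
  seal (exp_coef (fun m => - m%:R^-1 \*: heis G g m%:Z) n x) =
  annihilation_exp G g n%:Z (seal x).
Proof. by apply: seal_exp_coef => m y; rewrite /= linearZ /= seal_heis. Qed.

(** As [<g, beta>] is the integer [q] and integers embed in [C], the scalar condition on [(s, t)]
    becomes [s - t = - n - 1 - q]. So [t] determines [s], and only [t] up to the weight of [b]
    contributes. *)
Lemma seal_Yexp_basis g (n q : int) (b : fock_basis C l) :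
  pairing G g b.2 = q%:~R ->
  seal (Yexp_basis G g n b) = shift g (vertex G g (- n - 1 - q) (bvec C b)).
Proof.
move=> gb; set a := - n - 1 - q; pose N := (absz (wt b)).+1.
have inA (s t : nat) : (s%:R - t%:R + pairing G g b.2 = (- n - 1)%:~R :> C) <->
    s%:Z - t%:Z = a.
  rewrite gb -[s%:R]/(s%:Z%:~R) -[t%:R]/(t%:Z%:~R) -intrB -intrD.
  by split=> [/intr_inj|] e; [rewrite /a -e; lia | congr (_%:~R); lia].
pose r := [seq (absz (a + t%:Z)%R, t) | t <- iota 0 N & 0 <= a + t%:Z].
rewrite /Yexp_basis (@seal_fsbig _ _ _ r).
- rewrite big_map big_filter.
  have bN : supported (fun b' => wt b' < N%:Z) (bvec C b).
    by apply: supportedU; have := wt_ge0 b; rewrite /N; lia.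
  rewrite (vertexE G g a bN) linear_sum -(big_mkord xpredT (fun t => shift g
    (creation_exp G g (a + t%:Z) (annihilation_exp G g t%:Z (bvec C b))))).
  rewrite /index_iota subn0 big_mkcond; apply: eq_bigr => t _ /=.
  case: (leP 0 (a + t%:Z)) => [at0|at0]; last first.
    by rewrite creation_exp_lt0 // linear0.
  rewrite seal_mul_expv seal_creation_exp seal_annihilation_exp seal_basis.
  by rewrite gez0_abs.
- by rewrite map_inj_uniq ?filter_uniq ?iota_uniq // => t t' [].
- move=> [s t] /mapP[t']; rewrite mem_filter => /andP[at0 _] [-> ->] /=.
  by apply/inA; lia.
- move=> [s t] /inA /= st stN.
  rewrite seal_mul_expv seal_creation_exp seal_annihilation_exp seal_basis.
  rewrite annihilation_exp_eq0 ?linear0 //; apply: supportedU.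
  have wb := wt_ge0 b; rewrite ltNge; apply/negP => tb; case/negP: stN.
  apply/mapP; exists t; last by congr (_, _); lia.
  by rewrite mem_filter mem_iota /N; apply/andP; split; lia.
Qed.

Lemma Ymode_exp g (n : int) (x : fock C l) :
  Ymode G (expv g) n x = lin_ext (Yexp_basis G g n) x.
Proof. by rewrite /Ymode /expv lin_extU enum_mset0. Qed.

Lemma seal_Ymode_exp g (n q : int) (b : fock_basis C l) :
  pairing G g b.2 = q%:~R ->
  seal (Ymode G (expv g) n << b >>) =
  shift g (vertex G g (- n - 1 - q) (bvec C b)).
Proof. by move=> gb; rewrite Ymode_exp lin_extU (seal_Yexp_basis n gb). Qed.

Lemma vertex_zero (n : int) v : vertex G 0 n v = (n == 0)%:R *: v.
Proof.
have c0 m u : cmode G 0 m u = 0.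
  rewrite /cmode; case: m => [|m]; first by rewrite hmode0 scaler0.
  by rewrite /hmode /= big1 ?scaler0 // => j _; rewrite mxE scale0r.
have P0 k u : creation_exp G 0 k u = (k == 0)%:R *: u.
  by apply: exp_int_vacuum => [i j w|m]; rewrite /= ?c0.
have a0 m u : amode G 0 m u = 0.
  rewrite /amode; case: m => [|m]; first by rewrite hmode0 scaler0.
  rewrite /hmode big1 ?scaler0 // => j _.
  by rewrite (_ : 0 = 0 *: 0 :> 'rV[C]_l) ?pairingZl ?mul0r ?mulr0 ?scale0r // scale0r.
have Q0 k u : annihilation_exp G 0 k u = (k == 0)%:R *: u.
  by apply: exp_int_vacuum => [i j w|m]; rewrite /= ?a0.
have [N vN] := vertex_bound v.
have vN1 : supported (fun b => wt b < N.+1%:Z) v by apply: supportedW vN => b; lia.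
rewrite (vertexE G 0 n vN1) big_ord_recl big1 ?addr0 => [|t _].
  by rewrite Q0 P0 eqxx scale1r.
by rewrite Q0 scale0r linear0.
Qed.

End Fock.

Lemma seal_tens (A B : choiceType) (x : {malg C[A]}) (y : {malg C[B]}) :
  seal (tens x y) = tensr (seal x) (seal y).
Proof.
rewrite -[x](sealK (K := A)); move: (seal x) => u; rewrite unsealK.
apply: (eq_linear (f := seal \o lin_ext (fun a => lin_ext (fun b => << (a, b) >>) y) \o
  unseal) (g := tensl (seal y))) => a.
rewrite /= unseal_bvec lin_extU.
rewrite -[y](sealK (K := B)); move: (seal y) => v; rewrite unsealK.
apply: (eq_linear (f := seal \o lin_ext (fun b => << (a, b) >>) \o
  unseal) (g := tensr (bvec C a))) => b.
by rewrite /= unseal_bvec lin_extU seal_basis tensr_bvec.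
Qed.

End Transport.

Section Differential.
Context {C : numFieldType}.
Local Notation VA := (free_module C (fock_basis C 2)).
Local Notation VB := (free_module C (fock_basis C 1)).
Local Notation AB := (fock_basis C 2 * fock_basis C 1)%type.
Local Notation VAB := (free_module C AB).
Local Notation G := (cd_gram C).
Local Notation c := (cv C).
Local Notation phi := (phi C).

Lemma vertex_eq0 l (H : 'M[C]_l) g n (b : fock_basis C l) : wt b + n < 0 ->
  vertex H g n (bvec C b) = 0.
Proof.
move=> bn; apply: (supported_none _ (supported_vertex H g n b)) => b' [_ e].
by have := wt_ge0 b'; rewrite e; lia.
Qed.

Definition ds_term (uv ab : AB) : fock2 C :=
  \sum_(i \in [set: int]%classic)
    tens (Ymode G << ab.1 >> i << uv.1 >>)
         (Ymode (phi_gram C) << ab.2 >> (0 - 1 - i) << uv.2 >>).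

Lemma d_DS0_basis uv :
  d_DS0 (<< uv >> : fock2 C) = lin_ext (ds_term uv) (d_DS C).
Proof. exact: lin_extU. Qed.

(** The coefficient of [z^j] is the mode [-1 - j], whose partner in the zero mode of the product is
    the fermionic mode [j]. Outside the window one of the two factors would have negative weight. *)
Lemma seal_ds_term g (q i : int) (a : fock_basis C 2) (b : fock_basis C 1) (J : nat) :
  pairing G g a.2 = q%:~R -> b.2 = i%:~R *: phi ->
  wt a + wt b + `|q| + `|i| + 1 <= J%:Z ->
  seal (ds_term (a, b) ((mset0, g), (mset0, phi))) =
  \sum_(j <- window J)
    tensr (shift g (vertex G g (j - q) (bvec C a))) (fpsi i j (bvec C b)).
Proof.
move=> ga bi leJ; have [wa wb] := (wt_ge0 a, wt_ge0 b).
have gb : pairing (phi_gram C) phi b.2 = i%:~R.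
  by rewrite bi pairingZr pairing_phi mulr1.
have termE m : seal (tens (Ymode G (expv g) m << a >>)
    (Ymode (phi_gram C) (expv phi) (0 - 1 - m) << b >>)) =
  tensr (shift g (vertex G g (- m - 1 - q) (bvec C a))) (fpsi i (- 1 - m) (bvec C b)).
  rewrite seal_tens (seal_Ymode_exp m ga) (seal_Ymode_exp _ gb) /fpsi /psi.
  by rewrite sub0r.
rewrite /ds_term (@seal_fsbig _ _ _ _ [seq - 1 - j | j <- window J]) //.
- rewrite big_map; apply: eq_bigr => j _; rewrite termE.
  have e1 : - (-1 - j) - 1 - q = j - q by lia.
  have e2 : -1 - (-1 - j) = j by lia.
  by rewrite e1 e2.
- by rewrite map_inj_uniq ?window_uniq // => j j' /=; lia.
- move=> m _ mJ; have {}mJ : ~~ (- J%:Z <= -1 - m <= J%:Z).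
    rewrite -mem_window; apply: contra mJ => mJ; apply/mapP; exists (- 1 - m) => //; lia.
  rewrite termE; case: (ltP (-1 - m) (- J%:Z)) => mJ'.
    by rewrite vertex_eq0 ?linear0 ?tensr0l //; lia.
  by rewrite /fpsi /psi (@vertex_eq0 _ (phi_gram C)) ?linear0 ?tensr0r //; lia.
Qed.

Definition ds_diff : VAB -> VAB := seal \o @d_DS0 C \o unseal.
HB.instance Definition _ :=
  GRing.isLinear.Build C (fock2 C) (fock2 C) *:%R (@d_DS0 C) (@d_DS0P C).
HB.instance Definition _ := GRing.Linear.on ds_diff.

Lemma ds_diffE x : ds_diff (seal x) = seal (d_DS0 x).
Proof. by rewrite /ds_diff /= sealK. Qed.

Lemma seal_expv l (beta : 'rV[C]_l) :
  seal (expv beta) = bvec C ((mset0, beta) : fock_basis C l).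
Proof. exact: seal_basis. Qed.

Lemma seal_expvD l (beta beta' : 'rV[C]_l) :
  seal (expv beta + expv beta') = bvec C ((mset0, beta) : fock_basis C l) +
    bvec C ((mset0, beta') : fock_basis C l).
Proof.
apply: etrans (linearD seal _ _) _.
by rewrite -!seal_expv.
Qed.

Lemma seal_basisD (K : choiceType) (b b' : K) :
  seal (<< b >> + << b' >> : {malg C[K]}) = bvec C b + bvec C b'.
Proof. by rewrite -!seal_basis; exact: linearD. Qed.

Lemma d_DSE : d_DS C =
  << ((mset0, c), (mset0, phi)) : AB >> + << ((mset0, 0), (mset0, phi)) : AB >>.
Proof.
apply: seal_inj; rewrite seal_basisD /d_DS seal_tens.
rewrite seal_expvD.
rewrite seal_expv.
rewrite tensrDl.
by rewrite !tensr_bvec.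
Qed.

Lemma lin_ext_basisD (K : choiceType) (V : lmodType C) (f : K -> V) (b b' : K) :
  lin_ext f (<< b >> + << b' >>) = f b + f b'.
Proof. by rewrite linearD /= !lin_extU. Qed.

Lemma sealD (K : choiceType) (x y : {malg C[K]}) : seal (x + y) = seal x + seal y.
Proof. exact: linearD. Qed.

Lemma ds_diff_bvec (r i : int) (a : fock_basis C 2) (b : fock_basis C 1) (J : nat) :
  pairing G c a.2 = r%:~R -> b.2 = i%:~R *: phi ->
  wt a + wt b + `|r| + `|i| + 1 <= J%:Z ->
  ds_diff (bvec C (a, b)) = dwin r i J (bvec C (a, b)).
Proof.
move=> ca bi leJ; have h0 : pairing G 0 a.2 = 0%:~R by rewrite -(scale0r c) pairingZl mul0r.
have leJ0 : wt a + wt b + `|0%Z| + `|i| + 1 <= J%:Z by lia.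
rewrite -{1}seal_basis ds_diffE d_DS0_basis d_DSE.
apply: etrans (congr1 seal (lin_ext_basisD _ _ _)) _.
apply: etrans (sealD _ _) _.
apply: etrans (congr2 +%R (seal_ds_term ca bi leJ) (seal_ds_term h0 bi leJ0)) _.
rewrite -tensr_bvec dwin_tensr -big_split /=; apply: eq_bigr => j _.
by rewrite vertex_zero shift0 subr0 -tensrDl.
Qed.

Lemma ds_diff_dwin (r : int) (beta0 : 'rV[C]_2) i z :
  pairing G c beta0 = r%:~R -> supported (cochain_basis beta0 i) z ->
  exists J0, forall J : nat, (J0 <= J)%N -> ds_diff z = dwin r i J z.
Proof.
move=> cb; apply: (@supported_ind C _ _ (fun z => exists J0 : nat,
  forall J : nat, (J0 <= J)%N -> ds_diff z = dwin r i J z)).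
  by exists 0%N => J _; rewrite !linear0.
move=> e [a b] x [[n /= an] bi] [J1 x1].
exists (maxn J1 (absz (wt a + wt b + `|r| + `|i| + 1))) => J.
rewrite geq_max => /andP[leJ1 leJ]; rewrite !linearP /= (x1 J leJ1).
rewrite (@ds_diff_bvec r i a b J) //.
  (* The value [r] of [<c, ->] is constant on the coset because [<c, c> = 0]. *)
  by rewrite an pairingDr pairingZr pairing_cc mulr0 addr0.
by have [wa wb] := (wt_ge0 a, wt_ge0 b); lia.
Qed.

End Differential.

Section Subquotient.
Context (C : fieldType) (V : lmodType C) (Z B : submodClosed V).

Lemma subquot_pi_eq0 (x : subspace_of Z) : (subquot_pi B x == 0) = (val x \in B).
Proof. by rewrite -(raddf0 (subquot_pi B)) subquot_eqP (raddf0 val) subr0. Qed.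

Lemma subquot_piZ e (x y : subspace_of Z) : val x - e *: val y \in B ->
  subquot_pi B x = e *: subquot_pi B y.
Proof.
move=> xyB; rewrite [RHS](subquot_scaleE B e y); apply/eqP.
by rewrite subquot_eqP GRing.valZ.
Qed.

End Subquotient.

(** * Cohomology of the modules *)

Section Cochains.
Context {C : numFieldType}.
Local Notation AB := (fock_basis C 2 * fock_basis C 1)%type.
Local Notation VAB := (free_module C AB).
Local Notation G := (cd_gram C).
Local Notation c := (cv C).
Local Notation phi := (phi C).
Implicit Type (i : int).

(** The common form of all the modules considered; the cohomology depends on them only through the
    coset and the value of [<c, beta0>]. *)
Definition spans_coset (beta0 : 'rV[C]_2) (N : set (fock C 2)) : Prop :=
  forall x, N x <-> supported (fun b => same_coset beta0 b.2) (seal x).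

Lemma Pi0_coset : spans_coset 0 (Pi0 C).
Proof.
move=> x; rewrite supported_seal.
by split=> xP b /xP [n e]; exists n; rewrite e add0r.
Qed.

Lemma Pi_coset k (r : int) lambda :
  spans_coset (r%:~R *: muv k + lambda *: c) (Pi k r lambda).
Proof.
move=> x; set nu := _ + _; split=> [[y /Pi0_coset yP <-]|xP].
  rewrite seal_mul_expv; apply: supported_linear yP => b [n e].
  by rewrite /= shiftE; apply: supportedU; exists n; rewrite /= e add0r addrC.
exists (unseal (shift (- nu) (seal x))).
  apply/Pi0_coset; rewrite unsealK; apply: supported_linear xP => b [n e].
  rewrite /= shiftE; apply: supportedU; exists n.
  by rewrite /= e add0r addrAC subrr add0r.
by apply: seal_inj; rewrite seal_mul_expv unsealK shiftD addNr shift0.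
Qed.

Lemma tens_basis (a : fock_basis C 2) (b : fock_basis C 1) :
  tens << a >> << b >> = << (a, b) >> :> fock2 C.
Proof.
apply: seal_inj; rewrite seal_tens.
by rewrite (seal_basis a) (seal_basis b) tensr_bvec; exact/esym/seal_basis.
Qed.

Lemma cochains_supported beta0 N i x : spans_coset beta0 N ->
  cochains N i x <-> supported (cochain_basis beta0 i) (seal x).
Proof.
move=> NP; split=> [[s sP ->]|].
  rewrite (_ : seal _ = \sum_(q <- s) tensr (seal q.1) (seal q.2)); last first.
    apply: etrans (linear_sum seal _ _ _) _.
    by apply: eq_bigr => q _; rewrite seal_tens.
  apply: supported_sum_seq => q /sP [/NP q1 /supported_seal q2].
  exact: supported_tensr q1 q2.
rewrite -{2}(sealK x); move: (seal x).
apply: (@supported_ind C _ _ (fun v => cochains N i (unseal v))).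
  by rewrite linear0; exact: cochains0.
move=> e [a b] v [a0 bi] IH.
have -> : unseal (e *: bvec C (a, b) + v) = e *: << (a, b) >> + unseal v.
  by rewrite -unseal_bvec; exact: linearP.
apply: cochains_closed IH; exists [:: (<< a >>, << b >>)]; last first.
  by rewrite big_seq1 tens_basis.
move=> q; rewrite inE => /eqP -> /=; split.
  by apply/NP; rewrite seal_basis; apply: supportedU.
by apply/supported_seal; rewrite seal_basis; apply: supportedU.
Qed.

End Cochains.

Section Conclusions.
Context {C : numFieldType}.
Local Notation G := (cd_gram C).
Local Notation c := (cv C).
Local Notation phi := (phi C).
Implicit Type (i : int).

Section Coset.
Variables (beta0 : 'rV[C]_2) (N : set (fock C 2)).
Hypothesis N_coset : spans_coset beta0 N.
Local Notation cochain i := (supported (cochain_basis beta0 i)).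

Lemma cocyclesP i x :
  reflect (cochain i (seal x) /\ ds_diff (seal x) = 0) (x \in cocycles N i).
Proof.
apply: (iffP (asboolP _)) => -[xi dx].
  split; first exact/(cochains_supported i x N_coset).
  by rewrite ds_diffE dx linear0.
split; first exact/(cochains_supported i x N_coset).
by apply: seal_inj; rewrite linear0 -ds_diffE.
Qed.

Lemma coboundariesP i x :
  reflect (exists2 y, cochain (i - 1) y & seal x = ds_diff y)
    (x \in coboundaries N i).
Proof.
apply: (iffP (asboolP _)) => -[y yi xy].
  exists (seal y); first exact/(cochains_supported _ _ N_coset).
  by rewrite ds_diffE xy.
exists (unseal y); first by apply/(cochains_supported _ _ N_coset); rewrite unsealK.
by apply: seal_inj; rewrite xy -ds_diffE unsealK.
Qed.

Lemma H_DS_eq0 i :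
  (forall x, cochain i x -> ds_diff x = 0 ->
    exists2 y, cochain (i - 1) y & x = ds_diff y) ->
  forall q : H_DS N i, q = 0.
Proof.
move=> exact_i q; rewrite -[q]subquot_reprK; apply/eqP; rewrite subquot_pi_eq0.
have /cocyclesP [xi dx] := valP (repr q).
by apply/coboundariesP; exact: exact_i.
Qed.

Lemma H_DS_line (v : fock C 2) : pairing G c beta0 = 0 ->
  seal v = bvec C ((mset0, beta0) : fock_basis C 2) ->
  H_DS_delta0_line N v.
Proof.
move=> cb vE.
have ds_dwin i z : cochain i z ->
    exists J0, forall J : nat, (J0 <= J)%N -> ds_diff z = dwin 0 i J z.
  exact: ds_diff_dwin.
have xE : seal (tens v (expv 0)) = vac beta0 0.
  by rewrite seal_tens vE seal_expv tensr_bvec /vac scale0r.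
have vac0 : cochain 0 (vac beta0 0).
  by have := cochain_vac beta0 0 0; rewrite scale0r addr0.
have xZ : tens v (expv 0) \in cocycles N 0.
  by apply/cocyclesP; rewrite xE; split=> //; exact: dd_vac0 ds_dwin _.
(* Since the vector is a cocycle, the default value in [DS_class] does not occur. *)
have [u clE uE] : exists2 u : subspace_of (cocycles N 0),
    DS_class N 0 (tens v (expv 0)) = subquot_pi (coboundaries N 0) u &
    val u = tens v (expv 0).
  by exists (insubd (0 : subspace_of (cocycles N 0)) (tens v (expv 0))) => //;
     exact: insubdK.
split=> //.
- rewrite clE subquot_pi_eq0 uE; apply/coboundariesP => -[y yi].
  by rewrite xE; apply/eqP; exact: vac_not_exact yi.
- apply/seteqP; split=> // q _.
  have /cocyclesP [xi dx] := valP (repr q).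
  have [e [y yi xy]] := vacuum_generates ds_dwin xi dx.
  exists e => //; rewrite clE -[RHS]subquot_reprK; apply/esym/subquot_piZ.
  apply/coboundariesP; exists y => //.
  rewrite uE; apply: etrans (linearB seal _ _) _.
  rewrite xy [X in _ - X](linearZ_LR seal).
  by rewrite /= xE addrC addKr.
- move=> i i0; apply/seteqP; split=> // q _.
  by apply: (@H_DS_eq0 i) => x; exact: exact_neutral.
Qed.

Lemma H_DS_total0 (r : int) : pairing G c beta0 = r%:~R -> r != 0 ->
  H_DS_total N = [set (fun=> 0)]%classic.
Proof.
move=> cb r0; have H0 i (q : H_DS N i) : q = 0.
  by apply: H_DS_eq0 => x; apply: (exact_charged _ r0) => j z; exact: ds_diff_dwin.
apply/seteqP; split=> [f _|_ ->] /=; first by apply: functional_extensionality_dep => i; exact: H0.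
by apply: sub_finite_set (finite_set0 int) => i /=; rewrite eqxx.
Qed.

End Coset.

Lemma pairing_muv k : pairing G c (muv k) = 1.
Proof.
by rewrite pairingDr !pairingZr pairing_cc pairing_cd mulr0 addr0 mulVf ?pnatr_eq0.
Qed.

End Conclusions.

Local Open Scope complex_scope.

Theorem proposition7 (R : realType) (p : nat) (hp : (2 <= p)%N)
    (lambda : R[i]) (r : int) :
  let k : R[i] := - 2 + p%:R^-1 in
  [/\ H_DS_delta0_line (Pi0 R[i]) (expv 0),
      H_DS_delta0_line (Pi k 0 lambda) (expv (lambda *: cv R[i])) &
      r != 0 -> H_DS_total (Pi k r lambda) = [set (fun=> 0)]%classic].
Proof.
move=> k; split.
- apply: (H_DS_line Pi0_coset); first by rewrite -(scale0r (cv R[i])) pairingZr mul0r.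
  exact: seal_expv.
- apply: (H_DS_line (Pi_coset k 0 lambda)).
    by rewrite scale0r add0r pairingZr pairing_cc mulr0.
  by rewrite scale0r add0r; exact: seal_expv.
- apply: (H_DS_total0 (Pi_coset k r lambda)).
  (* The sector is [<c, r mu + lambda c> = r], from [<c, mu> = 1] and [<c, c> = 0]. *)
  by rewrite pairingDr !pairingZr pairing_muv pairing_cc mulr0 addr0 mulr1.
Qed.
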